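(* Let $\omega$ be a Kähler form with constant coefficients on $\mathbb{C}^n$. Let $p,q,m$ be integers with $0\le p,q\le p+q\le m\le n$. Let $\alpha_1,\dots,\alpha_{m-p-q+1}$ be real $(1,1)$-forms with constant coefficients on $\mathbb{C}^n$, each semipositive and $m$-positive with respect to $\omega$. Put $\Omega=\omega^{n-m}\wedge\alpha_1\wedge\cdots\wedge\alpha_{m-p-q}$, let $\Lambda^{p,q}$ be the space of complex $(p,q)$-forms with constant coefficients on $\mathbb{C}^n$, and $$P^{p,q}=\{\Phi\in\Lambda^{p,q} : \Omega\wedge\alpha_{m-p-q+1}\wedge\Phi=0\}.$$ Let $\Gamma$ be a fixed positive volume form (constant coefficients) on $\mathbb{C}^n$ and define $Q(\Phi,\Psi)=i^{q-p}(-1)^{(p+q)(p+q+1)/2}\,\Omega\wedge\Phi\wedge\overline{\Psi}/\Gamma$ for $\Phi,\Psi\in\Lambda^{p,q}$. Then $Q$ is positive definite on $P^{p,q}$.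
   Context: A real $(1,1)$-form $\alpha$ with constant coefficients is $m$-positive with respect to $\omega$ if $\alpha^k\wedge\omega^{n-k}>0$ (a positive multiple of the standard volume form) for every $1\le k\le m$. Semipositive means positive semidefinite. For a top-degree form $\Theta$, $\Theta/\Gamma$ denotes the complex number $c$ with $\Theta=c\Gamma$. *)

(* Defs.v *)
(* constant-coefficient complex differential forms on C^n,
   represented through their coefficients in the basis of the exterior algebra
   generated by dz_1,...,dz_n, dzbar_1,...,dzbar_n.  The complex numbers are
   R[i] for an arbitrary model R of the reals (R : realType). *)
From HB Require Import structures.
From mathcomp Require Import all_boot all_order all_algebra complex.
From mathcomp Require Import reals.
Set Implicit Arguments. Unset Strict Implicit. Unset Printing Implicit Defensive.
Import Order.TTheory GRing.Theory Num.Theory.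
Local Open Scope ring_scope.

Section Forms.
Variable R : realType.
Local Notation C := R[i].
Variable n : nat.

(* Index of the basis 1-forms: inl j = dz_j, inr j = dzbar_j. *)
Definition idx := ('I_n + 'I_n)%type.

(* Canonical ordering of basis 1-forms: dz_1 < dzbar_1 < dz_2 < dzbar_2 < ... *)
Definition rk (x : idx) : nat :=
  match x with inl j => (2 * j)%N | inr j => (2 * j).+1 end.

(* A constant-coefficient form: its coefficient on each basis monomial
   dx_{k1} /\ ... /\ dx_{kr} (k1 < ... < kr in the order rk), indexed by the set
   {k1,...,kr}. *)
Definition cform := {ffun {set idx} -> C}.

Definition shuffle_sign (I J : {set idx}) : C :=
  (-1) ^+ #|[set x in setX I J | (rk x.2 < rk x.1)%N]|.

Definition wedge (a b : cform) : cform :=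
  [ffun K => \sum_(I : {set idx}) \sum_(J : {set idx} |
       (I :|: J == K) && [disjoint I & J]) shuffle_sign I J * a I * b J].

Definition one_form : cform := [ffun K => (K == set0)%:R].

Definition e1 (x : idx) : cform := [ffun K => (K == [set x])%:R].

Definition wpow (a : cform) (k : nat) : cform := iter k (wedge a) one_form.

Definition swap_idx (x : idx) : idx :=
  match x with inl j => inr j | inr j => inl j end.

Definition monomial (s : seq idx) : cform := foldr wedge one_form (map e1 s).

Definition conj_form (a : cform) : cform :=
  \sum_(I : {set idx})
     Num.conj (a I) *:
       monomial (map swap_idx (sort (fun x y => (rk x <= rk y)%N) (enum I))).

Definition holo (I : {set idx}) : {set 'I_n} := [set j | inl j \in I].
Definition antiholo (I : {set idx}) : {set 'I_n} := [set j | inr j \in I].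
Definition is_pq (p q : nat) (a : cform) : Prop :=
  forall I, a I != 0 -> #|holo I| = p /\ #|antiholo I| = q.

Definition iC : C := Complex 0 1.

(* The real (1,1)-cform  i * sum_{j,k} h_{jk} dz_j /\ dzbar_k  attached to a
   matrix h; it is real iff h is Hermitian. *)
Definition form11 (h : 'M[C]_n) : cform :=
  \sum_(j < n) \sum_(k < n) (iC * h j k) *: wedge (e1 (inl j)) (e1 (inr k)).

Definition is_hermitian (h : 'M[C]_n) : Prop :=
  forall j k, h k j = Num.conj (h j k).
Definition is_psd (h : 'M[C]_n) : Prop :=
  forall v : 'I_n -> C,
    0 <= \sum_(j < n) \sum_(k < n) Num.conj (v j) * h j k * v k.
Definition is_posdef (h : 'M[C]_n) : Prop :=
  forall v : 'I_n -> C, (exists j, v j != 0) ->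
    0 < \sum_(j < n) \sum_(k < n) Num.conj (v j) * h j k * v k.

(* Standard volume cform (i dz_1/\dzbar_1) /\ ... /\ (i dz_n/\dzbar_n)
   = 2^n dx_1/\dy_1/\.../\dx_n/\dy_n. *)
Definition std_vol : cform :=
  \big[wedge/one_form]_(k < n) (iC *: wedge (e1 (inl k)) (e1 (inr k))).

Definition top_pos (T : cform) : Prop := exists c : C, 0 < c /\ T = c *: std_vol.

(* Theta / Gamma for top-degree forms: the c with Theta = c Gamma. *)
Definition top_ratio (T G : cform) : C := T setT / G setT.

Definition m_positive (m : nat) (alpha omega : cform) : Prop :=
  forall k, (1 <= k <= m)%N -> top_pos (wedge (wpow alpha k) (wpow omega (n - k))).

End Forms.

(* Main.v *)
Require Import Defs.
From HB Require Import structures.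
From mathcomp Require Import all_boot all_order all_algebra complex.
From mathcomp Require Import reals spectral ring lra zify ssrAC.
From mathcomp Require classical_sets.
Set Implicit Arguments. Unset Strict Implicit. Unset Printing Implicit Defensive.
Import Order.TTheory GRing.Theory Num.Theory.
Local Open Scope ring_scope.

(** The forms are allowed to be more degenerate than in the statement, which makes an
    induction on n possible: for (p,q)-forms and real (1,1)-forms b_0, ..., b_N on
    C^n with N = n - p - q, it suffices that b_i is semipositive of rank at least
    p + q + i.

    Hard Lefschetz in dimension n + 1 follows from Hodge-Riemann in dimension n, as
    in Timorin's argument. Write b_1 as a sum of i dz_j dzbar_j, j in J; if
    b_1 ... b_N Phi = 0, then the restriction of Phi to each hyperplane z_j = 0 is
    primitive for the restricted forms, so 0 = b_1 ... b_N Phi Phibar is a sum of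
    terms of the same sign. Hence Phi vanishes on all these hyperplanes, and
    Phi = 0 because #|J| > p + q. The rank condition is inherited since the rank of
    a semipositive form drops by at most one on a hyperplane.

    Hodge-Riemann then follows by deforming the forms linearly to a convenient base
    point: by hard Lefschetz the Hermitian form stays nondegenerate on the primitive
    space, hence stays positive. At the base point all forms but the last are the
    standard Kaehler form s of C^n, the last one is s + i dz dzbar, and Hodge-Riemann
    in dimension n + 1 reduces to dimension n by splitting
    Phi = a + dz u + dzbar v + (i dz dzbar) b and completing the square with
    c = a + s b. *)

(** * Exterior algebra *)

(** The m-positivity enters through a rank: a semipositive form of rank r is, in suitable
    coordinates, a sum of r commuting forms of square zero, so its (r+1)-st power vanishes; hence an
    m-positive form has rank at least m. The required rank p + q + i grows with i because hard
    Lefschetz drops b_0: then b_1 has rank at least p + q + 1, and on a hyperplane it has the rank p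
    + q that Hodge-Riemann asks of the first form. Nondegeneracy along the path uses hard Lefschetz
    twice. The primitive space is the orthogonal of the products of b_0 with (p-1,q-1)-forms. The
    Hermitian form is nondegenerate on all (p,q)-forms by hard Lefschetz for b_1, ..., b_N, and on
    these products by hard Lefschetz for b_0, b_0, b_1, ..., b_N in bidegree (p-1,q-1). The
    primitive space moves along the path, so positivity is not followed on it: [prim_form] is a form
    on all (p,q)-forms that is positive definite exactly when the original one is positive on
    primitive forms. The base point may be degenerate because rank n suffices in dimension n + 1 at
    every position but the last. *)

Lemma sum_disjointU (T : finType) (A B : {set T}) (F : T -> nat) :
  [disjoint A & B] ->
  (\sum_(x in A :|: B) F x = \sum_(x in A) F x + \sum_(x in B) F x)%N.
Proof. by move=> dAB; rewrite -bigU //=; apply: eq_bigl => x; rewrite !inE. Qed.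

Lemma disjoint_setUl (T : finType) (A B D : {set T}) :
  [disjoint A :|: B & D] = [disjoint A & D] && [disjoint B & D].
Proof. by rewrite !disjoints_subset subUset. Qed.

Lemma disjoint_setUr (T : finType) (A B D : {set T}) :
  [disjoint D & A :|: B] = [disjoint D & A] && [disjoint D & B].
Proof. by rewrite ![[disjoint D & _]]disjoint_sym disjoint_setUl. Qed.

Section ExteriorAlgebra.
Variables (R : realType) (n : nat).
Local Notation C := R[i].
Local Notation idx := (idx n).
Implicit Types (I J K : {set idx}) (x y : idx).

(** A fresh name for [cform], so that structure inference finds the exterior algebra built below and
    not the pointwise structure of finite functions. *)
Definition extalg := cform R n.
HB.instance Definition _ := Choice.copy extalg (cform R n).
Implicit Types (a b c : extalg).

(* The operations are locked: otherwise unification tries to evaluate finite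
   functions over [{set idx}]. *)
Definition cf a I : C := locked (fun (a : cform R n) I => a I) a I.
Definition ext_zero : extalg := locked (0 : cform R n).
Definition ext_opp a : extalg := locked (fun a : cform R n => - a) a.
Definition ext_add a b : extalg := locked (fun a b : cform R n => a + b) a b.
Definition ext_scale (k : C) a : extalg :=
  locked (fun k (a : cform R n) => k *: a) k a.
Definition ext_one : extalg := locked (one_form R n).
Definition ext_mul a b : extalg := locked (@wedge R n) a b.
Definition eb I : extalg := locked (fun I => [ffun K => (K == I)%:R] : cform R n) I.

Lemma cfE a I : cf a I = (a : cform R n) I.
Proof. by rewrite /cf -lock. Qed.

Lemma ext_eqP a b : (forall I, cf a I = cf b I) -> a = b.
Proof. by move=> eq_ab; apply/ffunP => I; rewrite -!cfE. Qed.

Let cf0' I : cf ext_zero I = 0.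
Proof. by rewrite cfE /ext_zero -lock ffunE. Qed.
Let cfN' a I : cf (ext_opp a) I = - cf a I.
Proof. by rewrite !cfE /ext_opp -lock ffunE. Qed.
Let cfD' a b I : cf (ext_add a b) I = cf a I + cf b I.
Proof. by rewrite !cfE /ext_add -lock ffunE. Qed.
Let cfZ' k a I : cf (ext_scale k a) I = k * cf a I.
Proof. by rewrite !cfE /ext_scale -lock ffunE. Qed.

Let extDA : associative ext_add.
Proof. by move=> a b c; apply: ext_eqP => I; rewrite !cfD' addrA. Qed.
Let extDC : commutative ext_add.
Proof. by move=> a b; apply: ext_eqP => I; rewrite !cfD' addrC. Qed.
Let ext0D : left_id ext_zero ext_add.
Proof. by move=> a; apply: ext_eqP => I; rewrite cfD' cf0' add0r. Qed.
Let extND : left_inverse ext_zero ext_opp ext_add.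
Proof. by move=> a; apply: ext_eqP => I; rewrite cfD' cfN' cf0' addNr. Qed.
HB.instance Definition _ := GRing.isZmodule.Build extalg extDA extDC ext0D extND.

Let extZA k l a : ext_scale k (ext_scale l a) = ext_scale (k * l) a.
Proof. by apply: ext_eqP => I; rewrite !cfZ' mulrA. Qed.
Let extZ1 : left_id 1 ext_scale.
Proof. by move=> a; apply: ext_eqP => I; rewrite cfZ' mul1r. Qed.
Let extZDr : right_distributive ext_scale +%R.
Proof. by move=> k a b; apply: ext_eqP => I; rewrite !(cfD', cfZ') mulrDr. Qed.
Let extZDl a : {morph ext_scale^~ a : k l / k + l}.
Proof. by move=> k l; apply: ext_eqP => I; rewrite !(cfD', cfZ') mulrDl. Qed.
HB.instance Definition _ :=
  GRing.Zmodule_isLmodule.Build C extalg extZA extZ1 extZDr extZDl.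

Lemma cf0 I : cf 0 I = 0. Proof. exact: cf0'. Qed.
Lemma cfN a I : cf (- a) I = - cf a I. Proof. exact: cfN'. Qed.
Lemma cfD a b I : cf (a + b) I = cf a I + cf b I. Proof. exact: cfD'. Qed.
Lemma cfZ k a I : cf (k *: a) I = k * cf a I. Proof. exact: cfZ'. Qed.

Lemma cf_sum (T : Type) (r : seq T) (P : pred T) (F : T -> extalg) I :
  cf (\sum_(i <- r | P i) F i) I = \sum_(i <- r | P i) cf (F i) I.
Proof.
apply: (big_morph (cf^~ I)) => [a b|]; [exact: cfD | exact: cf0].
Qed.

Lemma cf_eb I K : cf (eb I) K = (K == I)%:R.
Proof. by rewrite cfE /eb -lock ffunE. Qed.

Lemma eb_expand a : a = \sum_I cf a I *: eb I.
Proof.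
apply: ext_eqP => K; rewrite cf_sum (bigD1 K) //= cfZ cf_eb eqxx mulr1.
rewrite big1 ?addr0 // => I neIK.
by rewrite cfZ cf_eb eq_sym (negbTE neIK) mulr0.
Qed.

(** The exponent in [shuffle_sign]. It is additive over disjoint unions in each argument, which is
    the source of associativity. *)
Definition inv_count I J := #|[set x in setX I J | (rk x.2 < rk x.1)%N]|.

Lemma inv_countE I J :
  inv_count I J = (\sum_(x in I) \sum_(y in J) (rk y < rk x))%N.
Proof.
rewrite /inv_count -sum1_card pair_big_dep /=.
under eq_bigl do rewrite !inE.
rewrite big_mkcondr /=; apply: eq_bigr => -[x y] _ /=.
by case: (rk y < rk x)%N.
Qed.

Lemma inv_countUl I J K : [disjoint I & J] ->
  inv_count (I :|: J) K = (inv_count I K + inv_count J K)%N.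
Proof. by move=> dIJ; rewrite !inv_countE sum_disjointU. Qed.

Lemma inv_countUr I J K : [disjoint J & K] ->
  inv_count I (J :|: K) = (inv_count I J + inv_count I K)%N.
Proof.
move=> dJK; rewrite !inv_countE -big_split /=.
by apply: eq_bigr => x _; rewrite sum_disjointU.
Qed.

Lemma shuffle_signE I J : shuffle_sign R I J = (-1) ^+ inv_count I J.
Proof. by []. Qed.

Definition ebmul I J : extalg :=
  if [disjoint I & J] then shuffle_sign R I J *: eb (I :|: J) else 0.

Let mulE a b : ext_mul a b = \sum_I \sum_J (cf a I * cf b J) *: ebmul I J.
Proof.
apply: ext_eqP => K; rewrite cfE /ext_mul -lock ffunE cf_sum.
apply: eq_bigr => I _; rewrite cf_sum big_mkcond; apply: eq_bigr => J _.
rewrite cfZ /ebmul -[a I]cfE -[b J]cfE; case: ifP => [/andP[/eqP <- ->]|].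
  by rewrite cfZ cf_eb eqxx mulr1 -mulrA mulrC.
case: (boolP [disjoint I & J]) => dIJ; last by rewrite cf0 mulr0.
by rewrite andbT cfZ cf_eb eq_sym => ->; rewrite !mulr0.
Qed.

Let wedgeDl a b c : ext_mul (a + b) c = (ext_mul a c + ext_mul b c).
Proof.
rewrite !mulE -big_split /=; apply: eq_bigr => I _.
rewrite -big_split /=; apply: eq_bigr => J _.
by rewrite cfD mulrDl scalerDl.
Qed.

Let wedgeDr a b c : ext_mul a (b + c) = (ext_mul a b + ext_mul a c).
Proof.
rewrite !mulE -big_split /=; apply: eq_bigr => I _.
rewrite -big_split /=; apply: eq_bigr => J _.
by rewrite cfD mulrDr scalerDl.
Qed.

Let wedgeZl (k : C) a b : ext_mul (k *: a) b = (k *: ext_mul a b).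
Proof.
rewrite !mulE scaler_sumr; apply: eq_bigr => I _.
rewrite scaler_sumr; apply: eq_bigr => J _.
by rewrite cfZ scalerA mulrA.
Qed.

Let wedgeZr (k : C) a b : ext_mul a (k *: b) = (k *: ext_mul a b).
Proof.
rewrite !mulE scaler_sumr; apply: eq_bigr => I _.
rewrite scaler_sumr; apply: eq_bigr => J _.
by rewrite cfZ scalerA mulrCA.
Qed.

Let wedge0l a : ext_mul 0 a = 0.
Proof. by have := wedgeZl 0 0 a; rewrite !scale0r. Qed.

Let wedge0r a : ext_mul a 0 = 0.
Proof. by have := wedgeZr 0 a 0; rewrite !scale0r. Qed.

Let wedge_suml (T : Type) (r : seq T) (P : pred T) (F : T -> extalg) b :
  ext_mul (\sum_(i <- r | P i) F i) b = \sum_(i <- r | P i) (ext_mul (F i) b).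
Proof.
apply: (big_morph (ext_mul^~ b)) => [c d|].
  exact: wedgeDl.
exact: wedge0l.
Qed.

Let wedge_sumr (T : Type) (r : seq T) (P : pred T) (F : T -> extalg) b :
  ext_mul b (\sum_(i <- r | P i) F i) = \sum_(i <- r | P i) (ext_mul b (F i)).
Proof.
apply: (big_morph (ext_mul b)) => [c d|].
  exact: wedgeDr.
exact: wedge0r.
Qed.

Let wedge_eb I J : ext_mul (eb I) (eb J) = ebmul I J.
Proof.
rewrite mulE (bigD1 I) //= [X in _ + X]big1 ?addr0 => [|K /negbTE neKI].
  rewrite (bigD1 J) //= [X in _ + X]big1 ?addr0 => [|K /negbTE neKJ].
    by rewrite !cf_eb !eqxx mulr1 scale1r.
  by rewrite [cf (eb J) K]cf_eb neKJ mulr0 scale0r.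
by rewrite big1 // => L _; rewrite [cf (eb I) K]cf_eb neKI mul0r scale0r.
Qed.

(** Both sides vanish unless the three sets are pairwise disjoint; otherwise both signs count the
    inversions of the pairs (I,J), (I,K) and (J,K). *)
Let wedge_ebA I J K :
  ext_mul (eb I) (ext_mul (eb J) (eb K)) = ext_mul (ext_mul (eb I) (eb J)) (eb K).
Proof.
rewrite !wedge_eb /ebmul.
case: (boolP [disjoint J & K]) => dJK; last first.
  rewrite wedge0r; case: ifP => dIJ; last by rewrite wedge0l.
  by rewrite wedgeZl wedge_eb /ebmul disjoint_setUl (negbTE dJK) andbF scaler0.
case: (boolP [disjoint I & J]) => dIJ; last first.
  rewrite wedge0l wedgeZr wedge_eb /ebmul.
  by rewrite disjoint_setUr (negbTE dIJ) scaler0.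
rewrite wedgeZl wedgeZr !wedge_eb /ebmul disjoint_setUl disjoint_setUr dJK dIJ.
rewrite andbT andTb; case: ifP => dIK; last by rewrite !scaler0.
rewrite !scalerA setUA !shuffle_signE -!exprD.
rewrite inv_countUl // inv_countUr //; congr (_ ^+ _ *: _); lia.
Qed.

Let wedgeA : associative ext_mul.
Proof.
move=> a b c; rewrite [a]eb_expand [b]eb_expand [c]eb_expand.
rewrite !wedge_suml; apply: eq_bigr => I _.
rewrite wedge_sumr [X in _ = ext_mul X _]wedge_sumr wedge_suml.
apply: eq_bigr => J _; rewrite !wedge_sumr; apply: eq_bigr => K _.
by rewrite !(wedgeZl, wedgeZr) wedge_ebA !scalerA; congr (_ *: _); ring.
Qed.

Lemma inv_count0l J : inv_count set0 J = 0%N.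
Proof. by rewrite inv_countE big_set0. Qed.

Lemma inv_count0r J : inv_count J set0 = 0%N.
Proof. by rewrite inv_countE big1 // => x _; rewrite big_set0. Qed.

Let extE1 : ext_one = eb set0.
Proof. by apply: ext_eqP => I; rewrite cf_eb cfE /ext_one -lock ffunE. Qed.

Let wedge1l : left_id ext_one ext_mul.
Proof.
move=> a; rewrite extE1 [a in LHS]eb_expand wedge_sumr [RHS]eb_expand.
apply: eq_bigr => I _; rewrite wedgeZr wedge_eb /ebmul.
by rewrite disjoints_subset sub0set set0U shuffle_signE inv_count0l scale1r.
Qed.

Let wedge1r : right_id ext_one ext_mul.
Proof.
move=> a; rewrite extE1 [a in LHS]eb_expand wedge_suml [RHS]eb_expand.
apply: eq_bigr => I _; rewrite wedgeZl wedge_eb /ebmul disjoint_sym.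
by rewrite disjoints_subset sub0set setU0 shuffle_signE inv_count0r scale1r.
Qed.

Let one_form_neq0 : ext_one != 0.
Proof.
apply/eqP => /(congr1 (cf^~ set0)); rewrite extE1 cf0 cf_eb eqxx => /eqP.
by rewrite oner_eq0.
Qed.

HB.instance Definition _ := GRing.Zmodule_isNzRing.Build extalg
  wedgeA wedge1l wedge1r wedgeDl wedgeDr one_form_neq0.
HB.instance Definition _ :=
  GRing.Lmodule_isLalgebra.Build C extalg (fun k a b => esym (wedgeZl k a b)).
HB.instance Definition _ :=
  GRing.Lalgebra_isAlgebra.Build C extalg (fun k a b => esym (wedgeZr k a b)).

Lemma mul_ebE I J : eb I * eb J = ebmul I J. Proof. exact: wedge_eb. Qed.

Lemma cfM a b K : cf (a * b) K = \sum_(I : {set idx}) \sum_(J : {set idx} |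
  (I :|: J == K) && [disjoint I & J]) shuffle_sign R I J * cf a I * cf b J.
Proof.
rewrite cfE -[_ * _]/(ext_mul a b) /ext_mul -lock ffunE.
by apply: eq_bigr => I _; apply: eq_bigr => J _; rewrite !cfE.
Qed.

Lemma ext_oneE : 1 = eb set0. Proof. exact: extE1. Qed.

End ExteriorAlgebra.

(** * Generators and the universal property of the exterior algebra *)

Section Generators.
Variables (R : realType) (n : nat).
Local Notation C := R[i].
Local Notation idx := (idx n).
Local Notation extalg := (extalg R n).
Local Notation eb := (@eb R n).
Implicit Types (I J K : {set idx}) (x y : idx) (a b c : extalg).

Definition gen x : extalg := eb [set x].

Lemma genE x : gen x = eb [set x]. Proof. by []. Qed.

Lemma rk_inj : injective (@rk n).
Proof.
move=> [i|i] [j|j] /= h; try lia; congr (_ _); apply: val_inj => /=; lia.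
Qed.

Lemma gen_eb x J : gen x * eb J =
  if x \in J then 0 else (-1) ^+ (\sum_(y in J) (rk y < rk x))%N *: eb (x |: J).
Proof.
rewrite genE mul_ebE /ebmul disjoints1.
case: ifP => [/negbTE ->|/negbFE -> //].
by rewrite shuffle_signE inv_countE big_set1.
Qed.

Lemma gen_anticomm x y : gen x * gen y = - (gen y * gen x).
Proof.
rewrite [X in gen x * X]genE [X in gen y * X]genE !gen_eb !inE [y == x]eq_sym.
case: eqP => [|/eqP nexy]; first by rewrite oppr0.
rewrite !big_set1 setUC -scaleNr.
have : rk x != rk y by rewrite (inj_eq rk_inj).
by case: ltngtP => //= _ _; rewrite ?expr1 ?expr0 ?opprK.
Qed.

(** All indices in increasing order of [rk], so that a product of generators along this list is a
    basis monomial without any sign. *)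
Definition allidx : seq idx := flatten [seq [:: inl k; inr k] | k <- enum 'I_n].

Lemma map_rk_allidx : map (@rk n) allidx = iota 0 n.*2.
Proof.
rewrite /allidx map_flatten -map_comp.
transitivity (flatten [seq [:: k.*2; k.*2.+1] | k <- map val (enum 'I_n)]).
  by rewrite -map_comp; congr flatten; apply: eq_map => k /=; rewrite !mul2n.
rewrite val_enum_ord -[0%N in RHS]/(0.*2)%N.
by elim: n 0%N => //= m IH k; rewrite IH.
Qed.

Lemma sorted_allidx : sorted (fun x y => rk x < rk y)%N allidx.
Proof. by have := iota_ltn_sorted 0 n.*2; rewrite -map_rk_allidx sorted_map. Qed.

Lemma uniq_allidx : uniq allidx.
Proof. by apply: (@map_uniq _ _ (@rk n)); rewrite map_rk_allidx iota_uniq. Qed.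

Lemma mem_allidx x : x \in allidx.
Proof.
apply/flattenP; case: x => k;
  (exists [:: inl k; inr k]; first by apply: map_f; rewrite mem_enum);
  by rewrite !inE eqxx ?orbT.
Qed.

Lemma perm_allidx : perm_eq allidx (index_enum (Finite.clone idx _)).
Proof.
apply: uniq_perm; rewrite ?uniq_allidx ?index_enum_uniq // => x.
by rewrite mem_allidx mem_index_enum.
Qed.

(** Identifies the sorted lists in the definition of [conj_form] with sublists of [allidx]. *)
Lemma sort_enum_set I :
  sort (fun x y => rk x <= rk y)%N (enum I) = [seq x <- allidx | x \in I].
Proof.
apply: (@sorted_eq _ (fun x y => rk x <= rk y)%N).
- by move=> ? ? ?; apply: leq_trans.
- by move=> x y h; apply: rk_inj; apply/eqP; rewrite eqn_leq.
- by apply: sort_sorted => x y; apply: leq_total.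
- apply: sorted_filter; first by move=> ? ? ?; apply: leq_trans.
  by apply: sub_sorted sorted_allidx => x y; apply: ltnW.
- apply: uniq_perm; rewrite ?sort_uniq ?enum_uniq ?filter_uniq ?uniq_allidx //.
  by move=> x; rewrite mem_sort mem_enum mem_filter mem_allidx andbT.
Qed.

Section Hom.
Variables (A : algType C) (f : idx -> A).

(** The universal property of the exterior algebra. The map is linear for every [f], and an algebra
    morphism as soon as the images [f x] anticommute ([homM]). Conjugation, linear changes of
    coordinates and pullback along a projection are all obtained from it. *)
Definition hom a : A := \sum_I cf a I *: \prod_(x <- allidx | x \in I) f x.

Lemma hom_is_linear : linear hom.
Proof.
move=> k a b; rewrite /hom scaler_sumr -big_split /=; apply: eq_bigr => I _.
by rewrite cfD cfZ scalerDl scalerA.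
Qed.
HB.instance Definition _ := GRing.isLinear.Build C extalg A _ hom hom_is_linear.

Lemma hom_eb I : hom (eb I) = \prod_(x <- allidx | x \in I) f x.
Proof.
rewrite /hom (bigD1 I) //= cf_eb eqxx scale1r [X in _ + X]big1 ?addr0 // => J neJI.
by rewrite cf_eb (negbTE neJI) scale0r.
Qed.

Lemma hom1 : hom 1 = 1.
Proof. by rewrite ext_oneE hom_eb big_pred0 // => x; rewrite inE. Qed.

Lemma hom_gen x : hom (gen x) = f x.
Proof.
rewrite genE hom_eb -big_filter.
have -> : [seq y <- allidx | y \in [set x]] = [:: x]; last by rewrite big_seq1.
under eq_filter do rewrite inE.
by rewrite filter_pred1_uniq ?uniq_allidx ?mem_allidx.
Qed.

Hypothesis f_anticomm : forall x y, f x * f y = - (f y * f x).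

Let f_sq x : f x * f x = 0.
Proof.
have /eqP := f_anticomm x x; rewrite -subr_eq0 opprK -mulr2n -scaler_nat.
by rewrite scaler_eq0 pnatr_eq0 /= => /eqP.
Qed.

(** The counterpart of [gen_eb] in the target algebra: [f x] moves right to its place in the sorted
    product, with one sign for each smaller factor that it passes, and meets itself when [x] is
    already there. *)
Lemma mul_prod_insert (L : seq idx) x J :
  sorted (fun y z => rk y < rk z)%N L -> x \in L ->
  f x * \prod_(y <- L | y \in J) f y =
  if x \in J then 0
  else (-1) ^+ (\sum_(y <- L | y \in J) (rk y < rk x))%N
         *: \prod_(y <- L | y \in x |: J) f y.
Proof.
elim: L => //= z L IH sL; rewrite inE.
have tr : transitive (fun y z : idx => rk y < rk z)%N.
  by move=> ? ? ?; apply: ltn_trans.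
have /allP minz := order_path_min tr sL.
have zL : z \notin L by apply/negP => /minz; rewrite ltnn.
rewrite !big_cons !inE; case: (eqVneq x z) => [-> _|nexz /= xL].
  case: ifP => zJ; first by rewrite mulrA f_sq mul0r.
  rewrite /= [(\sum_(j <- L | _) _)%N]big1_seq => [|y /andP[_ /minz ltzy]]; last first.
    by rewrite ltnNge (ltnW ltzy).
  rewrite scale1r; congr (_ * _).
  rewrite big_seq_cond [RHS]big_seq_cond; apply: eq_bigl => y; rewrite !inE.
  by case: eqP => // ->; rewrite (negbTE zL).
have zx := minz _ xL; have IHx := IH (path_sorted sL) xL.
case: (boolP (z \in J)) => zJ.
  rewrite mulrA f_anticomm mulNr -mulrA IHx; case: ifP => xJ.
    by rewrite mulr0 oppr0.
  by rewrite zx exprD expr1 mulN1r scaleNr scalerAr.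
exact: IHx.
Qed.

Lemma hom_genM x a : hom (gen x * a) = f x * hom a.
Proof.
rewrite [a]eb_expand mulr_sumr !linear_sum mulr_sumr; apply: eq_bigr => J _ /=.
rewrite -scalerAr !linearZ /= -scalerAr; congr (_ *: _).
rewrite gen_eb hom_eb mul_prod_insert ?sorted_allidx ?mem_allidx //.
case: ifP => _; first by rewrite linear0.
rewrite linearZ /= hom_eb; congr (_ ^+ _ *: _).
by rewrite (perm_big _ perm_allidx).
Qed.
End Hom.

Lemma prod_gen_sorted (L : seq idx) I :
  sorted (fun y z => rk y < rk z)%N L ->
  \prod_(x <- L | x \in I) gen x = eb [set x in I | x \in L].
Proof.
elim: L => [_|z L IH sL].
  by rewrite big_nil ext_oneE; congr eb; apply/setP=> x; rewrite !inE andbF.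
have tr : transitive (fun y z : idx => rk y < rk z)%N.
  by move=> ? ? ?; apply: ltn_trans.
have /allP minz := order_path_min tr sL.
have zL : z \notin L by apply/negP => /minz; rewrite ltnn.
rewrite big_cons IH ?(path_sorted sL) //; case: ifP => zI; last first.
  congr eb; apply/setP => x; rewrite !inE.
  by case: eqP => //= ->; rewrite zI.
rewrite gen_eb !inE (negbTE zL) andbF big1 ?scale1r => [|y]; last first.
  by rewrite inE => /andP[_ /minz ltzy]; rewrite ltnNge (ltnW ltzy).
congr eb; apply/setP => x; rewrite !inE.
by case: eqP => //= ->; rewrite zI.
Qed.

Lemma eb_prod I : eb I = \prod_(x <- allidx | x \in I) gen x.
Proof.
rewrite prod_gen_sorted ?sorted_allidx //; congr eb; apply/setP => x.
by rewrite inE mem_allidx andbT.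
Qed.

(** Replaces expansions into monomials: a property compatible with linear combinations has to be
    checked only under left multiplication by a generator. *)
Lemma ext_ind (P : extalg -> Prop) :
  P 1 -> (forall x a, P a -> P (gen x * a)) ->
  (forall a b, P a -> P b -> P (a + b)) -> (forall k a, P a -> P (k *: a)) ->
  forall a, P a.
Proof.
move=> P1 Pg PD PZ a; rewrite [a]eb_expand.
have P0 : P 0 by rewrite -(scale0r 1); apply: PZ.
apply: (big_ind P) => // I _; apply: PZ; rewrite eb_prod.
elim: allidx => [|x s IH]; first by rewrite big_nil.
by rewrite big_cons; case: ifP => // _; apply: Pg.
Qed.

Lemma genM_mult (A : lalgType C) (phi : {linear extalg -> A}) :
  phi 1 = 1 -> (forall x a, phi (gen x * a) = phi (gen x) * phi a) ->
  forall a b, phi (a * b) = phi a * phi b.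
Proof.
move=> phi1 phiM a b; elim/ext_ind: a => [|x a IH|a c IHa IHc|k a IH].
- by rewrite phi1 !mul1r.
- by rewrite -mulrA !phiM IH mulrA.
- by rewrite mulrDl !linearD IHa IHc mulrDl.
- by rewrite -scalerAl !linearZ /= IH scalerAl.
Qed.

Lemma homM (A : algType C) (f : idx -> A) :
  (forall x y, f x * f y = - (f y * f x)) ->
  forall a b, hom f (a * b) = hom f a * hom f b.
Proof.
move=> fA; apply: genM_mult; first exact: hom1.
by move=> x a; rewrite /= hom_gen hom_genM.
Qed.

Lemma comm_gen_central a :
  (forall x, gen x * a = a * gen x) -> forall b, b * a = a * b.
Proof.
move=> ha b; elim/ext_ind: b => [|x b IH|b c IHb IHc|k b IH].
- by rewrite mul1r mulr1.
- by rewrite -mulrA IH !mulrA ha.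
- by rewrite mulrDl mulrDr IHb IHc.
- by rewrite -scalerAl IH scalerAr.
Qed.

End Generators.

(** * Bidegree *)

Section Bidegree.
Variables (R : realType) (n : nat).
Local Notation C := R[i].
Local Notation idx := (idx n).
Local Notation extalg := (extalg R n).
Implicit Types (I J K : {set idx}) (x y : idx) (a b c : extalg).

Definition pq (p q : nat) a : bool :=
  [forall I, (cf a I != 0) ==> (#|holo I| == p) && (#|antiholo I| == q)].

Lemma pqP p q a :
  reflect (forall I, cf a I != 0 -> #|holo I| = p /\ #|antiholo I| = q)
          (pq p q a).
Proof.
apply: (iffP forallP) => h I; last by apply/implyP => /h [-> ->]; rewrite !eqxx.
by move/implyP: (h I) => hI /hI /andP[/eqP -> /eqP ->].
Qed.

Lemma pq0 p q : pq p q 0.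
Proof. by apply/pqP => I; rewrite cf0 eqxx. Qed.

Lemma pqD p q a b : pq p q a -> pq p q b -> pq p q (a + b).
Proof.
move=> /pqP ha /pqP hb; apply/pqP => I; rewrite cfD.
by case: (eqVneq (cf a I) 0) => [->|/ha //]; rewrite add0r => /hb.
Qed.

Lemma pqZ p q k a : pq p q a -> pq p q (k *: a).
Proof.
by move/pqP => ha; apply/pqP => I; rewrite cfZ mulf_eq0 negb_or => /andP[_ /ha].
Qed.

Lemma pq_sum p q (T : Type) (r : seq T) (P : pred T) (F : T -> extalg) :
  (forall i, P i -> pq p q (F i)) -> pq p q (\sum_(i <- r | P i) F i).
Proof.
move=> hF; apply: (big_ind (fun a => pq p q a)) => //; first exact: pq0.
by move=> a b; apply: pqD.
Qed.

Lemma pq_eb I : pq #|holo I| #|antiholo I| (eb R I).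
Proof.
by apply/pqP => J; rewrite cf_eb; have [->|_] := eqVneq J I; rewrite ?eqxx.
Qed.

Lemma pq1 : pq 0 0 1.
Proof.
rewrite ext_oneE; have := pq_eb set0.
have -> : holo (set0 : {set idx}) = set0 by apply/setP => j; rewrite !inE.
have -> : antiholo (set0 : {set idx}) = set0 by apply/setP => j; rewrite !inE.
by rewrite cards0.
Qed.

Lemma sum_set_idx I (w : idx -> nat) :
  (\sum_(x in I) w x =
   \sum_(j in holo I) w (inl j) + \sum_(j in antiholo I) w (inr j))%N.
Proof.
by rewrite big_sumType /=; congr (_ + _)%N; apply: eq_bigl => j; rewrite !inE.
Qed.

Lemma card_idx I : #|I| = (#|holo I| + #|antiholo I|)%N.
Proof. by rewrite -!sum1_card sum_set_idx. Qed.

Lemma pq_gen_l j : pq 1 0 (gen R (inl j : idx)).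
Proof.
have := pq_eb [set inl j]; rewrite -[eb _ _]/(gen _ _).
have -> : holo [set inl j] = [set j] by apply/setP => k; rewrite !inE.
have -> : antiholo [set inl j] = set0 by apply/setP => k; rewrite !inE.
by rewrite cards0 cards1.
Qed.

Lemma pq_gen_r j : pq 0 1 (gen R (inr j : idx)).
Proof.
have := pq_eb [set inr j]; rewrite -[eb _ _]/(gen _ _).
have -> : antiholo [set inr j] = [set j] by apply/setP => k; rewrite !inE.
have -> : holo [set inr j] = set0 by apply/setP => k; rewrite !inE.
by rewrite cards0 cards1.
Qed.

Lemma holoU I J : holo (I :|: J) = holo I :|: holo J.
Proof. by apply/setP => j; rewrite !inE. Qed.

Lemma antiholoU I J : antiholo (I :|: J) = antiholo I :|: antiholo J.
Proof. by apply/setP => j; rewrite !inE. Qed.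

Lemma pq_ebmul I J :
  pq (#|holo I| + #|holo J|) (#|antiholo I| + #|antiholo J|) (ebmul R I J).
Proof.
rewrite /ebmul; case: ifP => dIJ; last exact: pq0.
apply: pqZ; have := pq_eb (I :|: J); rewrite holoU antiholoU !cardsU.
have -> : holo I :&: holo J = set0.
  apply/setP => j; rewrite !inE; apply/negP => /andP[jI jJ].
  by move/pred0P: dIJ => /(_ (inl j)) /=; rewrite jI jJ.
have -> : antiholo I :&: antiholo J = set0.
  apply/setP => j; rewrite !inE; apply/negP => /andP[jI jJ].
  by move/pred0P: dIJ => /(_ (inr j)) /=; rewrite jI jJ.
by rewrite cards0 !subn0.
Qed.

Lemma pqM p q p' q' a b :
  pq p q a -> pq p' q' b -> pq (p + p') (q + q') (a * b).
Proof.
move=> /pqP ha /pqP hb; rewrite [a]eb_expand [b]eb_expand mulr_suml.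
apply: pq_sum => I _; rewrite mulr_sumr; apply: pq_sum => J _.
rewrite -scalerAl -scalerAr scalerA mul_ebE.
case: (eqVneq (cf a I) 0) => [->|/ha [<- <-]].
  by rewrite mul0r scale0r; apply: pq0.
case: (eqVneq (cf b J) 0) => [->|/hb [<- <-]].
  by rewrite mulr0 scale0r; apply: pq0.
exact/pqZ/pq_ebmul.
Qed.

Lemma pq_eq p q p' q' a : pq p q a -> p = p' -> q = q' -> pq p' q' a.
Proof. by move=> ha <- <-. Qed.

Lemma pq_ind (D : nat -> nat -> extalg -> Prop) :
  (forall p q, D p q 0) -> D 0%N 0%N 1 ->
  (forall p q j a, D p q a -> D p.+1 q (gen R (inl j) * a)) ->
  (forall p q j a, D p q a -> D p q.+1 (gen R (inr j) * a)) ->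
  (forall p q a b, D p q a -> D p q b -> D p q (a + b)) ->
  (forall p q k a, D p q a -> D p q (k *: a)) ->
  forall p q a, pq p q a -> D p q a.
Proof.
move=> D0 D1 Dl Dr DD DZ p q a /pqP ha; rewrite [a]eb_expand.
apply: (big_ind (D p q)) => [||I _]; [exact: D0 | exact: DD |].
case: (eqVneq (cf a I) 0) => [->|/ha [<- <-]]; first by rewrite scale0r.
(* As sums over [allidx], the two degrees unfold along the same list as the monomial, and each
   generator raises exactly one of them. *)
apply: DZ; pose w1 (x : idx) := if x is inl _ then 1%N else 0%N.
pose w2 (x : idx) := if x is inl _ then 0%N else 1%N.
have -> : #|holo I| = (\sum_(x <- allidx n | x \in I) w1 x)%N.
  rewrite (perm_big _ (perm_allidx n)) sum_set_idx /= sum1_card.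
  by rewrite [X in (_ + X)%N]big1 ?addn0.
have -> : #|antiholo I| = (\sum_(x <- allidx n | x \in I) w2 x)%N.
  rewrite (perm_big _ (perm_allidx n)) sum_set_idx /= sum1_card.
  by rewrite [X in (X + _)%N]big1.
rewrite eb_prod; elim: (allidx n) => [|x s IH]; first by rewrite !big_nil.
by rewrite !big_cons; case: ifP => // _; case: x => j /=; [apply: Dl | apply: Dr].
Qed.

Lemma pq_genC p q a x :
  pq p q a -> gen R x * a = (-1) ^+ (p + q) *: (a * gen R x).
Proof.
elim/pq_ind => {p q a} [p q||p q j a IH|p q j a IH|p q a b IHa IHb|p q k a IH].
- by rewrite mulr0 mul0r scaler0.
- by rewrite mulr1 mul1r scale1r.
- rewrite mulrA gen_anticomm mulNr -[X in - X]mulrA IH -scalerAr mulrA addSn exprS.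
  by rewrite mulN1r scaleNr.
- rewrite mulrA gen_anticomm mulNr -[X in - X]mulrA IH -scalerAr mulrA addnS exprS.
  by rewrite mulN1r scaleNr.
- by rewrite mulrDr mulrDl IHa IHb scalerDr.
- by rewrite -scalerAr IH -scalerAl !scalerA mulrC.
Qed.

Lemma pq_mulC p q p' q' a b : pq p q a -> pq p' q' b ->
  a * b = (-1) ^+ ((p + q) * (p' + q')) *: (b * a).
Proof.
move=> ha hb; elim/pq_ind: ha => {p q a}
  [p q||p q j a IH|p q j a IH|p q a a' IHa IHa'|p q k a IH].
- by rewrite mulr0 mul0r scaler0.
- by rewrite mulr1 mul1r scale1r.
- rewrite -[LHS]mulrA IH -scalerAr [X in _ *: X = _]mulrA (pq_genC _ hb).
  rewrite -scalerAl scalerA.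
  by rewrite -exprD mulrA; congr (_ ^+ _ *: _); lia.
- rewrite -[LHS]mulrA IH -scalerAr [X in _ *: X = _]mulrA (pq_genC _ hb).
  rewrite -scalerAl scalerA.
  by rewrite -exprD mulrA; congr (_ ^+ _ *: _); lia.
- by rewrite mulrDr mulrDl IHa IHa' scalerDr.
- by rewrite -scalerAl IH -scalerAr !scalerA mulrC.
Qed.

Lemma setT_type I : #|holo I| = n -> #|antiholo I| = n -> I = setT.
Proof.
move=> hI aI; apply/eqP; rewrite eqEcard subsetT cardsT card_sum card_ord.
by rewrite card_idx hI aI leqnn.
Qed.

Lemma pq_top a : pq n n a -> a = cf a setT *: eb R setT.
Proof.
move=> /pqP ha; apply: ext_eqP => I; rewrite cfZ cf_eb.
case: eqP => [->|neI]; first by rewrite mulr1.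
rewrite mulr0; apply/eqP/negPn/negP => /ha [hI aI].
by apply: neI; apply: setT_type.
Qed.

Lemma pq_above p q a : pq p q a -> (n < p)%N \/ (n < q)%N -> a = 0.
Proof.
move=> /pqP ha hn; apply: ext_eqP => I; rewrite cf0; apply/eqP/negPn/negP => /ha.
have := max_card (mem (holo I)); have := max_card (mem (antiholo I)).
by rewrite card_ord => h1 h2 [e1 e2]; case: hn => hn; move: h1 h2; rewrite ?e1 ?e2; lia.
Qed.

Lemma cf_mul_top a b : cf (a * b) setT =
  \sum_(I : {set idx}) shuffle_sign R I (~: I) * cf a I * cf b (~: I).
Proof.
rewrite cfM; apply: eq_bigr => I _; apply: big_pred1 => J /=.
apply/andP/eqP => [[/eqP IJ dIJ]|->]; last first.
  by rewrite setUCr disjoints_subset setCK.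
apply/setP => x; move/setP: IJ => /(_ x); rewrite !inE.
move/pred0P: dIJ => /(_ x) /=.
by case: (x \in I) => //= ->.
Qed.

(** Duality between complementary bidegrees: multiplication by the complementary monomial isolates
    each coefficient of [a] up to sign. *)
Lemma top_pairing p q p' q' a : pq p q a -> (p + p' = n)%N -> (q + q' = n)%N ->
  (forall b, pq p' q' b -> cf (a * b) setT = 0) -> a = 0.
Proof.
move=> /pqP ha hp hq hab; apply: ext_eqP => I; rewrite cf0.
apply/eqP/negPn/negP => aI; have [hI aI'] := ha _ aI.
have hC : pq p' q' (eb R (~: I)).
  apply: pq_eq (pq_eb (~: I)) _ _.
    have <- : ~: holo I = holo (~: I) by apply/setP => j; rewrite !inE.
    by rewrite cardsCs setCK card_ord hI -hp addKn.
  have <- : ~: antiholo I = antiholo (~: I) by apply/setP => j; rewrite !inE.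
  by rewrite cardsCs setCK card_ord aI' -hq addKn.
move/eqP: (hab _ hC); rewrite cf_mul_top (bigD1 I) //= big1 => [|J neJI].
  rewrite addr0 cf_eb eqxx mulr1 mulf_eq0 (negbTE aI) orbF shuffle_signE.
  by rewrite signr_eq0.
by rewrite cf_eb (inj_eq (@setC_inj _)) (negbTE neJI) mulr0.
Qed.

End Bidegree.

Section HomBidegree.
Variables (R : realType) (n n' : nat) (f : idx n -> extalg R n').
Variables (p1 q1 p2 q2 : nat).
Hypothesis fl : forall j, pq p1 q1 (f (inl j)).
Hypothesis fr : forall j, pq p2 q2 (f (inr j)).
Hypothesis f_anticomm : forall x y, f x * f y = - (f y * f x).

(** Here [(p1, q1)] and [(p2, q2)] are the bidegrees of the images of dz and dzbar: (1,0) and (0,1)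
    for maps of complex spaces, exchanged for conjugation. *)
Lemma hom_pq p q a : pq p q a ->
  pq (p * p1 + q * p2) (p * q1 + q * q2) (hom f a).
Proof.
elim/pq_ind => {p q a} [p q||p q j a IH|p q j a IH|p q a b IHa IHb|p q k a IH].
- by rewrite linear0; apply: pq0.
- by rewrite hom1; apply: pq1.
- by rewrite hom_genM //; apply: pq_eq (pqM (fl j) IH) _ _; lia.
- by rewrite hom_genM //; apply: pq_eq (pqM (fr j) IH) _ _; lia.
- by rewrite linearD; apply: pqD.
- by rewrite linearZ; apply: pqZ.
Qed.
End HomBidegree.

(** * Positive semidefinite matrices *)

Section HermitianMatrices.
Variable C : numClosedFieldType.
Local Notation "M ^t*" := (map_mx Num.conj (M^T)) (at level 30).

Lemma adjmxM m n p (A : 'M[C]_(m, n)) (B : 'M[C]_(n, p)) :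
  (A *m B)^t* = B^t* *m A^t*.
Proof. by rewrite trmx_mul map_mxM. Qed.

Lemma adjmxK m n (A : 'M[C]_(m, n)) : (A^t*)^t* = A.
Proof. by apply/matrixP => i j; rewrite !mxE conjCK. Qed.

Lemma adjmxD m n (A B : 'M[C]_(m, n)) : (A + B)^t* = A^t* + B^t*.
Proof. by apply/matrixP => i j; rewrite !mxE rmorphD. Qed.

Lemma adjmxZ m n k (A : 'M[C]_(m, n)) : (k *: A)^t* = k^* *: A^t*.
Proof. by apply/matrixP => i j; rewrite !mxE rmorphM. Qed.

Lemma adjmx_unit n (A : 'M[C]_n) : (A^t* \in unitmx) = (A \in unitmx).
Proof. by rewrite map_unitmx unitmx_tr. Qed.

(** With row vectors the conjugate falls on the second argument, so this is the expression in
    [is_psd] evaluated at the conjugate of [x]. *)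
Definition qf n (h : 'M[C]_n) (x : 'rV[C]_n) : C := (x *m h *m x^t*) 0 0.

Definition hermx n (h : 'M[C]_n) := h^t* = h.
Definition psdmx n (h : 'M[C]_n) := hermx h /\ forall x, 0 <= qf h x.
Definition posmx n (h : 'M[C]_n) := forall x, x != 0 -> 0 < qf h x.

Lemma qfD n (g h : 'M[C]_n) x : qf (g + h) x = qf g x + qf h x.
Proof. by rewrite /qf mulmxDr mulmxDl mxE. Qed.

Lemma qfZ n k (h : 'M[C]_n) x : qf (k *: h) x = k * qf h x.
Proof. by rewrite /qf -scalemxAr -scalemxAl mxE. Qed.

Lemma qfN n (h : 'M[C]_n) x : qf (- h) x = - qf h x.
Proof. by rewrite -scaleN1r qfZ mulN1r. Qed.

Lemma qf0 n (h : 'M[C]_n) : qf h 0 = 0.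
Proof. by rewrite /qf !mul0mx mxE. Qed.

Lemma qf1 n (x : 'rV[C]_n) : qf 1%:M x = \sum_i `|x 0 i| ^+ 2.
Proof.
rewrite /qf mulmx1 mxE; apply: eq_bigr => i _.
by rewrite !mxE normCK.
Qed.

Lemma qf1_ge0 n (x : 'rV[C]_n) : 0 <= qf 1%:M x.
Proof. by rewrite qf1 sumr_ge0 // => i _; rewrite exprn_ge0. Qed.

Lemma qf1_gt0 n (x : 'rV[C]_n) : x != 0 -> 0 < qf 1%:M x.
Proof.
move=> x0; rewrite lt_def qf1_ge0 andbT; apply: contra x0 => /eqP h.
apply/eqP/rowP => i; rewrite mxE; apply/eqP.
rewrite -normr_eq0 -sqrf_eq0; move/eqP: h; rewrite qf1 psumr_eq0 => [|k _].
  by move/allP => /(_ i (mem_index_enum _)).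
by rewrite exprn_ge0.
Qed.

Lemma qf_conj n m (h : 'M[C]_n) (g : 'M[C]_(n, m)) x :
  qf (g^t* *m h *m g) x = qf h (x *m g^t*).
Proof. by rewrite /qf adjmxM adjmxK !mulmxA. Qed.

Lemma hermx_conj n m (h : 'M[C]_n) (g : 'M[C]_(n, m)) :
  hermx h -> hermx (g^t* *m h *m g).
Proof. by move=> hh; rewrite /hermx !adjmxM adjmxK hh mulmxA. Qed.

Lemma psdmx_conj n m (h : 'M[C]_n) (g : 'M[C]_(n, m)) :
  psdmx h -> psdmx (g^t* *m h *m g).
Proof.
by move=> [hh ph]; split=> [|x]; [exact: hermx_conj | rewrite qf_conj].
Qed.

Lemma qf_conj_real n (h : 'M[C]_n) x : hermx h -> (qf h x)^* = qf h x.
Proof.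
move=> hh; transitivity ((x *m h *m x^t*)^t* 0 0); first by rewrite [RHS]mxE [in RHS]mxE.
by rewrite !adjmxM adjmxK hh mulmxA.
Qed.

Lemma qf_real n (h : 'M[C]_n) x : hermx h -> qf h x \is Num.real.
Proof. by move=> hh; apply/CrealP/qf_conj_real. Qed.

Lemma herm_spectral n (h : 'M[C]_n) : hermx h -> exists (P : 'M[C]_n) (d : 'rV[C]_n),
  [/\ P *m P^t* = 1%:M, P^t* *m P = 1%:M & h = P^t* *m diag_mx d *m P].
Proof.
move=> hh; have hn : h \is normalmx by apply/normalmxP; rewrite hh.
have /unitarymxP Pu := spectral_unitarymx h.
exists (spectralmx h), (spectral_diag h); split=> //.
  by apply: mulmx1C.
by rewrite -invmx_unitary ?spectral_unitarymx; first exact/orthomx_spectralP.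
Qed.

Lemma qf_row m n (P : 'M[C]_(m, n)) (h : 'M[C]_n) i :
  qf h (row i P) = (P *m h *m P^t*) i i.
Proof.
by rewrite /qf -row_mul mxE [RHS]mxE; apply: eq_bigr => k _; rewrite !mxE.
Qed.

Lemma spectral_entry n (P : 'M[C]_n) d i : P *m P^t* = 1%:M ->
  qf (P^t* *m diag_mx d *m P) (row i P) = d 0 i.
Proof.
move=> Pu; rewrite qf_row !mulmxA Pu mul1mx -mulmxA Pu mulmx1.
by rewrite mxE eqxx mulr1n.
Qed.

(** The normal form of a semipositive matrix. An arbitrary set [J] is allowed because the
    eigenvalues given by the spectral theorem are not sorted. *)
Definition pidset n (J : {set 'I_n}) : 'M[C]_n :=
  \matrix_(j, k) ((j == k) && (j \in J))%:R.

Lemma pidsetE n (J : {set 'I_n}) j k :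
  pidset J j k = ((j == k) && (j \in J))%:R.
Proof. by rewrite mxE. Qed.

Lemma pidset_diag n (J : {set 'I_n}) : pidset J = diag_mx (\row_j (j \in J)%:R).
Proof.
by apply/matrixP => i j; rewrite !mxE; case: eqP => [->|_] /=; rewrite ?mulr1n.
Qed.

Lemma rank_pidset_le n (J : {set 'I_n}) : (\rank (pidset J) <= #|J|)%N.
Proof.
have -> : pidset J = \sum_(j in J) delta_mx j j.
  apply/matrixP => k l; rewrite mxE summxE.
  have [kJ|kJ] := boolP (k \in J); last first.
    rewrite andbF big1 // => j jJ; rewrite mxE; case: eqP => //= kj.
    by rewrite kj jJ in kJ.
  rewrite (bigD1 k) //= mxE eqxx /= andbT eq_sym big1 ?addr0 // => j /andP[_ ne].
  by rewrite mxE eq_sym (negbTE ne).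
rewrite -sum1_card; elim/big_rec2: _ => [|j A B _ IH]; first by rewrite mxrank0.
by rewrite (leq_trans (mxrank_add _ _)) // leq_add // mxrank_delta.
Qed.

(** The matrices of [J] and of its complement add up to the identity, so subadditivity of the rank
    makes both upper bounds sharp. *)
Lemma rank_pidset n (J : {set 'I_n}) : \rank (pidset J) = #|J|.
Proof.
apply/eqP; rewrite eqn_leq rank_pidset_le /=.
have e : pidset J + pidset (~: J) = 1%:M.
  apply/matrixP => i j; rewrite !mxE inE; case: eqP => //= _; last by rewrite addr0.
  by case: (i \in J); rewrite ?addr0 ?add0r.
have := mxrank_add (pidset J) (pidset (~: J)); rewrite e mxrank1.
have := rank_pidset_le (~: J); have := cardsC J; rewrite card_ord => hC hle hn.
by rewrite -(leq_add2r #|~: J|) hC (leq_trans hn) // leq_add2l.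
Qed.

Lemma psd_normal_form n (h : 'M[C]_n) : psdmx h ->
  exists (g : 'M[C]_n) (J : {set 'I_n}),
    [/\ g \in unitmx, #|J| = \rank h & h = g^t* *m pidset J *m g].
Proof.
move=> [hh ph]; have [P [d [Pu Pu' eh]]] := herm_spectral hh.
have d0 i : 0 <= d 0 i by rewrite -(spectral_entry d i Pu) -eh.
pose J := [set i | d 0 i != 0].
(* Scaling by square roots of the eigenvalues. Zero eigenvalues get the factor 1, which keeps [g]
   invertible; the corresponding entries of [pidset J] are zero. *)
pose s : 'rV[C]_n := \row_i (if d 0 i == 0 then 1 else sqrtC (d 0 i)).
have s0 i : s 0 i != 0.
  by rewrite mxE; case: (eqVneq (d 0 i) 0) => [_|di]; rewrite ?oner_eq0 ?sqrtC_eq0.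
have Pun : P \in unitmx by case/mulmx1_unit: Pu.
have sun : diag_mx s \in unitmx.
  rewrite unitmxE det_diag unitfE; apply/prodf_neq0 => i _; exact: s0.
have gun : diag_mx s *m P \in unitmx by rewrite unitmx_mul sun.
have eD : h = (diag_mx s *m P)^t* *m pidset J *m (diag_mx s *m P).
  rewrite adjmxM eh !mulmxA; congr (_ *m _); rewrite -!mulmxA; congr (_ *m _).
  rewrite mulmxA pidset_diag; apply/matrixP => i j.
  rewrite tr_diag_mx map_diag_mx mulmx_diag mulmx_diag !mxE; case: eqP => // _.
  rewrite !mulr1n inE; case: (eqVneq (d 0 i) 0) => [->|di].
    by rewrite /= mulr0 mul0r.
  by rewrite /= mulr1 conj_Creal ?ger0_real ?sqrtC_ge0 // -expr2 sqrtCK.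
exists (diag_mx s *m P), J; split=> //.
have gfull : row_full ((diag_mx s *m P)^t*) by rewrite row_full_unit adjmx_unit.
by rewrite eD mxrankMfree ?row_free_unit // (eqmxMfull _ gfull) rank_pidset.
Qed.

(** In normal form the value is the sum over [J] of the squared moduli of the coordinates, so these
    coordinates vanish. *)
Lemma psd_qf_eq0 n (h : 'M[C]_n) x : psdmx h -> qf h x = 0 -> x *m h = 0.
Proof.
move=> ph; have [g [J [_ _ ->]]] := psd_normal_form ph.
rewrite qf_conj !mulmxA; set y := x *m _; rewrite /qf => h0.
suff -> : y *m pidset J = 0 by rewrite mul0mx.
have yE i : (y *m pidset J) 0 i = y 0 i * (i \in J)%:R.
  rewrite mxE (bigD1 i) //= big1 ?addr0 => [|k ne].
    by rewrite pidsetE eqxx.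
  by rewrite pidsetE (negbTE ne) mulr0.
move: h0; rewrite mxE => /eqP; rewrite psumr_eq0 => [/allP h0|i _]; last first.
  rewrite yE !mxE; case: (i \in J); rewrite ?mulr0 ?mul0r // mulr1.
  by rewrite mul_conjC_ge0.
apply/rowP => i; have := h0 i (mem_index_enum _); rewrite yE !mxE.
by case: (i \in J); rewrite ?mulr0 // !mulr1 mulf_eq0 conjC_eq0 orbb => /eqP.
Qed.

Lemma psdmxD n (g h : 'M[C]_n) : psdmx g -> psdmx h -> psdmx (g + h).
Proof.
move=> [hg pg] [hh ph]; split=> [|x]; first by rewrite /hermx adjmxD hg hh.
by rewrite qfD addr_ge0.
Qed.

Lemma psdmxZ n k (h : 'M[C]_n) : 0 <= k -> psdmx h -> psdmx (k *: h).
Proof.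
move=> k0 [hh ph]; split=> [|x]; last by rewrite qfZ mulr_ge0.
by rewrite /hermx adjmxZ hh conj_Creal // ger0_real.
Qed.

Lemma rank_sub_kermx m n (A : 'M[C]_(m, n)) (r k : nat) (B : 'M[C]_(k, m)) :
  (kermx A <= B)%MS -> (\rank B + r <= m)%N -> (r <= \rank A)%N.
Proof. by move=> /mxrankS; rewrite mxrank_ker; have := rank_leq_row A; lia. Qed.

(** A vector killed by [g + h] is isotropic for both summands, hence killed by [g]: the kernel can
    only shrink. *)
Lemma psd_rankD n (g h : 'M[C]_n) :
  psdmx g -> psdmx h -> (\rank g <= \rank (g + h)%R)%N.
Proof.
move=> pg ph; apply: (@rank_sub_kermx _ _ _ _ _ (kermx g)); last first.
  by rewrite mxrank_ker; have := rank_leq_row g; lia.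
apply/row_subP => i; apply/sub_kermxP; set x := row i _.
have x0 : x *m (g + h) = 0 by rewrite -row_mul mulmx_ker row0.
have : qf (g + h) x = 0 by rewrite /qf x0 mul0mx mxE.
rewrite qfD => /eqP q0; apply: psd_qf_eq0 => //; move: q0.
by rewrite paddr_eq0 ?(proj2 pg) ?(proj2 ph) // => /andP[/eqP].
Qed.

Lemma psd_rankZ n k (h : 'M[C]_n) : k != 0 -> \rank (k *: h) = \rank h.
Proof. by move=> k0; rewrite mxrank_scale_nz. Qed.

(* For a positive semidefinite form, the kernel of the restriction to a
   hyperplane lies in the kernel of the form. *)
Lemma psd_rank_submx n (h : 'M[C]_n.+1) (j : 'I_n.+1) : psdmx h ->
  psdmx (row' j (col' j h)) /\ (\rank h <= (\rank (row' j (col' j h))).+1)%N.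
Proof.
move=> ph; pose e : 'M[C]_(n, n.+1) := \matrix_(k, l) (l == lift j k)%:R.
have eE : row' j (col' j h) = (e^t*)^t* *m h *m e^t*.
  rewrite adjmxK; apply/matrixP => k l; rewrite !mxE (bigD1 (lift j l)) //=.
  rewrite [X in _ + X]big1 ?addr0 => [|i ne]; last first.
    by rewrite !mxE (negbTE ne) rmorph0 mulr0.
  rewrite !mxE eqxx rmorph1 mulr1 (bigD1 (lift j k)) //= big1 ?addr0 => [|i ne].
    by rewrite mxE eqxx mul1r.
  by rewrite mxE (negbTE ne) mul0r.
have pr : psdmx (row' j (col' j h)) by rewrite eE; apply: psdmx_conj.
split=> //.
have efree : row_free e.
  apply/row_freeP; exists (e^t*); apply/matrixP => k l; rewrite !mxE.
  rewrite (bigD1 (lift j k)) //= big1 ?addr0 => [|i ne].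
    by rewrite !mxE eqxx mul1r (inj_eq lift_inj) conjC_nat.
  by rewrite mxE (negbTE ne) mul0r.
have kb : (kermx (row' j (col' j h)) *m e <= kermx h)%MS.
  apply/row_subP => i; rewrite row_mul; apply/sub_kermxP.
  apply: psd_qf_eq0 => //; set x := row i _.
  have -> : qf h (x *m e) = qf (row' j (col' j h)) x.
    by rewrite eE qf_conj adjmxK.
  by rewrite /qf -row_mul mulmx_ker row0 mul0mx mxE.
have := mxrankS kb; rewrite mxrankMfree // !mxrank_ker.
have := rank_leq_row h; have := rank_leq_row (row' j (col' j h)); lia.
Qed.

Lemma posmx_rank n (h : 'M[C]_n) : posmx h -> \rank h = n.
Proof.
move=> ph; apply/eqP; apply/row_freeP; apply/row_freeP.
rewrite -kermx_eq0; apply/eqP/row_matrixP => i; rewrite row0.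
apply/eqP/negPn/negP => /ph; rewrite /qf -row_mul mulmx_ker row0.
by rewrite mul0mx mxE ltxx.
Qed.

Lemma psd_unit_pos n (h : 'M[C]_n) : psdmx h -> h \in unitmx -> posmx h.
Proof.
move=> ph hu x x0; rewrite lt_def (proj2 ph) andbT.
apply: contra x0 => /eqP /(psd_qf_eq0 ph) xh.
by rewrite -(mulmxK hu x) xh mul0mx.
Qed.

(** The witness is the inverse of one plus the sum of the inverses of the [d i]; it needs no choice
    of a minimum and makes sense for n = 0. *)
Lemma finite_lower_bound n (d : 'I_n -> C) : (forall i, 0 < d i) ->
  exists2 c : C, 0 < c & forall i, c <= d i.
Proof.
move=> d0; have S0 : 0 < 1 + \sum_i (d i)^-1.
  by rewrite ltr_pwDl // sumr_ge0 // => i _; rewrite invr_ge0 ltW.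
exists (1 + \sum_i (d i)^-1)^-1 => [|i]; first by rewrite invr_gt0.
rewrite -[d i]invrK lef_pV2 ?posrE ?invr_gt0 //.
rewrite (bigD1 i) //= addrCA lerDl addr_ge0 // sumr_ge0 // => k _.
by rewrite invr_ge0 ltW.
Qed.

(** The constant bounds the eigenvalues from below. This coercivity gives the room for perturbation
    in [posmx_path]. *)
Lemma posmx_bound n (h : 'M[C]_n) : hermx h -> posmx h ->
  exists2 c : C, 0 < c & forall x, c * qf 1%:M x <= qf h x.
Proof.
move=> hh ph; have [P [d [Pu Pu' eh]]] := herm_spectral hh.
have d0 i : 0 < d 0 i.
  rewrite -(spectral_entry d i Pu) -eh; apply: ph; apply/eqP => r0.
  have := congr1 (fun A => row i A) Pu; rewrite row_mul r0 mul0mx => /rowP/(_ i).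
  by rewrite !mxE eqxx => /eqP; rewrite eq_sym oner_eq0.
have [c c0 hc] := finite_lower_bound d0; exists c => // x.
have -> : qf 1%:M x = qf 1%:M (x *m P^t*).
  by rewrite -[RHS]qf_conj mulmx1 Pu'.
rewrite eh qf_conj; set y := x *m _.
rewrite qf1 mulr_sumr /qf mul_mx_diag mxE ler_sum // => i _.
rewrite [(\matrix_(_, _) _) _ _]mxE [(y^t*) i 0]mxE [y^T _ _]mxE mulrAC -normCK.
by rewrite [leRHS]mulrC ler_wpM2r ?exprn_ge0.
Qed.

End HermitianMatrices.

(** * Conjugation and (1,1)-forms *)

Section Conjugation.
Variables (R : realType) (n : nat).
Local Notation C := R[i].
Local Notation idx := (idx n).
Local Notation extalg := (extalg R n).
Local Notation gen := (@gen R n).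
Local Notation iC := (@iC R).
Implicit Types (I J K : {set idx}) (x y : idx) (a b c : extalg).

Lemma iC_sq : iC * iC = -1.
Proof.
by apply/eqP; rewrite eq_complex /=; apply/andP; split; apply/eqP; ring.
Qed.

Lemma iC_neq0 : iC != 0.
Proof.
apply/eqP => i0; have /eqP := iC_sq.
by rewrite i0 mul0r eq_sym oppr_eq0 oner_eq0.
Qed.

Lemma conj_iC : (iC)^* = - iC.
Proof. by apply/eqP; rewrite eq_complex /= oppr0 !eqxx. Qed.

Definition conj_coef a : extalg := \sum_I (cf a I)^* *: eb R I.

Lemma cf_conj_coef a I : cf (conj_coef a) I = (cf a I)^*.
Proof.
rewrite cf_sum (bigD1 I) //= cfZ cf_eb eqxx mulr1 big1 ?addr0 // => J neJI.
by rewrite cfZ cf_eb eq_sym (negbTE neJI) mulr0.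
Qed.

Lemma conj_coefD a b : conj_coef (a + b) = conj_coef a + conj_coef b.
Proof. by apply: ext_eqP => I; rewrite cfD !cf_conj_coef cfD rmorphD. Qed.

Lemma conj_coefZ k a : conj_coef (k *: a) = k^* *: conj_coef a.
Proof. by apply: ext_eqP => I; rewrite cfZ !cf_conj_coef cfZ rmorphM. Qed.

Lemma conj_coef0 : conj_coef 0 = 0.
Proof. by rewrite -(scale0r 0) conj_coefZ rmorph0 !scale0r. Qed.

Lemma conj_coef_sum (T : Type) (r : seq T) (P : pred T) (F : T -> extalg) :
  conj_coef (\sum_(i <- r | P i) F i) = \sum_(i <- r | P i) conj_coef (F i).
Proof. exact: (big_morph conj_coef conj_coefD conj_coef0). Qed.

Lemma conj_coef_eb I : conj_coef (eb R I) = eb R I.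
Proof. by apply: ext_eqP => J; rewrite cf_conj_coef cf_eb rmorph_nat. Qed.

Lemma conj_coef_genM x a : conj_coef (gen x * a) = gen x * conj_coef a.
Proof.
rewrite [a]eb_expand mulr_sumr !conj_coef_sum mulr_sumr; apply: eq_bigr => J _.
rewrite -scalerAr !conj_coefZ -scalerAr conj_coef_eb; congr (_ *: _).
rewrite gen_eb; case: ifP => _; first exact: conj_coef0.
by rewrite conj_coefZ conj_coef_eb rmorph_sign.
Qed.

(** Conjugation in two stages: the semilinear one acts on coefficients only, and the exchange of dz
    and dzbar is then a linear morphism given by [hom]. *)
Definition cj a : extalg := hom (fun x => gen (swap_idx x)) (conj_coef a).

Lemma cjD a b : cj (a + b) = cj a + cj b.
Proof. by rewrite /cj conj_coefD linearD. Qed.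

Lemma cjZ k a : cj (k *: a) = k^* *: cj a.
Proof. by rewrite /cj conj_coefZ linearZ. Qed.

Lemma cj0 : cj 0 = 0.
Proof. by rewrite /cj conj_coef0 linear0. Qed.

Lemma cjN a : cj (- a) = - cj a.
Proof. by rewrite -scaleN1r cjZ rmorphN1 scaleN1r. Qed.

Lemma cj_sum (T : Type) (r : seq T) (P : pred T) (F : T -> extalg) :
  cj (\sum_(i <- r | P i) F i) = \sum_(i <- r | P i) cj (F i).
Proof. exact: (big_morph cj cjD cj0). Qed.

Lemma cj1 : cj 1 = 1.
Proof. by rewrite /cj ext_oneE conj_coef_eb -ext_oneE hom1. Qed.

Lemma cj_genM x a : cj (gen x * a) = gen (swap_idx x) * cj a.
Proof.
by rewrite /cj conj_coef_genM hom_genM // => y z; apply: gen_anticomm.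
Qed.

Lemma cj_gen x : cj (gen x) = gen (swap_idx x).
Proof. by rewrite -[gen x]mulr1 cj_genM cj1 mulr1. Qed.

Lemma cjM a b : cj (a * b) = cj a * cj b.
Proof.
elim/ext_ind: a => [|x a IH|a c IHa IHc|k a IH].
- by rewrite cj1 !mul1r.
- by rewrite -mulrA !cj_genM IH mulrA.
- by rewrite mulrDl !cjD IHa IHc mulrDl.
- by rewrite -scalerAl !cjZ IH scalerAl.
Qed.

Lemma cjK : involutive cj.
Proof.
move=> a; elim/ext_ind: a => [|x a IH|a c IHa IHc|k a IH].
- by rewrite !cj1.
- by rewrite !cj_genM IH; case: x.
- by rewrite !cjD IHa IHc.
- by rewrite !cjZ IH conjCK.
Qed.

Lemma pq_cj p q a : pq p q a -> pq q p (cj a).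
Proof.
move=> ha; have hc : pq p q (conj_coef a).
  by apply/pqP => I; rewrite cf_conj_coef conjC_eq0; apply/pqP: I.
have := @hom_pq R n n (fun x => gen (swap_idx x)) 0 1 1 0 _ _ _ p q _ hc.
rewrite !muln0 !muln1 add0n addn0; apply => [j|j|x y].
- exact: pq_gen_r.
- exact: pq_gen_l.
- exact: gen_anticomm.
Qed.

Definition theta (j : 'I_n) : extalg := iC *: (gen (inl j) * gen (inr j)).

Lemma cj_theta j : cj (theta j) = theta j.
Proof.
rewrite /theta cjZ cjM !cj_gen /= conj_iC gen_anticomm.
by rewrite scalerN scaleNr opprK.
Qed.

Lemma gen2_central x y a : a * (gen x * gen y) = gen x * gen y * a.
Proof.
apply: comm_gen_central => z.
by rewrite mulrA [gen z * gen x]gen_anticomm mulNr -!mulrA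
  [gen z * gen y]gen_anticomm mulrN opprK.
Qed.

Lemma theta_central j a : a * theta j = theta j * a.
Proof. by rewrite -scalerAr gen2_central scalerAl. Qed.

Lemma gen_sq x : gen x * gen x = 0.
Proof. by rewrite {2}genE gen_eb inE eqxx. Qed.

Lemma theta_sq j : theta j * theta j = 0.
Proof.
rewrite -scalerAl -scalerAr gen2_central mulrA -[_ * gen (inl j)]mulrA.
by rewrite [gen (inr j) * _]gen_anticomm mulrN mulrA gen_sq mul0r oppr0 mul0r !scaler0.
Qed.

Definition hform (h : 'M[C]_n) : extalg :=
  \sum_j \sum_k (iC * h j k) *: (gen (inl j) * gen (inr k)).

Lemma hform_central h a : a * hform h = hform h * a.
Proof.
rewrite /hform mulr_suml mulr_sumr; apply: eq_bigr => j _.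
rewrite mulr_suml mulr_sumr; apply: eq_bigr => k _.
by rewrite -scalerAr gen2_central scalerAl.
Qed.

Lemma pq_hform h : pq 1 1 (hform h).
Proof.
apply: pq_sum => j _; apply: pq_sum => k _; apply: pqZ.
by apply: (pqM (pq_gen_l _ _) (pq_gen_r _ _)).
Qed.

Lemma hformD g h : hform (g + h) = hform g + hform h.
Proof.
rewrite /hform -big_split; apply: eq_bigr => j _.
rewrite -big_split; apply: eq_bigr => k _.
by rewrite /= mxE mulrDr scalerDl.
Qed.

Lemma hformZ t h : hform (t *: h) = t *: hform h.
Proof.
rewrite /hform scaler_sumr; apply: eq_bigr => j _.
rewrite scaler_sumr; apply: eq_bigr => k _.
by rewrite mxE mulrCA scalerA.
Qed.

Lemma cj_hform h : is_hermitian h -> cj (hform h) = hform h.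
Proof.
move=> hh; rewrite /hform [RHS]exchange_big cj_sum; apply: eq_bigr => j _.
rewrite cj_sum; apply: eq_bigr => k _.
rewrite cjZ cjM !cj_gen /= gen_anticomm rmorphM /= conj_iC -hh.
by rewrite mulNr scaleNr scalerN opprK.
Qed.

Lemma hform_pidset (J : {set 'I_n}) : hform (pidset C J) = \sum_(j in J) theta j.
Proof.
rewrite /hform [RHS]big_mkcond; apply: eq_bigr => j _.
rewrite (bigD1 j) //= big1 => [|k nekj].
  by rewrite mxE eqxx addr0; case: (j \in J); rewrite ?mulr1 // mulr0 scale0r.
by rewrite mxE eq_sym (negbTE nekj) mulr0 scale0r.
Qed.

(** The ratio of the top-degree part to the standard volume form, which is [iC ^+ n] times the top
    monomial by [prod_theta]. *)
Definition vc a : C := cf a setT / iC ^+ n.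

Lemma vcD a b : vc (a + b) = vc a + vc b.
Proof. by rewrite /vc cfD mulrDl. Qed.
Lemma vcZ k a : vc (k *: a) = k * vc a.
Proof. by rewrite /vc cfZ mulrA. Qed.
Lemma vc0 : vc 0 = 0.
Proof. by rewrite /vc cf0 mul0r. Qed.
Lemma vcN a : vc (- a) = - vc a.
Proof. by rewrite /vc cfN mulNr. Qed.
Lemma vc_sum (T : Type) (r : seq T) (P : pred T) (F : T -> extalg) :
  vc (\sum_(i <- r | P i) F i) = \sum_(i <- r | P i) vc (F i).
Proof. exact: (big_morph vc vcD vc0). Qed.

Lemma prod_theta : \prod_j theta j = iC ^+ n *: eb R setT.
Proof.
rewrite eb_prod /theta scaler_prod prodr_const card_ord; congr (_ *: _).
rewrite [RHS](eq_bigl xpredT) => [|x]; last by rewrite inE.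
rewrite /allidx big_flatten [RHS]big_map [index_enum _]unlock -enumT.
by apply: eq_bigr => j _; rewrite !big_cons big_nil /= mulr1.
Qed.

(** No sign appears because the volume form is a product of the real forms [theta j]. *)
Lemma vc_cj a : pq n n a -> vc (cj a) = (vc a)^*.
Proof.
move=> /pq_top ->; rewrite cjZ !vcZ rmorphM /=; congr (_ * _).
have iCn : iC ^+ n != 0 by rewrite expf_neq0 ?iC_neq0.
have vT : vc (eb R setT) = (iC ^+ n)^-1 by rewrite /vc cf_eb eqxx mul1r.
have -> : eb R [set: idx] = (iC ^+ n)^-1 *: \prod_j theta j.
  by rewrite prod_theta scalerA mulVf // scale1r.
have cjprod : cj (\prod_j theta j) = \prod_j theta j.
  rewrite (big_morph cj cjM cj1); apply: eq_bigr => j _; exact: cj_theta.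
by rewrite cjZ !vcZ cjprod rmorphM /= prod_theta vcZ vT mulfV // rmorph1.
Qed.

End Conjugation.

(** * Linear changes of coordinates and restriction to hyperplanes *)

Section LinearChange.
Variables (R : realType) (n : nat).
Local Notation C := R[i].
Local Notation gen := (@gen R n).
Implicit Types (g : 'M[C]_n).

Definition glf g (x : idx n) : extalg R n :=
  match x with
  | inl j => \sum_k g j k *: gen (inl k)
  | inr j => \sum_k (g j k)^* *: gen (inr k)
  end.

Lemma lin_gen_anticomm (I : finType) (f1 f2 : I -> idx n) (u v : I -> C) :
  (\sum_k u k *: gen (f1 k)) * (\sum_k v k *: gen (f2 k)) =
  - ((\sum_k v k *: gen (f2 k)) * (\sum_k u k *: gen (f1 k))).
Proof.
rewrite mulr_suml mulr_sumr -sumrN; apply: eq_bigr => k _.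
rewrite mulr_suml mulr_sumr -sumrN; apply: eq_bigr => l _.
rewrite -!scalerAr -!scalerAl !scalerA gen_anticomm scalerN mulrC.
by rewrite mulrC.
Qed.

Lemma glf_anticomm g x y : glf g x * glf g y = - (glf g y * glf g x).
Proof. by case: x => j; case: y => k; apply: lin_gen_anticomm. Qed.

Definition gl g := hom (glf g).

Lemma glM g a b : gl g (a * b) = gl g a * gl g b.
Proof. exact: homM (glf_anticomm g) a b. Qed.

Lemma gl1 g : gl g 1 = 1. Proof. exact: hom1. Qed.

Lemma glD g a b : gl g (a + b) = gl g a + gl g b.
Proof. exact: linearD. Qed.

Lemma glZ g k a : gl g (k *: a) = k *: gl g a.
Proof. exact: linearZ. Qed.

Lemma gl0 g : gl g 0 = 0. Proof. exact: linear0. Qed.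

Lemma gl_prod g (T : Type) (r : seq T) (F : T -> extalg R n) :
  gl g (\prod_(i <- r) F i) = \prod_(i <- r) gl g (F i).
Proof. exact: (big_morph (gl g) (glM g) (gl1 g)). Qed.

Lemma gl_genM g x a : gl g (gen x * a) = glf g x * gl g a.
Proof. by rewrite /gl hom_genM //; apply: glf_anticomm. Qed.

Lemma pq_gl g p q a : pq p q a -> pq p q (gl g a).
Proof.
move=> ha; have := @hom_pq R n n (glf g) 1 0 0 1 _ _ _ p q a ha.
rewrite !muln0 !muln1 add0n addn0; apply => [j|j|x y].
- by apply: pq_sum => k _; apply/pqZ/pq_gen_l.
- by apply: pq_sum => k _; apply/pqZ/pq_gen_r.
- exact: glf_anticomm.
Qed.

Lemma gl_hform g h : gl g (hform h) = hform (g^T *m h *m map_mx Num.conj g).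
Proof.
rewrite /hform /gl linear_sum /=.
transitivity (\sum_j \sum_k \sum_r \sum_s (iC R * (g r j * h r s * (g s k)^*)) *:
   (gen (inl j) * gen (inr k))); last first.
  apply: eq_bigr => j _; apply: eq_bigr => k _.
  rewrite mxE mulr_sumr scaler_suml exchange_big; apply: eq_bigr => s _.
  rewrite !mxE mulr_suml mulr_sumr scaler_suml; apply: eq_bigr => r _.
  by rewrite mxE.
under [RHS]eq_bigr => j _ do rewrite exchange_big.
rewrite [RHS]exchange_big; apply: eq_bigr => r _.
rewrite linear_sum.
under [RHS]eq_bigr => j _ do rewrite exchange_big.
rewrite [RHS]exchange_big; apply: eq_bigr => s _.
rewrite linearZ /= (homM (glf_anticomm g)) !hom_gen /=.
rewrite mulr_suml scaler_sumr; apply: eq_bigr => j _.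
rewrite mulr_sumr scaler_sumr; apply: eq_bigr => k _.
by rewrite -scalerAl -scalerAr !scalerA; congr (_ *: _); ring.
Qed.

Lemma glK g g' : g *m g' = 1%:M -> cancel (gl g) (gl g').
Proof.
move=> gg' a.
have key (h h' : 'M[C]_n) (f : 'I_n -> idx n) j : h *m h' = 1%:M ->
    \sum_k h j k *: (\sum_l h' k l *: gen (f l)) = gen (f j).
  move=> hh'; under eq_bigr do rewrite scaler_sumr.
  rewrite exchange_big (bigD1 j) //= [X in _ + X]big1 ?addr0 => [|l nelj].
    rewrite -[RHS]scale1r; transitivity ((h *m h') j j *: gen (f j)).
      by rewrite mxE scaler_suml; apply: eq_bigr => k _; rewrite scalerA.
    by rewrite hh' mxE eqxx.
  transitivity ((h *m h') j l *: gen (f l)).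
    by rewrite mxE scaler_suml; apply: eq_bigr => k _; rewrite scalerA.
  by rewrite hh' mxE eq_sym (negbTE nelj) scale0r.
elim/ext_ind: a => [|x a IH|a b IHa IHb|k a IH].
- by rewrite !gl1.
- rewrite gl_genM glM IH; congr (_ * _); case: x => j.
    rewrite /= /gl linear_sum -[RHS](key _ _ _ _ gg').
    by apply: eq_bigr => k _; rewrite linearZ /= hom_gen.
  have gg'c : map_mx Num.conj g *m map_mx Num.conj g' = 1%:M.
    by rewrite -map_mxM gg' map_mx1.
  rewrite /= /gl linear_sum -[RHS](key _ _ _ _ gg'c).
  apply: eq_bigr => k _; rewrite linearZ /= hom_gen /= !mxE.
  by congr (_ *: _); apply: eq_bigr => l _; rewrite mxE.
- by rewrite !glD IHa IHb.
- by rewrite !glZ IH.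
Qed.

End LinearChange.

Section Restriction.
Variables (R : realType) (n : nat) (j : 'I_n.+1).
Local Notation C := R[i].
Local Notation gen := (@gen R _).

Definition lidx (x : idx n) : idx n.+1 :=
  match x with inl k => inl (lift j k) | inr k => inr (lift j k) end.

Lemma lidx_inj : injective lidx.
Proof.
move=> [k|k] [l|l] //= h.
  have := congr1 (fun z : idx n.+1 => if z is inl i then unlift j i else None) h.
  by rewrite /= !liftK => -[->].
have := congr1 (fun z : idx n.+1 => if z is inr i then unlift j i else None) h.
by rewrite /= !liftK => -[->].
Qed.

Lemma lidx_inl x : lidx x != inl j.
Proof.
case: x => k //=; apply/eqP => -[] /eqP.
by rewrite eq_sym (negbTE (neq_lift _ _)).
Qed.

Lemma lidx_inr x : lidx x != inr j.
Proof.
case: x => k //=; apply/eqP => -[] /eqP.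
by rewrite eq_sym (negbTE (neq_lift _ _)).
Qed.

Lemma lidxP (y : idx n.+1) :
  [\/ y = inl j, y = inr j | exists x, y = lidx x].
Proof.
case: y => k; case: (unliftP j k) => [l ->|->]; try by [constructor 1|constructor 2].
  by constructor 3; exists (inl l).
by constructor 3; exists (inr l).
Qed.

Lemma rk_lidx x y : (rk (lidx x) < rk (lidx y))%N = (rk x < rk y)%N.
Proof.
case: x => k; case: y => l /=; rewrite /bump;
  case: (leqP j k) => hk; case: (leqP j l) => hl /=; apply/idP/idP; lia.
Qed.

(** Pullback to the hyperplane z_j = 0: monomials containing dz_j or dzbar_j are dropped. Defining
    it on coefficients gives [cf_res] at once; multiplicativity is proved afterwards and rests on
    [lidx] preserving the order of the indices. *)
Definition res (a : extalg R n.+1) : extalg R n :=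
  \sum_(K : {set idx n}) cf a (lidx @: K) *: eb R K.

Lemma cf_res a K : cf (res a) K = cf a (lidx @: K).
Proof.
rewrite cf_sum (bigD1 K) //= cfZ cf_eb eqxx mulr1 big1 ?addr0 // => J neJK.
by rewrite cfZ cf_eb eq_sym (negbTE neJK) mulr0.
Qed.

Lemma res_is_linear : linear res.
Proof. by move=> k a b; apply: ext_eqP => K; rewrite !(cfD, cfZ, cf_res). Qed.
HB.instance Definition _ :=
  GRing.isLinear.Build C (extalg R n.+1) (extalg R n) _ res res_is_linear.

End Restriction.

Section GenCoefficients.
Variables (R : realType) (n : nat).
Implicit Types (x : idx n) (K : {set idx n}) (a : extalg R n).

Lemma cf_genM x a K : cf (gen R x * a) K =
  if x \in K then (-1) ^+ (\sum_(y in K :\ x) (rk y < rk x))%N * cf a (K :\ x)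
  else 0.
Proof.
rewrite {1}[a]eb_expand mulr_sumr cf_sum.
case: ifP => xK; last first.
  rewrite big1 // => J _; rewrite -scalerAr cfZ gen_eb.
  case: ifP => xJ; first by rewrite cf0 mulr0.
  rewrite cfZ cf_eb; have /negbTE -> : K != x |: J; last by rewrite !mulr0.
  by apply/eqP => eK; rewrite eK !inE eqxx in xK.
rewrite (bigD1 (K :\ x)) //= big1 => [|J neJ].
  by rewrite addr0 -scalerAr cfZ gen_eb !inE eqxx /= cfZ cf_eb setD1K // eqxx
    mulr1 mulrC.
rewrite -scalerAr cfZ gen_eb; case: ifP => xJ; first by rewrite cf0 mulr0.
rewrite cfZ cf_eb; have /negbTE -> : K != x |: J; last by rewrite !mulr0.
by apply/eqP => eK; move: neJ; rewrite eK setU1K ?eqxx // xJ.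
Qed.

(* The two signs cancel: no index has rank between [inl j] and [inr j]. *)
Lemma cf_thetaM (j : 'I_n) a K : inl j \in K -> inr j \in K ->
  cf (theta R j * a) K = iC R * cf a (K :\ inl j :\ inr j).
Proof.
move=> lK rK; rewrite -scalerAl cfZ -mulrA !cf_genM lK !inE rK /=.
congr (_ * _); rewrite mulrA -exprD.
rewrite (bigD1 (inr j)) ?inE ?rK //= ltnNge leqnSn add0n.
have -> : (\sum_(y in K :\ inl j | y != inr j) (rk y < 2 * j) =
           \sum_(y in K :\ inl j :\ inr j) (rk y < (2 * j).+1))%N.
  rewrite (eq_bigl (mem (K :\ inl j :\ inr j))) => [|y]; last first.
    by rewrite !inE andbC.
  apply: eq_bigr => y; rewrite !inE => /and3P[_ nel _].
  have : rk y != rk (inl j) by rewrite (inj_eq (@rk_inj n)).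
  by rewrite /= ltnS [in RHS]leq_eqVlt => /negbTE ->.
by rewrite addnn -mul2n exprM sqrrN expr1n expr1n mul1r.
Qed.

End GenCoefficients.

Section RestrictionMorphism.
Variables (R : realType) (n : nat) (j : 'I_n.+1).
Local Notation C := R[i].
Local Notation gen := (@gen R _).
Local Notation res := (@res R n j).
Local Notation lidx := (@lidx n j).
Local Notation dz := (gen (inl j)).
Local Notation dzb := (gen (inr j)).
Local Notation th := (theta R j).

Lemma resD a b : res (a + b) = res a + res b.
Proof. exact: linearD. Qed.

Lemma resZ k a : res (k *: a) = k *: res a.
Proof. exact: linearZ. Qed.

Lemma res0 : res 0 = 0.
Proof. exact: linear0. Qed.

Lemma res_sum (T : Type) (r : seq T) (P : pred T) (F : T -> extalg R n.+1) :
  res (\sum_(i <- r | P i) F i) = \sum_(i <- r | P i) res (F i).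
Proof. exact: linear_sum. Qed.

Lemma res_gen_inl : res dz = 0.
Proof.
apply: ext_eqP => K; rewrite cf_res cf0 genE cf_eb.
case: eqP => // /setP/(_ (inl j)); rewrite !inE eqxx => /imsetP[x _ /eqP].
by rewrite eq_sym (negbTE (lidx_inl _ _)).
Qed.

Lemma res_gen_inr : res dzb = 0.
Proof.
apply: ext_eqP => K; rewrite cf_res cf0 genE cf_eb.
case: eqP => // /setP/(_ (inr j)); rewrite !inE eqxx => /imsetP[x _ /eqP].
by rewrite eq_sym (negbTE (lidx_inr _ _)).
Qed.

Lemma res_gen_lidx x : res (gen (lidx x)) = gen x.
Proof.
apply: ext_eqP => K; rewrite cf_res !genE !cf_eb -imset_set1.
by rewrite (inj_eq (imset_inj (@lidx_inj n j))).
Qed.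

Lemma res1 : res 1 = 1.
Proof.
apply: ext_eqP => K; rewrite cf_res !ext_oneE !cf_eb.
by rewrite -(imset0 lidx) (inj_eq (imset_inj (@lidx_inj n j))).
Qed.

Lemma res_genM y a : res (gen y * a) = res (gen y) * res a.
Proof.
case: (lidxP j y) => [->|->|[x ->]].
- rewrite res_gen_inl mul0r; apply: ext_eqP => K; rewrite cf_res cf0 cf_genM.
  case: ifP => // /imsetP[x _ /eqP].
  by rewrite eq_sym (negbTE (lidx_inl _ _)).
- rewrite res_gen_inr mul0r; apply: ext_eqP => K; rewrite cf_res cf0 cf_genM.
  case: ifP => // /imsetP[x _ /eqP].
  by rewrite eq_sym (negbTE (lidx_inr _ _)).
rewrite res_gen_lidx; apply: ext_eqP => K; rewrite cf_res !cf_genM.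
rewrite (mem_imset _ _ (@lidx_inj n j)); case: ifP => // xK.
have -> : lidx @: K :\ lidx x = lidx @: (K :\ x).
  apply/setP => z; rewrite !inE; apply/andP/imsetP => [[nez /imsetP[w wK ez]]|].
    exists w => //; rewrite !inE wK andbT; apply: contra nez => /eqP <-.
    by rewrite ez.
  move=> [w]; rewrite !inE => /andP[newx wK] ->.
  by rewrite (inj_eq (@lidx_inj n j)) newx imset_f.
rewrite cf_res big_imset /=; last by move=> u v _ _; apply: lidx_inj.
by congr (_ ^+ _ * _); apply: eq_bigr => z _; rewrite rk_lidx.
Qed.

Lemma resM a b : res (a * b) = res a * res b.
Proof. by apply: genM_mult; [exact: res1 | exact: res_genM]. Qed.

Lemma res_prod (T : Type) (r : seq T) (F : T -> extalg R n.+1) :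
  res (\prod_(i <- r) F i) = \prod_(i <- r) res (F i).
Proof. exact: (big_morph res resM res1). Qed.

Lemma res_cj a : res (cj a) = cj (res a).
Proof.
elim/ext_ind: a => [|x a IH|a b IHa IHb|k a IH].
- by rewrite cj1 res1 cj1.
- rewrite cj_genM !resM cjM IH; congr (_ * _).
  case: (lidxP j x) => [->|->|[y ->]] /=.
  + by rewrite res_gen_inl res_gen_inr cj0.
  + by rewrite res_gen_inl res_gen_inr cj0.
  + by rewrite res_gen_lidx cj_gen -res_gen_lidx; case: y.
- by rewrite cjD !resD cjD IHa IHb.
- by rewrite cjZ !resZ cjZ IH.
Qed.

Lemma pq_res p q a : pq p q a -> pq p q (res a).
Proof.
elim/pq_ind => {p q a} [p q||p q k a IH|p q k a IH|p q a b IHa IHb|p q k a IH].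
- by rewrite res0 pq0.
- by rewrite res1 pq1.
- rewrite resM; case: (lidxP j (inl k)) => [->|//|[[l|l] // ->]].
    by rewrite res_gen_inl mul0r pq0.
  by rewrite res_gen_lidx; apply: (pqM (pq_gen_l _ _) IH).
- rewrite resM; case: (lidxP j (inr k)) => [//|->|[[l|l] // ->]].
    by rewrite res_gen_inr mul0r pq0.
  by rewrite res_gen_lidx; apply: (pqM (pq_gen_r _ _) IH).
- by rewrite resD pqD.
- by rewrite resZ pqZ.
Qed.

Lemma res_theta : res th = 0.
Proof. by rewrite resZ resM res_gen_inl mul0r scaler0. Qed.

Lemma res_hform h : res (hform h) = hform (row' j (col' j h)).
Proof.
rewrite /hform res_sum (bigD1_ord j) //= [X in X + _]res_sum.
rewrite big1 ?add0r => [|k _]; last first.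
  by rewrite resZ resM res_gen_inl mul0r scaler0.
apply: eq_bigr => k _; rewrite res_sum (bigD1_ord j) //=.
rewrite resZ resM res_gen_inr mulr0 scaler0 add0r.
apply: eq_bigr => l _; rewrite resZ resM !mxE.
by rewrite (res_gen_lidx (inl k)) (res_gen_lidx (inr l)).
Qed.

Lemma imset_lidx (K : {set idx n}) :
  (lidx @: K) = (inl j |: (inr j |: lidx @: K)) :\ inl j :\ inr j.
Proof.
have lN : inl j \notin lidx @: K.
  by apply/imsetP => -[x _ /eqP]; rewrite eq_sym (negbTE (lidx_inl _ _)).
have rN : inr j \notin lidx @: K.
  by apply/imsetP => -[x _ /eqP]; rewrite eq_sym (negbTE (lidx_inr _ _)).
by rewrite !setU1K // !inE negb_or lN.
Qed.

(** The monomials free of dz_j and dzbar_j, whose coefficients [res] records, are sent by [th] to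
    distinct monomials with the factor [iC]. *)
Lemma theta_mul_eq0 a : th * a = 0 -> res a = 0.
Proof.
move=> h; apply: ext_eqP => K; rewrite cf_res cf0 imset_lidx.
have := congr1 (fun b => cf b (inl j |: (inr j |: lidx @: K))) h.
rewrite cf0 cf_thetaM ?inE ?eqxx ?orbT // => /eqP.
by rewrite mulf_eq0 (negbTE (iC_neq0 R)) => /eqP.
Qed.

(** The factor i of [th] accounts for the extra [iC] in the normalization of [vc] one dimension
    higher. This is how a product with a sum of [theta j] becomes a sum over hyperplanes. *)
Lemma vc_thetaM a : vc (th * a) = vc (res a).
Proof.
rewrite /vc cf_thetaM ?inE // cf_res.
have -> : lidx @: setT = [set: idx n.+1] :\ inl j :\ inr j.
  rewrite imset_lidx; congr (_ :\ _ :\ _); apply/setP => y; rewrite !inE.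
  case: (lidxP j y) => [->|->|[x ->]]; rewrite ?eqxx ?orbT //.
  by rewrite imset_f ?inE ?orbT.
by rewrite exprS invfM mulrACA mulfV ?iC_neq0 // mul1r.
Qed.

End RestrictionMorphism.

(** * Splitting a form along one coordinate *)

Section Splitting.
Variables (R : realType) (n : nat) (j : 'I_n.+1).
Local Notation C := R[i].
Local Notation gen := (@gen R _).
Local Notation iC := (@iC R).
Local Notation res := (@res R n j).
Local Notation lidx := (@lidx n j).
Local Notation dz := (gen (inl j)).
Local Notation dzb := (gen (inr j)).
Local Notation th := (theta R j).

(** Pullback along the projection that forgets z_j; it is a section of [res]. *)
Definition inc : extalg R n -> extalg R n.+1 := hom (fun x => gen (lidx x)).

Let lidx_anticomm x y :
  gen (lidx x) * gen (lidx y) = - (gen (lidx y) * gen (lidx x)).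
Proof. exact: gen_anticomm. Qed.

Lemma incM a b : inc (a * b) = inc a * inc b.
Proof. exact: homM. Qed.
Lemma incD a b : inc (a + b) = inc a + inc b.
Proof. exact: linearD. Qed.
Lemma incZ k a : inc (k *: a) = k *: inc a.
Proof. exact: linearZ. Qed.
Lemma inc0 : inc 0 = 0. Proof. exact: linear0. Qed.
Lemma incN a : inc (- a) = - inc a. Proof. exact: linearN. Qed.
Lemma inc1 : inc 1 = 1. Proof. exact: hom1. Qed.
Lemma inc_gen x : inc (gen x) = gen (lidx x). Proof. exact: hom_gen. Qed.
Lemma inc_genM x a : inc (gen x * a) = gen (lidx x) * inc a.
Proof. exact: hom_genM. Qed.

Lemma incX k a : inc (a ^+ k) = inc a ^+ k.
Proof. by elim: k => [|k IH]; rewrite ?inc1 // !exprS incM IH. Qed.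

Lemma resK : cancel inc res.
Proof.
move=> a; elim/ext_ind: a => [|x a IH|a b IHa IHb|k a IH].
- by rewrite inc1 res1.
- by rewrite inc_genM resM res_gen_lidx IH.
- by rewrite incD resD IHa IHb.
- by rewrite incZ resZ IH.
Qed.

Lemma inc_cj a : inc (cj a) = cj (inc a).
Proof.
elim/ext_ind: a => [|x a IH|a b IHa IHb|k a IH].
- by rewrite cj1 inc1 cj1.
- by rewrite cj_genM !inc_genM cj_genM IH; case: x.
- by rewrite cjD !incD cjD IHa IHb.
- by rewrite cjZ !incZ cjZ IH.
Qed.

Lemma pq_inc p q a : pq p q a -> pq p q (inc a).
Proof.
move=> ha; have := @hom_pq R n n.+1 (fun x => gen (lidx x)) 1 0 0 1 _ _ _ p q a ha.
rewrite !muln0 !muln1 add0n addn0; apply => [k|k|x y].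
- exact: pq_gen_l.
- exact: pq_gen_r.
- exact: gen_anticomm.
Qed.

Lemma inc_theta k : inc (theta R k) = theta R (lift j k).
Proof. by rewrite incZ incM !inc_gen. Qed.

(* The bidegree of a form after removing [dp] factors dz and [dq] factors dzbar;
   when [p < dp] or [q < dq] only the zero form qualifies. *)
Definition pqs dp dq p q (a : extalg R n) :=
  a = 0 \/ exists p' q', [/\ p = (p' + dp)%N, q = (q' + dq)%N & pq p' q' a].

Lemma pqs0 dp dq p q : pqs dp dq p q 0. Proof. by left. Qed.

Lemma pqsD dp dq p q a b :
  pqs dp dq p q a -> pqs dp dq p q b -> pqs dp dq p q (a + b).
Proof.
case=> [->|[p' [q' [ep eq ha]]]]; first by rewrite add0r.
case=> [->|[p2 [q2 [ep2 eq2 hb]]]]; first by rewrite addr0; right; exists p', q'.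
right; exists p', q'; split=> //; apply: pqD => //; apply: pq_eq hb _ _; lia.
Qed.

Lemma pqsZ dp dq p q k a : pqs dp dq p q a -> pqs dp dq p q (k *: a).
Proof.
case=> [->|[p' [q' [ep eq ha]]]]; first by rewrite scaler0; left.
by right; exists p', q'; split=> //; apply: pqZ.
Qed.

Lemma pqsN dp dq p q a : pqs dp dq p q a -> pqs dp dq p q (- a).
Proof. by rewrite -scaleN1r; apply: pqsZ. Qed.

Lemma pqs_gen_l dp dq p q k a :
  pqs dp dq p q a -> pqs dp dq p.+1 q (gen (inl k) * a).
Proof.
case=> [->|[p' [q' [-> -> ha]]]]; first by rewrite mulr0; left.
by right; exists p'.+1, q'; split=> //; apply: (pqM (pq_gen_l _ _) ha).
Qed.

Lemma pqs_gen_r dp dq p q k a :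
  pqs dp dq p q a -> pqs dp dq p q.+1 (gen (inr k) * a).
Proof.
case=> [->|[p' [q' [-> -> ha]]]]; first by rewrite mulr0; left.
by right; exists p', q'.+1; split=> //; apply: (pqM (pq_gen_r _ _) ha).
Qed.

Lemma pqs_shift dp dq ep eq p q a : pqs dp dq p q a ->
  pqs (ep + dp) (eq + dq) (ep + p) (eq + q) a.
Proof.
case=> [->|[p' [q' [-> -> ha]]]]; first by left.
by right; exists p', q'; split=> //; lia.
Qed.

Definition assemble (a u v b : extalg R n) :=
  inc a + dz * inc u + dzb * inc v + th * inc b.

Lemma dz_th : dz * th = 0.
Proof. by rewrite -scalerAr mulrA gen_sq mul0r scaler0. Qed.

Lemma dzb_th : dzb * th = 0.
Proof. by rewrite theta_central -scalerAl -mulrA gen_sq mulr0 scaler0. Qed.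

Lemma dz_dzb : dz * dzb = - iC *: th.
Proof. by rewrite scalerA mulNr iC_sq opprK scale1r. Qed.

Lemma dzb_dz : dzb * dz = iC *: th.
Proof. by rewrite gen_anticomm dz_dzb scaleNr opprK. Qed.

Lemma splitting p q (a : extalg R n.+1) : pq p q a ->
  exists a0 u v b, [/\ a = assemble a0 u v b, pqs 0 0 p q a0, pqs 1 0 p q u,
    pqs 0 1 p q v & pqs 1 1 p q b].
Proof.
elim/pq_ind => {p q a} [p q||p q k a|p q k a|p q a b|p q k a].
- exists 0, 0, 0, 0; split; try exact: pqs0.
  by rewrite /assemble inc0 !mulr0 !addr0.
- exists 1, 0, 0, 0; split; try exact: pqs0.
    by rewrite /assemble inc0 inc1 !mulr0 !addr0.
  by right; exists 0%N, 0%N; split=> //; apply: pq1.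
- move=> [a0 [u [v [b [-> h0 h1 h2 h3]]]]].
  case: (lidxP j (inl k)) => [->|//|[[l|l] // ->]].
    (* Multiplication by dz sends the first slot to the second and the third to the fourth, with dz
       dzbar = - i [th]; it kills the other two. *)
    exists 0, a0, 0, (- iC *: v); split.
    + rewrite /assemble !mulrDr inc0 !mulr0 !mulrA gen_sq mul0r dz_dzb dz_th mul0r.
      by rewrite !(add0r, addr0) incZ -scalerAl scalerAr.
    + exact: pqs0.
    + exact: (pqs_shift 1 0 h0).
    + exact: pqs0.
    + exact: pqsZ (pqs_shift 1 0 h2).
  (* A generator of the hyperplane anticommutes with dz and dzbar and commutes with [th], hence the
     signs of the two middle components. *)
  exists (gen (inl l) * a0), (- (gen (inl l) * u)), (- (gen (inl l) * v)),
    (gen (inl l) * b); split.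
  + rewrite /assemble !mulrDr !incN !inc_genM; congr (_ + _ + _ + _).
    * by rewrite mulrA gen_anticomm mulNr mulrN mulrA.
    * by rewrite mulrA gen_anticomm mulNr mulrN mulrA.
    * by rewrite mulrA theta_central mulrA.
  + exact: pqs_gen_l.
  + by apply/pqsN/pqs_gen_l.
  + by apply/pqsN/pqs_gen_l.
  + exact: pqs_gen_l.
- move=> [a0 [u [v [b [-> h0 h1 h2 h3]]]]].
  case: (lidxP j (inr k)) => [//|->|[[l|l] // ->]].
    exists 0, 0, a0, (iC *: u); split.
    + rewrite /assemble !mulrDr inc0 !mulr0 !mulrA gen_sq mul0r dzb_dz dzb_th mul0r.
      by rewrite !(add0r, addr0) incZ -scalerAl scalerAr.
    + exact: pqs0.
    + exact: pqs0.
    + exact: (pqs_shift 0 1 h0).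
    + exact: pqsZ (pqs_shift 0 1 h1).
  exists (gen (inr l) * a0), (- (gen (inr l) * u)), (- (gen (inr l) * v)),
    (gen (inr l) * b); split.
  + rewrite /assemble !mulrDr !incN !inc_genM; congr (_ + _ + _ + _).
    * by rewrite mulrA gen_anticomm mulNr mulrN mulrA.
    * by rewrite mulrA gen_anticomm mulNr mulrN mulrA.
    * by rewrite mulrA theta_central mulrA.
  + exact: pqs_gen_r.
  + by apply/pqsN/pqs_gen_r.
  + by apply/pqsN/pqs_gen_r.
  + exact: pqs_gen_r.
- move=> [a0 [u [v [b0 [-> h0 h1 h2 h3]]]]] [a0' [u' [v' [b0' [-> h0' h1' h2' h3']]]]].
  exists (a0 + a0'), (u + u'), (v + v'), (b0 + b0'); split; try exact: pqsD.
  rewrite /assemble !incD !mulrDr.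
  by rewrite addrACA; congr (_ + _); rewrite addrACA; congr (_ + _); rewrite addrACA.
- move=> [a0 [u [v [b0 [-> h0 h1 h2 h3]]]]].
  exists (k *: a0), (k *: u), (k *: v), (k *: b0); split; try exact: pqsZ.
  by rewrite /assemble !incZ !scalerDr -!scalerAr.
Qed.

Lemma theta_inc_eq0 a : th * inc a = 0 -> a = 0.
Proof. by move/theta_mul_eq0; rewrite resK. Qed.

(** Restriction isolates [a]; then multiplication by dzbar isolates [u], multiplication by dz
    isolates [v], and [b] remains. *)
Lemma assemble_eq0 a u v b : assemble a u v b = 0 ->
  [/\ a = 0, u = 0, v = 0 & b = 0].
Proof.
rewrite /assemble => h.
have a0 : a = 0.
  have := congr1 res h; rewrite !resD !resM res_gen_inl res_gen_inr res_theta.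
  by rewrite resK res0 !mul0r !addr0.
move: h; rewrite a0 inc0 add0r => h.
have u0 : u = 0.
  have := congr1 (fun x => dzb * x) h; rewrite !mulrDr !mulrA gen_sq dzb_th dzb_dz.
  rewrite !mul0r mulr0 !addr0 -scalerAl => /eqP.
  by rewrite scaler_eq0 (negbTE (iC_neq0 R)) => /eqP /theta_inc_eq0.
have v0 : v = 0.
  have := congr1 (fun x => dz * x) h; rewrite !mulrDr !mulrA gen_sq dz_th dz_dzb.
  rewrite !mul0r mulr0 !addr0 add0r -scalerAl => /eqP.
  by rewrite scaler_eq0 oppr_eq0 (negbTE (iC_neq0 R)) => /eqP /theta_inc_eq0.
split=> //; move: h; rewrite u0 v0 inc0 !mulr0 !add0r; exact: theta_inc_eq0.
Qed.

Lemma cf_inc_eq0 y a (K : {set idx n.+1}) :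
  (forall x, lidx x != y) -> y \in K -> cf (inc a) K = 0.
Proof.
move=> hy; elim/ext_ind: a K => [|x a IH|a b IHa IHb|k a IH] K yK.
- rewrite inc1 ext_oneE cf_eb; case: eqP => // K0.
  by move: yK; rewrite K0 inE.
- rewrite inc_genM cf_genM; case: ifP => // _.
  by rewrite IH ?mulr0 // !inE yK andbT eq_sym hy.
- by rewrite incD cfD IHa ?IHb ?addr0.
- by rewrite incZ cfZ IH ?mulr0.
Qed.

Lemma vc_assemble a u v b : vc (assemble a u v b) = vc b.
Proof.
rewrite /assemble !vcD vc_thetaM resK /vc !cf_genM !inE /=.
rewrite (cf_inc_eq0 a (lidx_inl j)) ?inE //.
rewrite (cf_inc_eq0 u (lidx_inr j)) ?inE //.
rewrite (cf_inc_eq0 v (lidx_inl j)) ?inE //.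
by rewrite !mulr0 mul0r !add0r.
Qed.

End Splitting.

(** * Paths of Hermitian matrices *)

Section Path.
Variable R : realType.
Local Notation C := R[i].
Local Notation "x %:C" := (real_complex _ x) (format "x %:C") : ring_scope.
Local Notation "M ^t*" := (map_mx Num.conj (M^T)) (at level 30).
Implicit Types (f g : R -> C) (s t : R).

Definition unit_itv t := (0 <= t <= 1).

(** Lipschitz on the unit interval, standing for continuity: it is stable under sums, products and
    conjugation, hence passes to determinants and adjugates. The constant lies in [C] so that it
    compares directly with norms. *)
Definition lip f := exists2 K : C, 0 <= K &
  forall s t, unit_itv s -> unit_itv t -> `|f s - f t| <= K * (`|s - t|)%:C.

Lemma norm_itv_le1 s t : unit_itv s -> unit_itv t -> (`|s - t|)%:C <= 1 :> C.
Proof.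
move=> /andP[s0 s1] /andP[t0 t1]; rewrite -[1]/(1%:C) lecR ler_norml.
by apply/andP; split; lra.
Qed.

Lemma normC_ge0 (r : R) : 0 <= (`|r|)%:C :> C.
Proof. by rewrite -[0]/(0%:C) lecR. Qed.

Lemma lip_const (k : C) : lip (fun=> k).
Proof. by exists 0 => // s t _ _; rewrite subrr normr0 mul0r. Qed.

Lemma lip_eq f g : lip f -> f =1 g -> lip g.
Proof. by move=> [K K0 hK] fg; exists K => // s t; rewrite -!fg; apply: hK. Qed.

Lemma lip_id : lip (fun t => t%:C).
Proof.
exists 1 => // s t _ _; rewrite mul1r -rmorphB /=.
by rewrite normc_def /= expr0n addr0 sqrtr_sqr.
Qed.

Lemma lipD f g : lip f -> lip g -> lip (fun t => f t + g t).
Proof.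
move=> [K K0 hK] [L L0 hL]; exists (K + L) => [|s t hs ht]; first exact: addr_ge0.
rewrite opprD addrACA mulrDl (le_trans (ler_normD _ _)) // lerD //.
  exact: hK.
exact: hL.
Qed.

Lemma lipN f : lip f -> lip (fun t => - f t).
Proof.
move=> [K K0 hK]; exists K => // s t hs ht.
by rewrite -opprD normrN; apply: hK.
Qed.

Lemma lip_conj f : lip f -> lip (fun t => (f t)^*).
Proof.
move=> [K K0 hK]; exists K => // s t hs ht.
by rewrite -rmorphB norm_conjC; apply: hK.
Qed.

Lemma lip_bounded f : lip f ->
  exists2 M : C, 0 <= M & forall t, unit_itv t -> `|f t| <= M.
Proof.
move=> [K K0 hK]; exists (`|f 0| + K) => [|t ht]; first exact: addr_ge0.
have h0 : unit_itv 0 by rewrite /unit_itv lexx ler01.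
rewrite -[f t](subrK (f 0)) addrC (le_trans (ler_normD _ _)) // lerD2l.
by rewrite (le_trans (hK _ _ ht h0)) // ler_piMr // norm_itv_le1.
Qed.

Lemma lipM f g : lip f -> lip g -> lip (fun t => f t * g t).
Proof.
move=> lf lg; have [M M0 hM] := lip_bounded lf; have [L L0 hL] := lip_bounded lg.
case: lf lg => [K K0 hK] [K' K'0 hK'].
exists (M * K' + L * K) => [|s t hs ht].
  by rewrite addr_ge0 ?mulr_ge0.
have -> : f s * g s - f t * g t = f s * (g s - g t) + g t * (f s - f t) by ring.
rewrite mulrDl (le_trans (ler_normD _ _)) // !normrM -!mulrA lerD //.
  by rewrite ler_pM ?hM ?hK'.
by rewrite ler_pM ?hL ?hK.
Qed.

Lemma lip_sum (T : Type) (r : seq T) (P : pred T) (F : R -> T -> C) :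
  (forall i, P i -> lip (F^~ i)) -> lip (fun t => \sum_(i <- r | P i) F t i).
Proof.
move=> hF; elim: r => [|i r IH].
  by apply: lip_eq (lip_const 0) _ => t; rewrite big_nil.
case: (boolP (P i)) => Pi.
  by apply: lip_eq (lipD (hF i Pi) IH) _ => t; rewrite big_cons Pi.
by apply: lip_eq IH _ => t; rewrite big_cons (negbTE Pi).
Qed.

Lemma lip_prod (T : Type) (r : seq T) (P : pred T) (F : R -> T -> C) :
  (forall i, P i -> lip (F^~ i)) -> lip (fun t => \prod_(i <- r | P i) F t i).
Proof.
move=> hF; elim: r => [|i r IH].
  by apply: lip_eq (lip_const 1) _ => t; rewrite big_nil.
case: (boolP (P i)) => Pi.
  by apply: lip_eq (lipM (hF i Pi) IH) _ => t; rewrite big_cons Pi.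
by apply: lip_eq IH _ => t; rewrite big_cons (negbTE Pi).
Qed.

Definition lipmx m n (A : R -> 'M[C]_(m, n)) := forall i j, lip (fun t => A t i j).

Lemma lipmx_mul m n p (A : R -> 'M[C]_(m, n)) (B : R -> 'M[C]_(n, p)) :
  lipmx A -> lipmx B -> lipmx (fun t => A t *m B t).
Proof.
move=> lA lB i j; apply: (@lip_eq (fun t => \sum_k A t i k * B t k j)) => [|t].
  by apply: lip_sum => k _; apply: lipM.
by rewrite mxE.
Qed.

Lemma lipmxD m n (A B : R -> 'M[C]_(m, n)) :
  lipmx A -> lipmx B -> lipmx (fun t => A t + B t).
Proof.
by move=> lA lB i j; apply: lip_eq (lipD (lA i j) (lB i j)) _ => t; rewrite mxE.
Qed.

Lemma lipmxZ m n f (A : R -> 'M[C]_(m, n)) :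
  lip f -> lipmx A -> lipmx (fun t => f t *: A t).
Proof.
by move=> lf lA i j; apply: lip_eq (lipM lf (lA i j)) _ => t; rewrite mxE.
Qed.

Lemma lipmx_adj m n (A : R -> 'M[C]_(m, n)) : lipmx A -> lipmx (fun t => (A t)^t*).
Proof.
by move=> lA i j; apply: lip_eq (lip_conj (lA j i)) _ => t; rewrite !mxE.
Qed.

Lemma lip_det n (A : R -> 'M[C]_n) : lipmx A -> lip (fun t => \det (A t)).
Proof.
move=> lA; apply: lip_sum => s _; apply: lipM; first exact: lip_const.
by apply: lip_prod => i _; apply: lA.
Qed.

Lemma lipmx_adjugate n (A : R -> 'M[C]_n) : lipmx A -> lipmx (fun t => \adj (A t)).
Proof.
move=> lA i j; apply: (@lip_eq (fun t => cofactor (A t) j i)) => [|t]; last first.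
  by rewrite mxE.
apply: lipM; first exact: lip_const.
by apply: lip_det => k l; apply: lip_eq (lA (lift j k) (lift i l)) _ => t; rewrite !mxE.
Qed.

(** Let u be the supremum of the times up to which [P] holds throughout: the closedness hypothesis
    gives [P u], and the openness hypothesis excludes u < 1. *)
Lemma unit_itv_connected (P : R -> Prop) :
  P 0 ->
  (forall t, unit_itv t -> P t -> exists2 d : R, 0 < d &
     forall s, unit_itv s -> `|s - t| < d -> P s) ->
  (forall t, unit_itv t -> (forall d : R, 0 < d ->
     exists s, [/\ unit_itv s, `|s - t| < d & P s]) -> P t) ->
  P 1.
Proof.
move=> P0 Popen Pclosed.
pose E : classical_sets.set R := fun t => unit_itv t /\ forall s, 0 <= s <= t -> P s.
have E0 : E 0.
  split=> [|s s0]; first by rewrite /unit_itv lexx ler01.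
  by have -> : s = 0 by apply: le_anti; rewrite andbC.
have hE : classical_sets.has_sup E.
  by split; [exists 0 | exists 1 => t [/andP[]]].
set u := sup E.
have ubE t : E t -> t <= u by apply: (sup_upper_bound hE).
have u0 : 0 <= u by apply: ubE.
have u1 : u <= 1 by apply: sup_le_ub; [exists 0 | move=> t [/andP[]]].
have iu : unit_itv u by apply/andP.
have below s : 0 <= s -> s < u -> P s.
  move=> s0 su; have d0 : 0 < u - s by rewrite subr_gt0.
  have [e [_ hPe] ue] := sup_adherent d0 hE.
  by apply: hPe; rewrite s0 /=; move: ue; rewrite -/u; lra.
have Pu : P u.
  apply: Pclosed => // d d0.
  have [e [ie hPe] ue] := sup_adherent d0 hE; have eu := ubE e (conj ie hPe).
  exists e; split=> //; last by apply: hPe; case/andP: ie => -> _ /=.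
  by rewrite distrC ger0_norm; move: ue; rewrite -/u; lra.
have [d d0 hd] := Popen u iu Pu.
case: (ltP u 1) => [lu1|]; last first.
  by move=> h; have <- : u = 1 by apply: le_anti; rewrite u1.
pose v := Num.min 1 (u + d / 2).
have uv : u < v by rewrite lt_min lu1 /= ltrDl divr_gt0.
have vd : v <= u + d / 2 by rewrite ge_min lexx orbT.
have v1 : v <= 1 by rewrite ge_min lexx.
suff /ubE : E v by rewrite leNgt uv.
split=> [|s /andP[s0 sv]]; first by apply/andP; split; lra.
case: (ltP s u) => [|us]; first exact: below.
apply: hd; first by apply/andP; split; lra.
by rewrite ger0_norm; lra.
Qed.

Lemma qf_lip n (A : R -> 'M[C]_n) : lipmx A ->
  exists2 K : C, 0 < K & forall s t x, unit_itv s -> unit_itv t ->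
    `|qf (A s) x - qf (A t) x| <= K * (`|s - t|)%:C * qf 1%:M x.
Proof.
move=> lA.
have /fin_all_exists [K hK] : forall i, exists K : 'I_n -> C, forall j, 0 <= K j /\
    forall s t, unit_itv s -> unit_itv t ->
    `|A s i j - A t i j| <= K j * (`|s - t|)%:C.
  move=> i; have /fin_all_exists [K hK] : forall j, exists K : C, 0 <= K /\
      forall s t, unit_itv s -> unit_itv t ->
      `|A s i j - A t i j| <= K * (`|s - t|)%:C.
    by move=> j; have [K K0 hK] := lA i j; exists K.
  by exists K.
(* The added 1 makes the constant strictly positive, so that one may divide by it in
   [C_small_scale]. *)
exists (1 + \sum_i \sum_j K i j) => [|s t x hs ht].
  rewrite ltr_pwDl // sumr_ge0 // => i _; rewrite sumr_ge0 // => j _.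
  exact: (hK i j).1.
have xle i : `|x 0 i| ^+ 2 <= qf 1%:M x.
  by rewrite qf1 (bigD1 i) //= lerDl sumr_ge0 // => k _; rewrite exprn_ge0.
have xxle i j : `|x 0 i| * `|x 0 j| <= qf 1%:M x.
  rewrite -(ler_pM2r (ltr0n _ 2)) mulr_natr mulr_natr [leRHS]mulr2n.
  apply: le_trans (lerD (xle i) (xle j)).
  rewrite -subr_ge0 addrAC -sqrrB -realEsqr.
  by rewrite rpredB // normr_real.
have -> : qf (A s) x - qf (A t) x =
    \sum_i \sum_j x 0 i * (A s i j - A t i j) * (x 0 j)^*.
  rewrite -qfN -qfD /qf mxE exchange_big; apply: eq_bigr => j _.
  rewrite mxE mulr_suml; apply: eq_bigr => i _; rewrite !mxE //.
rewrite mulrDl mul1r mulrDl.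
apply: (@le_trans _ _ ((\sum_i \sum_j K i j) * (`|s - t|)%:C * qf 1%:M x)).
  rewrite 2!mulr_suml (le_trans (ler_norm_sum _ _ _)) // ler_sum // => i _.
  rewrite 2!mulr_suml (le_trans (ler_norm_sum _ _ _)) // ler_sum // => j _.
  rewrite !normrM norm_conjC mulrAC [_ * `|A s i j - _|]mulrC.
  by rewrite ler_pM ?mulr_ge0 // (hK i j).2.
by rewrite lerDr mulr_ge0 ?normC_ge0 ?qf1_ge0.
Qed.

(** A positive element of [C] is real, so the real part of [c / K] does it. *)
Lemma C_small_scale (c K : C) : 0 < c -> 0 < K ->
  exists2 d : R, 0 < d & K * d%:C <= c.
Proof.
move=> c0 K0; have q0 : 0 < c / K by rewrite divr_gt0.
exists (complex.Re (c / K)).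
  by move: q0; rewrite ltcE /= => /andP[].
have -> : (complex.Re (c / K))%:C = c / K.
  move: (c / K) q0 => [a b]; rewrite ltcE /= => /andP[/eqP -> _].
  by [].
by rewrite mulrCA mulfV ?mulr1 // gt_eqF.
Qed.

(** Positivity is an open condition by coercivity. It is closed along the path because a limit of
    positive forms is semipositive, and a semipositive invertible matrix is positive. *)
Lemma posmx_path n (A : R -> 'M[C]_n) : lipmx A ->
  (forall t, unit_itv t -> hermx (A t)) ->
  (forall t, unit_itv t -> A t \in unitmx) ->
  posmx (A 0) -> posmx (A 1).
Proof.
move=> lA hA uA; have [K K0 hK] := qf_lip lA.
move=> p0; apply: (unit_itv_connected (P := fun t => posmx (A t)) p0) => t it.
  move=> pt; have [c c0 hc] := posmx_bound (hA t it) pt.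
  have [d d0 hd] := @C_small_scale c K c0 K0.
  exists d; first exact: d0.
  move=> s is_ std x x0.
  have x1 := qf1_gt0 x0.
  have := hK s t x is_ it; rewrite distrC => h.
  have lt1 : K * (`|s - t|)%:C * qf 1%:M x < c * qf 1%:M x.
    rewrite ltr_pM2r // (lt_le_trans _ hd) // ltr_pM2l // ltcR.
    by move: std.
  have := hc x.
  have re : qf (A t) x - qf (A s) x <= `|qf (A t) x - qf (A s) x|.
    exact: real_ler_norm (rpredB (qf_real x (hA t it)) (qf_real x (hA s is_))).
  move=> h2; have := lt_le_trans (le_lt_trans re (le_lt_trans h lt1)) h2.
  by rewrite ltrBlDr ltrDl.
move=> near_t; apply: psd_unit_pos; last exact: uA.
split=> [|x]; first exact: hA.
have [->|x0] := eqVneq x 0; first by rewrite qf0.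
have x1 := qf1_gt0 x0.
have rt := qf_real x (hA t it).
rewrite real_leNgt ?rpred0 //; apply/negP => neg.
have c0 : 0 < - qf (A t) x / qf 1%:M x by rewrite divr_gt0 // oppr_gt0.
have [d d0 hd] := C_small_scale c0 K0.
have [s [is_ std ps]] := near_t d d0.
have h := hK s t x is_ it.
have lt1 : K * (`|s - t|)%:C * qf 1%:M x < - qf (A t) x.
  rewrite -ltr_pdivlMr // (lt_le_trans _ hd) // ltr_pM2l // ltcR.
  by move: std.
have re : qf (A s) x - qf (A t) x <= `|qf (A s) x - qf (A t) x|.
  exact: real_ler_norm (rpredB (qf_real x (hA s is_)) rt).
have := le_lt_trans re (le_lt_trans h lt1).
by rewrite gtrDr => /lt_trans/(_ (ps x x0)); rewrite ltxx.
Qed.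

End Path.

(** * Positivity on a moving orthogonal complement *)

Section PrimitivePath.
Local Notation "M ^t*" := (map_mx Num.conj (M^T)) (at level 30).

(** Positivity on the [G]-orthogonal of the rows of [B]. In the application the rows span the
    products of b_0 with (p-1,q-1)-forms, and the orthogonal is the primitive space. *)
Definition prim_pos (C : numClosedFieldType) a b (G : 'M[C]_a) (B : 'M[C]_(b, a)) :=
  forall v : 'rV_a, v *m G *m B^t* = 0 -> v != 0 -> 0 < qf G v.

Section Fixed.
Variables (C : numClosedFieldType) (a b : nat) (G : 'M[C]_a) (B : 'M[C]_(b, a)).
Let N := B *m G *m B^t*.
Hypotheses (hG : hermx G) (uG : G \in unitmx) (uN : N \in unitmx).

(* Up to the factor |det N|^2, the form [G] composed with the projection onto the
   orthogonal of the rows of [B], plus a form that is positive on the rows of [B];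
   the adjugate keeps it polynomial in the entries of [G] and [B]. *)
Definition prim_form : 'M[C]_a :=
  (\det N * (\det N)^*) *: G
  + (- (\det N)^*) *: (G *m B^t* *m \adj N *m B *m G)
  + G *m B^t* *m B *m G.

Let k := \det N * (\det N)^*.
Let k_gt0 : 0 < k.
Proof. by rewrite mul_conjC_gt0; move: uN; rewrite unitmxE unitfE. Qed.

Let hN : hermx N.
Proof. by rewrite /hermx !adjmxM adjmxK hG mulmxA. Qed.

Let invN := invmx N.

Let hinvN : invN^t* = invN.
Proof. by rewrite /invN trmx_inv map_invmx hN. Qed.

Let adjE : (- (\det N)^*) *: \adj N = (- k) *: invN.
Proof.
have -> : \adj N = \det N *: invN.
  rewrite -[LHS](mulmxK uN) mul_adj_mx -/invN.
  by rewrite mul_scalar_mx.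
by rewrite scalerA mulNr /k mulrC.
Qed.

Let prim_formE : prim_form =
  k *: (G - G *m B^t* *m invN *m B *m G) + G *m B^t* *m B *m G.
Proof.
rewrite /prim_form; congr (_ + _); rewrite scalerBr -/k; congr (_ + _).
have aux (c : C) (X : 'M_b) :
    c *: (G *m B^t* *m X *m B *m G) = G *m B^t* *m (c *: X) *m B *m G.
  by rewrite -scalemxAr -!scalemxAl.
by rewrite -scaleNr !aux adjE.
Qed.

Lemma prim_form_herm : hermx prim_form.
Proof.
rewrite prim_formE /hermx adjmxD adjmxZ.
have -> : k^* = k by rewrite conj_Creal // gtr0_real.
congr (_ *: _ + _); last by rewrite !adjmxM adjmxK hG !mulmxA.
by rewrite -scaleN1r adjmxD adjmxZ rmorphN1 hG !adjmxM adjmxK hG hinvN !mulmxA.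
Qed.

Section Decompose.
Variable v : 'rV[C]_a.
(** The product [u *m B] is the [G]-orthogonal projection of [v] to the row space of [B], available
    because the Gram matrix [N] of the rows is invertible; [p] is the orthogonal part. *)
Let u := v *m G *m B^t* *m invN.
Let p := v - u *m B.

Let uNE : u *m N = v *m G *m B^t*.
Proof. by rewrite /u mulmxKV. Qed.

Let pGB : p *m G *m B^t* = 0.
Proof. by rewrite /p !mulmxBl -uNE /N !mulmxA subrr. Qed.

Let vH : v *m prim_form = k *: (p *m G) + u *m N *m B *m G.
Proof.
rewrite prim_formE mulmxDr -scalemxAr mulmxBr uNE !mulmxA; congr (_ *: _ + _).
by rewrite /p mulmxBl.
Qed.

Lemma qf_prim_form : qf prim_form v = k * qf G p + qf 1%:M (u *m N).
Proof.
rewrite /qf vH mulmxDl -scalemxAl mulmx1.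
have -> : p *m G *m v^t* = p *m G *m p^t*.
  rewrite -{1}[v](subrK (u *m B)) -/p adjmxD mulmxDr adjmxM.
  by rewrite [X in _ + X]mulmxA pGB mul0mx addr0.
have -> : u *m N *m B *m G *m v^t* = u *m N *m (u *m N)^t*.
  have -> : (u *m N)^t* = B *m G *m v^t* by rewrite uNE !adjmxM adjmxK hG mulmxA.
  by rewrite !mulmxA.
by rewrite mxE [X in X + _]mxE.
Qed.

Lemma prim_form_ker : v *m prim_form = 0 -> v = 0.
Proof.
move=> v0; have := congr1 (mulmx^~ (B^t*)) v0; rewrite /= vH mulmxDl mul0mx.
rewrite -scalemxAl pGB scaler0 add0r => h.
have u0 : u *m N *m N = 0 by rewrite -[RHS]h /N !mulmxA.
have {}u0 : u = 0 by rewrite -(mulmxK uN u) -(mulmxK uN (u *m N)) u0 !mul0mx.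
move: v0; rewrite vH u0 !mul0mx addr0 => /eqP; rewrite scaler_eq0 gt_eqF //=.
have -> : p = v by rewrite /p u0 mul0mx subr0.
by move/eqP => vG; rewrite -(mulmxK uG v) vG mul0mx.
Qed.

Lemma prim_form_gt0 : prim_pos G B -> v != 0 -> 0 < qf prim_form v.
Proof.
move=> hp v0; rewrite qf_prim_form.
have [p0|p0] := eqVneq p 0.
  rewrite p0 qf0 mulr0 add0r qf1_gt0 //; apply: contra v0 => /eqP uN0.
  have u0 : u = 0 by rewrite -(mulmxK uN u) uN0 mul0mx.
  by rewrite -(subrK (u *m B) v) -/p p0 u0 mul0mx addr0.
by rewrite ltr_pwDl ?qf1_ge0 // mulr_gt0 // hp.
Qed.

Lemma prim_form_pos : v *m G *m B^t* = 0 -> 0 < qf prim_form v -> 0 < qf G v.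
Proof.
move=> v0; rewrite qf_prim_form.
have u0 : u = 0 by rewrite /u v0 mul0mx.
have -> : p = v by rewrite /p u0 mul0mx subr0.
by rewrite u0 mul0mx qf0 addr0 pmulr_rgt0.
Qed.
End Decompose.

Lemma prim_form_unit : prim_form \in unitmx.
Proof.
rewrite -row_free_unit -kermx_eq0; apply/eqP/row_matrixP => i; rewrite row0.
by apply: prim_form_ker; rewrite -row_mul mulmx_ker row0.
Qed.
End Fixed.

(** Invertibility of [prim_form] follows from that of [G] and of the Gram matrix alone, so
    [posmx_path] applies on the whole fixed space and no basis of the moving complement has to be
    chosen. *)
Lemma prim_pos_path (R : realType) a b (G : R -> 'M[R[i]]_a) (B : R -> 'M[R[i]]_(b, a)) :
  lipmx G -> lipmx B ->
  (forall t, unit_itv t -> hermx (G t)) ->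
  (forall t, unit_itv t -> G t \in unitmx) ->
  (forall t, unit_itv t -> B t *m G t *m (B t)^t* \in unitmx) ->
  prim_pos (G 0) (B 0) -> prim_pos (G 1) (B 1).
Proof.
move=> lG lB hG uG uN p0 v v0 nv.
have i0 : unit_itv (0 : R) by rewrite /unit_itv lexx ler01.
have i1 : unit_itv (1 : R) by rewrite /unit_itv lexx ler01.
apply: (prim_form_pos (hG 1 i1) (uN 1 i1) v0).
have lBs := lipmx_adj lB.
have lN := lipmx_mul (lipmx_mul lB lG) lBs.
suff : posmx (prim_form (G 1) (B 1)) by apply.
apply: (posmx_path (A := fun t => prim_form (G t) (B t))) => [|t it|t it|x x0].
- apply: lipmxD; first apply: lipmxD.
  + by apply: lipmxZ => //; apply: lipM; [|apply: lip_conj]; apply: lip_det.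
  + apply: lipmxZ; first by apply/lipN/lip_conj/lip_det.
    by do !apply: lipmx_mul => //; apply: lipmx_adjugate.
  + by do !apply: lipmx_mul.
- exact: prim_form_herm (hG t it) (uN t it).
- exact: prim_form_unit (uG t it) (uN t it).
- by apply: prim_form_gt0 x0 => //; [apply: hG | apply: uN].
Qed.

End PrimitivePath.

(** * Hard Lefschetz and Hodge-Riemann *)

Section HardLefschetz.
Variable R : realType.
Local Notation C := R[i].
Local Notation "M ^t*" := (map_mx Num.conj (M^T)) (at level 30).

Definition fprod n (bs : seq 'M[C]_n) : extalg R n := \prod_(h <- bs) hform h.

Lemma fprod_cons n (h : 'M[C]_n) bs : fprod (h :: bs) = hform h * fprod bs.
Proof. by rewrite /fprod big_cons. Qed.

Lemma fprod_nil n : fprod ([::] : seq 'M[C]_n) = 1.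
Proof. by rewrite /fprod big_nil. Qed.

Lemma fprod_central n (bs : seq 'M[C]_n) a : a * fprod bs = fprod bs * a.
Proof.
elim: bs => [|h bs IH]; first by rewrite fprod_nil mulr1 mul1r.
by rewrite fprod_cons mulrA hform_central -mulrA IH mulrA.
Qed.

Lemma pq_fprod n (bs : seq 'M[C]_n) : pq (size bs) (size bs) (fprod bs).
Proof.
elim: bs => [|h bs IH]; first by rewrite fprod_nil; apply: pq1.
by rewrite fprod_cons; apply: (pqM (pq_hform h) IH).
Qed.

Fixpoint good n r (bs : seq 'M[C]_n) : Prop :=
  if bs is h :: bs' then [/\ psdmx h, (r <= \rank h)%N & good r.+1 bs'] else True.

Lemma cj_fprod n r (bs : seq 'M[C]_n) : good r bs -> cj (fprod bs) = fprod bs.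
Proof.
elim: bs r => [|h bs IH] r; first by rewrite fprod_nil cj1.
case=> -[hh _] _ /IH e; rewrite fprod_cons cjM e cj_hform // => j k.
by rewrite -{1}hh !mxE.
Qed.

Lemma good_res n r (bs : seq 'M[C]_n.+1) (j : 'I_n.+1) :
  good r.+1 bs -> good r [seq row' j (col' j h) | h <- bs].
Proof.
elim: bs r => //= h bs IH r [ph rh /IH gb].
by have [pr rr] := psd_rank_submx j ph; split=> //; rewrite -ltnS (leq_trans rh).
Qed.

Lemma good_conj n r (bs : seq 'M[C]_n) (P : 'M[C]_n) : P \in unitmx ->
  good r bs -> good r [seq P^t* *m h *m P | h <- bs].
Proof.
move=> uP; elim: bs r => [//|h bs IH] r [ph rh /IH gb].
split; [exact: psdmx_conj | | exact: gb].
have fP : row_full (P^t*) by rewrite row_full_unit adjmx_unit.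
by rewrite mxrankMfree ?row_free_unit // (eqmxMfull _ fP).
Qed.

Lemma res_fprod n (bs : seq 'M[C]_n.+1) j :
  res j (fprod bs) = fprod [seq row' j (col' j h) | h <- bs].
Proof.
rewrite /fprod res_prod big_map; apply: eq_bigr => h _; exact: res_hform.
Qed.

Definition eps (p q : nat) : C :=
  exprz (@iC R) (q%:Z - p%:Z) * (-1) ^+ ((p + q) * (p + q).+1 %/ 2).

(** Hard Lefschetz as injectivity. The list starts with b_1, so the required ranks run from p + q +
    1 to n. *)
Definition hl n := forall p q (bs : seq 'M[C]_n) (Phi : extalg R n),
  (p + q + size bs = n)%N -> good (p + q).+1 bs -> pq p q Phi ->
  fprod bs * Phi = 0 -> Phi = 0.

Definition hrr n p q (b0 : 'M[C]_n) bs := forall Phi : extalg R n,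
  pq p q Phi -> fprod (b0 :: bs) * Phi = 0 -> Phi != 0 ->
  0 < eps p q * vc (fprod bs * Phi * cj Phi).

Definition hrr_dim n := forall p q (b0 : 'M[C]_n) bs,
  (p + q + size bs = n)%N -> good (p + q) (b0 :: bs) -> hrr p q b0 bs.

Lemma hl_diag n p q (J : {set 'I_n.+1}) (bs : seq 'M[C]_n.+1) (Phi : extalg R n.+1) :
  hrr_dim n -> (p + q + size bs = n)%N -> (p + q < #|J|)%N ->
  psdmx (pidset C J) -> good (p + q).+2 bs -> pq p q Phi ->
  fprod (pidset C J :: bs) * Phi = 0 -> Phi = 0.
Proof.
move=> hn sz ltJ pJ gb hPhi Phi0; set X := fprod bs * Phi * cj Phi.
have rPhi j : res j Phi != 0 -> 0 < eps p q * vc (res j X).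
  move=> nz; rewrite /X !resM res_fprod res_cj.
  have [prJ rrJ] := psd_rank_submx j pJ.
  (* On the hyperplane the restricted b_1 takes the place of b_0; its rank is at least p + q because
     [J] has more than p + q elements. *)
  apply: (hn p q (row' j (col' j (pidset C J)))) => //.
  - by rewrite size_map.
  - split=> //; last exact: good_res.
    by rewrite -ltnS (leq_trans _ rrJ) // rank_pidset.
  - exact: pq_res.
  - by rewrite -(res_fprod (pidset C J :: bs)) -resM Phi0 res0.
have Q0 j : 0 <= eps p q * vc (res j X).
  have [r0|/(rPhi j)/ltW //] := eqVneq (res j Phi) 0.
  by rewrite /X !resM r0 mulr0 mul0r vc0 mulr0.
have : \sum_(j in J) eps p q * vc (res j X) = 0.
  transitivity (eps p q * vc (fprod (pidset C J :: bs) * Phi * cj Phi)); last first.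
    by rewrite Phi0 mul0r vc0 mulr0.
  have -> : fprod (pidset C J :: bs) * Phi * cj Phi = \sum_(j in J) theta R j * X.
    rewrite fprod_cons hform_pidset !mulr_suml; apply: eq_bigr => j _.
    by rewrite /X !mulrA.
  by rewrite vc_sum mulr_sumr; apply: eq_bigr => j _; rewrite vc_thetaM.
move/eqP; rewrite psumr_eq0 // => /allP sum0.
have {}rPhi j : j \in J -> res j Phi = 0.
  move=> jJ; apply/eqP/negPn/negP => /(rPhi j).
  have := sum0 j (mem_index_enum _); rewrite jJ => /eqP ->.
  by rewrite ltxx.
apply: ext_eqP => I; rewrite cf0; apply/eqP/negPn/negP => nzI.
have [hI aI] := pqP _ _ _ hPhi I nzI.
(* A monomial of bidegree (p,q) involves at most p + q coordinates, so some j in [J] is absent from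
   it, and its coefficient is one of [res j Phi]. *)
have /subsetPn [j jJ] : ~~ (J \subset holo I :|: antiholo I).
  apply/negP => /subset_leq_card; rewrite leqNgt => /negP; apply.
  by rewrite (leq_ltn_trans _ ltJ) // cardsU hI aI leq_subr.
rewrite !inE negb_or => /andP[jl jr].
have eI : I = (lidx j @: [set x | lidx j x \in I]).
  apply/setP => y; apply/idP/imsetP => [yI|[x]]; last by rewrite inE => xI ->.
  case: (lidxP j y) => [ey|ey|[x ey]]; rewrite ey in yI *.
  - by rewrite yI in jl.
  - by rewrite yI in jr.
  - by exists x; rewrite ?inE.
by move: nzI; rewrite eI -cf_res rPhi // cf0 eqxx.
Qed.

Lemma hl_step n : hrr_dim n -> hl n.+1.
Proof.
move=> hn p q [|b1 bs] Phi sz; first by rewrite fprod_nil mul1r.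
case=> pb rb gb hPhi Phi0.
have [g [J [ug cJ eb1]]] := psd_normal_form pb.
pose P := invmx g; have uP : P \in unitmx by rewrite unitmx_inv.
(* By [gl_hform] a change of coordinates acts by its transpose on the left and its conjugate on the
   right, so the conjugate of [P] produces the congruence by [P]. *)
pose g1 := map_mx Num.conj P.
have g1K : map_mx Num.conj g1 = P by apply/matrixP => i j; rewrite !mxE conjCK.
have g1T : g1^T = P^t* by rewrite map_trmx.
have gl_fprod l : gl g1 (fprod l) = fprod [seq P^t* *m h *m P | h <- l].
  rewrite /fprod gl_prod big_map; apply: eq_bigr => h _.
  by rewrite gl_hform g1K g1T.
have eJ : P^t* *m b1 *m P = pidset C J.
  rewrite eb1 !mulmxA -adjmxM -!mulmxA mulmxV // mulmx1.
  by rewrite trmx1 map_mx1 mul1mx.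
have : gl g1 Phi = 0.
  apply: (hl_diag (p := p) (q := q) (J := J)
    (bs := [seq P^t* *m h *m P | h <- bs])) => //.
  - by rewrite size_map; move: sz => /=; lia.
  - by rewrite cJ.
  - by rewrite -eJ; apply: psdmx_conj.
  - exact: good_conj.
  - exact: pq_gl.
  - by rewrite -eJ -(gl_fprod (b1 :: bs)) -glM Phi0 gl0.
have ug1 : g1 \in unitmx by rewrite map_unitmx.
by move=> /(congr1 (gl (invmx g1))); rewrite gl0 glK // mulmxV.
Qed.

End HardLefschetz.

(** * Hodge-Riemann at the base point *)

Section BaseCase.
Variables (R : realType) (n : nat).
Local Notation C := R[i].
Local Notation iC := (@iC R).
Local Notation eps := (@eps R).
Local Notation j := (@ord0 n).
Local Notation gen := (@gen R _).
Local Notation inc := (@inc R n j).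
Local Notation assemble := (@assemble R n j).
Local Notation dz := (gen (inl j)).
Local Notation dzb := (gen (inr j)).
Local Notation th := (theta R j).
Local Notation sg := (hform (1%:M : 'M[C]_n)).

(** In [mul_assemble] the component [u] of a form of bidegree (p+1,q) pairs with its conjugate with
    the factor (-1)^(p+q) (-i). So [u] contributes with its own Hodge-Riemann sign; the next two
    lemmas do the same for [v] and [b]. *)
Lemma eps_pred_l p q : eps p.+1 q * ((-1) ^+ (p + q) * - iC) = eps p q.
Proof.
rewrite /eps addSn; set s := (p + q)%N.
have -> : (s.+1 * s.+2 %/ 2 = s.+1 + s * s.+1 %/ 2)%N.
  have -> : (s.+1 * s.+2 = s.+1 * 2 + s * s.+1)%N by lia.
  by rewrite divnMDl.
have -> : q%:Z - p.+1%:Z = (q%:Z - p%:Z) - 1 by rewrite intS; ring.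
rewrite expfzDr ?iC_neq0 // exprN1 exprD exprS.
have -> : iC^-1 = - iC.
  by apply: (mulfI (iC_neq0 R)); rewrite mulfV ?iC_neq0 // mulrN iC_sq opprK.
set e := (-1) ^+ s; have ee : e * e = 1 by rewrite /e -expr2 sqrr_sign.
set f := (-1) ^+ _; set g := exprz _ _.
transitivity (g * f * (e * e) * (- (iC * iC))); first by ring.
by rewrite ee iC_sq opprK !mulr1.
Qed.

Lemma eps_pred_r p q : eps p q.+1 * ((-1) ^+ (p + q) * iC) = eps p q.
Proof.
rewrite /eps addnS; set s := (p + q)%N.
have -> : (s.+1 * s.+2 %/ 2 = s.+1 + s * s.+1 %/ 2)%N.
  have -> : (s.+1 * s.+2 = s.+1 * 2 + s * s.+1)%N by lia.
  by rewrite divnMDl.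
have -> : q.+1%:Z - p%:Z = (q%:Z - p%:Z) + 1 by rewrite intS; ring.
rewrite expfzDr ?iC_neq0 // expr1z exprD exprS.
set e := (-1) ^+ s; have ee : e * e = 1 by rewrite /e -expr2 sqrr_sign.
set f := (-1) ^+ _; set g := exprz _ _.
transitivity (g * f * (e * e) * (- (iC * iC))); first by ring.
by rewrite ee iC_sq opprK !mulr1.
Qed.

Lemma eps_pred_lr p q : - eps p.+1 q.+1 = eps p q.
Proof.
rewrite -(eps_pred_l p q) -(eps_pred_r p.+1 q) -mulrA; set x := eps _ _.
rewrite -[LHS]mulrN1; congr (x * _).
rewrite addSn exprS; set e := (-1) ^+ _.
have ee : e * e = 1 by rewrite /e -expr2 sqrr_sign.
transitivity ((e * e) * (iC * iC)); first by rewrite ee iC_sq mul1r.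
by ring.
Qed.

(** The degree of [a] is p + q - dp - dq; adding [dp] and [dq] instead keeps the parity and avoids
    truncated subtraction. *)
Lemma pqs_genC dp dq p q (a : extalg R n) x : pqs dp dq p q a ->
  inc a * gen x = (-1) ^+ (p + q + dp + dq) *: (gen x * inc a).
Proof.
case=> [->|[p' [q' [-> -> ha]]]]; first by rewrite inc0 mulr0 mul0r scaler0.
have e : (-1) ^+ (p' + dp + (q' + dq) + dp + dq) = (-1) ^+ (p' + q') :> C.
  rewrite (_ : (_ + dq)%N = (p' + q' + (dp + dq) * 2)%N); last by lia.
  by rewrite exprD exprM sqrr_sign mulr1.
rewrite e (pq_genC x (pq_inc j ha)) scalerA -expr2 sqrr_sign scale1r.
by [].
Qed.

Lemma cj_assemble a u v b :
  cj (assemble a u v b) = assemble (cj a) (cj v) (cj u) (cj b).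
Proof.
rewrite /assemble !cjD !cjM !cj_gen /= cj_theta !inc_cj.
by rewrite [_ + dzb * _ + _]addrAC.
Qed.

(** The seven products repeating dz or dzbar vanish. The signs come from moving dz or dzbar to the
    left, past [a] with sign [e] and past [u] or [v], whose degree is one less, with sign [- e]. *)
Lemma mul_assemble p q a u v b a' u' v' b' :
  pqs 0 0 p q a -> pqs 1 0 p q u -> pqs 0 1 p q v ->
  let e : C := (-1) ^+ (p + q) in
  assemble a u v b * assemble a' u' v' b' =
  assemble (a * a') (e *: (a * u') + u * a') (e *: (a * v') + v * a')
    (a * b' + b * a' + (e * iC) *: (u * v') - (e * iC) *: (v * u')).
Proof.
move=> ha hu hv e.
have aC x : inc a * gen x = e *: (gen x * inc a).
  by rewrite (pqs_genC _ ha) !addn0.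
have uC x : inc u * gen x = - e *: (gen x * inc u).
  by rewrite (pqs_genC _ hu) addn0 addn1 exprS mulN1r.
have vC x : inc v * gen x = - e *: (gen x * inc v).
  by rewrite (pqs_genC _ hv) addn0 addn1 exprS mulN1r.
rewrite {1 2}/assemble !mulrDl !mulrDr.
have z1 : dz * inc u * (dz * inc u') = 0.
  by rewrite mulrA -[dz * inc u * dz]mulrA uC -scalerAr mulrA gen_sq mul0r scaler0 mul0r.
have z2 : dz * inc u * (th * inc b') = 0.
  by rewrite mulrA theta_central mulrA -theta_central dz_th !mul0r.
have z3 : dzb * inc v * (dzb * inc v') = 0.
  by rewrite mulrA -[dzb * inc v * dzb]mulrA vC -scalerAr mulrA gen_sq mul0r scaler0 mul0r.
have z4 : dzb * inc v * (th * inc b') = 0.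
  by rewrite mulrA theta_central mulrA -theta_central dzb_th !mul0r.
have z5 : th * inc b * (dz * inc u') = 0.
  by rewrite -theta_central -mulrA [th * _]mulrA -theta_central dz_th mul0r mulr0.
have z6 : th * inc b * (dzb * inc v') = 0.
  by rewrite -theta_central -mulrA [th * _]mulrA -theta_central dzb_th mul0r mulr0.
have z7 : th * inc b * (th * inc b') = 0.
  by rewrite -theta_central -mulrA [th * _]mulrA theta_sq mul0r mulr0.
have t1 : inc a * (dz * inc u') = dz * inc (e *: (a * u')).
  by rewrite mulrA aC -scalerAl incZ incM -scalerAr mulrA.
have t2 : inc a * (dzb * inc v') = dzb * inc (e *: (a * v')).
  by rewrite mulrA aC -scalerAl incZ incM -scalerAr mulrA.
have t3 : inc a * (th * inc b') = th * inc (a * b').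
  by rewrite mulrA theta_central -mulrA incM.
have t4 : dz * inc u * (dzb * inc v') = th * inc ((e * iC) *: (u * v')).
  rewrite mulrA -[dz * inc u * dzb]mulrA uC -scalerAr mulrA dz_dzb incZ incM.
  move: (theta R j) => T.
  by rewrite -!scalerAl scalerA -scalerAr mulrNN [in RHS]mulrA.
have t5 : dzb * inc v * (dz * inc u') = th * inc (- ((e * iC) *: (v * u'))).
  rewrite mulrA -[dzb * inc v * dz]mulrA vC -scalerAr mulrA dzb_dz incN incZ incM.
  move: (theta R j) => T.
  by rewrite -!scalerAl scalerA mulrN -scalerAr mulNr scaleNr [in RHS]mulrA.
have t6 : dz * inc u * inc a' = dz * inc (u * a') by rewrite -mulrA -incM.
have t7 : dzb * inc v * inc a' = dzb * inc (v * a') by rewrite -mulrA -incM.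
have t8 : th * inc b * inc a' = th * inc (b * a') by rewrite -mulrA -incM.
rewrite z1 z2 z3 z4 z5 z6 z7 t1 t2 t3 t4 t5 t6 t7 t8 /assemble !addr0 !incD !mulrDr.
(* Sorts the nine surviving terms into the four components. *)
rewrite -incM; exact: (AC (4*2*2*1) (1*(2*5)*(3*7)*(4*9*6*8))).
Qed.

Lemma inc_assemble x a u v b : (forall y, y * inc x = inc x * y) ->
  inc x * assemble a u v b = assemble (x * a) (x * u) (x * v) (x * b).
Proof.
move=> xC; rewrite /assemble !mulrDr !incM; congr (_ + _ + _ + _);
  by rewrite !mulrA xC.
Qed.

Lemma theta_assemble a u v b : th * assemble a u v b = assemble 0 0 0 a.
Proof.
rewrite /assemble !mulrDr !mulrA -!(theta_central _ (gen _)) dz_th dzb_th theta_sq.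
by rewrite !mul0r inc0 !mulr0 !addr0 !add0r.
Qed.

Lemma assembleD a u v b a' u' v' b' :
  assemble a u v b + assemble a' u' v' b' =
  assemble (a + a') (u + u') (v + v') (b + b').
Proof.
rewrite /assemble !incD !mulrDr.
exact: (AC (4*4) ((1*5)*(2*6)*(3*7)*(4*8))).
Qed.

Lemma pidsetT m : pidset C [set: 'I_m] = 1%:M.
Proof. by apply/matrixP => k l; rewrite !mxE inE andbT. Qed.

Lemma hform1_split : hform (1%:M : 'M[C]_n.+1) = hform (pidset C [set~ j]) + th.
Proof.
rewrite -pidsetT !hform_pidset (bigD1 j) ?inE //= addrC; congr (_ + _).
by apply: eq_bigl => i; rewrite !inE.
Qed.

Lemma inc_sg : inc sg = hform (pidset C [set~ j]).
Proof.
apply: (addIr th); rewrite -hform1_split -!pidsetT !hform_pidset.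
rewrite [RHS](bigD1_ord j) ?inE //= addrC; congr (_ + _).
rewrite /inc (linear_sum (hom _)) /=.
apply: eq_big => [i|i _]; first by rewrite !inE.
exact: inc_theta.
Qed.

Lemma sgX_central k (y : extalg R n.+1) : y * inc (sg ^+ k) = inc (sg ^+ k) * y.
Proof.
rewrite incX; elim: k => [|k IH]; first by rewrite mulr1 mul1r.
by rewrite exprS mulrA inc_sg hform_central -inc_sg -mulrA IH mulrA.
Qed.

Lemma sgXC k (y : extalg R n) : y * sg ^+ k = sg ^+ k * y.
Proof.
elim: k => [|k IH]; first by rewrite mulr1 mul1r.
by rewrite exprS mulrA hform_central -mulrA IH mulrA.
Qed.

Lemma psdmx_pidset m (J : {set 'I_m}) : psdmx (pidset C J).
Proof.
split=> [|x].
  apply/matrixP => k l; rewrite !mxE rmorph_nat eq_sym.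
  by case: eqP => // ->.
have -> : qf (pidset C J) x = \sum_(i in J) `|x 0 i| ^+ 2.
  rewrite /qf pidset_diag mul_mx_diag mxE [RHS]big_mkcond; apply: eq_bigr => i _.
  rewrite !mxE; case: (i \in J); last by rewrite mulr0 mul0r.
  by rewrite mulr1 normCK.
by rewrite sumr_ge0 // => i _; rewrite exprn_ge0.
Qed.

Lemma psdmx1 m : psdmx (1%:M : 'M[C]_m).
Proof. by rewrite -pidsetT; apply: psdmx_pidset. Qed.

Lemma good_nseq1 r k : (r + k <= n.+1)%N -> good r (nseq k (1%:M : 'M[C]_n)).
Proof.
elim: k r => [//|k IH] r hr; split; first exact: psdmx1.
  by rewrite mxrank1; lia.
by apply: IH; lia.
Qed.

Lemma fprod_nseq k : fprod (nseq k (1%:M : 'M[C]_n)) = sg ^+ k.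
Proof. by elim: k => [|k IH]; rewrite ?fprod_nil // fprod_cons IH exprS. Qed.

(** The form of full rank stands last, the only position where rank [n.+1] is required under the
    bound of [good_base]. *)
Definition base_seq N : seq 'M[C]_n.+1 :=
  rcons (nseq N (pidset C [set~ j])) 1%:M.

Lemma fprod_base N :
  fprod (base_seq N) = inc (sg ^+ N) * (inc sg + th).
Proof.
elim: N => [|N IH].
  by rewrite /base_seq fprod_cons fprod_nil mulr1 expr0 inc1 mul1r hform1_split inc_sg.
by rewrite -[base_seq _]/(_ :: base_seq N) fprod_cons IH exprS incM inc_sg mulrA.
Qed.

Lemma good_base r N : (r + N <= n.+1)%N -> good r (base_seq N).
Proof.
elim: N r => [|N IH] r hr.
  split; [exact: psdmx1 | by rewrite mxrank1; lia | by []].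
split; first exact: psdmx_pidset.
  by rewrite rank_pidset cardsC1 card_ord /=; lia.
by apply: IH; lia.
Qed.

Hypothesis hn : hrr_dim R n.

(** The induction hypothesis for one component of a split form, as nonnegativity together with
    definiteness. It covers a component that is zero because p < dp or q < dq; [c] is the constant
    that the component inherits from the whole form. *)
Lemma hrr_sg dp dq p q k (c : C) (u : extalg R n) :
  pqs dp dq p q u -> (p + q + k = n + dp + dq)%N -> sg ^+ k.+1 * u = 0 ->
  (forall p' q', p = (p' + dp)%N -> q = (q' + dq)%N -> c = eps p' q') ->
  0 <= c * vc (sg ^+ k * u * cj u) /\ (c * vc (sg ^+ k * u * cj u) = 0 -> u = 0).
Proof.
case=> [->|[p' [q' [ep eq hu]]]] sz u0 ce.
  by rewrite mulr0 mul0r vc0 mulr0.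
have [->|nu] := eqVneq u 0; first by rewrite mulr0 mul0r vc0 mulr0.
have := @hn p' q' 1%:M (nseq k 1%:M) _ _ u hu.
rewrite -(ce p' q') // fprod_nseq; set x := c * _ => h.
have x0 : 0 < x.
  apply: h => //.
  - by rewrite size_nseq; lia.
  - by apply: (good_nseq1 (k := k.+1)); lia.
  - by rewrite (fprod_nseq k.+1).
by split; [exact: ltW | move=> e; move: x0; rewrite e ltxx].
Qed.

Lemma hrr_base0 p q : (p + q = n.+1)%N -> hrr p q (1%:M : 'M[C]_n.+1) [::].
Proof.
move=> sz Phi hPhi; have [a [u [v [b [-> ha hu hv hb]]]]] := splitting j hPhi.
rewrite -[_ :: _]/(base_seq 0) fprod_base expr0 inc1 mul1r mulrDl -[sg]expr1.
rewrite inc_assemble; last exact: sgX_central.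
rewrite theta_assemble assembleD !addr0 => /assemble_eq0 [a0 u0 v0 ab0] nz.
(* With the full form alone, primitivity makes a + s b vanish outright. The mixed terms in [a] and
   [b] then give -2 s b bbar, and only [u], [v], [b] remain. *)
have ea : a = - (sg ^+ 1 * b) by apply/eqP; rewrite -addr_eq0 addrC ab0.
rewrite fprod_nil mul1r cj_assemble (mul_assemble _ _ _ _ _ ha hu hv) vc_assemble.
have sgr : cj (sg ^+ 1) = sg ^+ 1.
  by rewrite expr1 cj_hform // => k l; rewrite !mxE eq_sym rmorph_nat.
have -> : a * cj b + b * cj a = (- 2) *: (sg ^+ 1 * b * cj b).
  rewrite ea cjN cjM sgr mulNr mulrN mulrA [b * _]sgXC -!mulrA.
  by rewrite -opprD -mulr2n -scaler_nat scaleNr.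
rewrite !vcD vcN !vcZ; set e := (-1) ^+ _; set E := eps p q.
have [Qu Zu] : 0 <= E * (e * iC) * vc (sg ^+ 0 * u * cj u) /\
    (E * (e * iC) * vc (sg ^+ 0 * u * cj u) = 0 -> u = 0).
  apply: (hrr_sg hu) => // [|p' q' ep eq]; first by lia.
  rewrite /E /e ep eq addn1 addn0 addSn exprS -(eps_pred_l p' q') mulN1r.
  by congr (_ * _); rewrite mulNr mulrN.
have [Qv Zv] : 0 <= E * (- (e * iC)) * vc (sg ^+ 0 * v * cj v) /\
    (E * (- (e * iC)) * vc (sg ^+ 0 * v * cj v) = 0 -> v = 0).
  apply: (hrr_sg hv) => // [|p' q' ep eq]; first by lia.
  rewrite /E /e ep eq addn1 addn0 addnS exprS -(eps_pred_r p' q') mulN1r.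
  by rewrite !mulNr opprK.
have [Qb Zb] : 0 <= - E * vc (sg ^+ 1 * b * cj b) /\
    (- E * vc (sg ^+ 1 * b * cj b) = 0 -> b = 0).
  apply: (hrr_sg hb) => [||p' q' ep eq]; first by lia.
    have := congr1 (fun x => sg ^+ 1 * x) ab0.
    by rewrite /= mulrDr a0 addr0 mulr0 mulrA -exprD.
  by rewrite /E ep eq !addn1 eps_pred_lr.
move: Qu Qv Qb Zu Zv Zb; rewrite !expr0 !mul1r.
set U := vc (u * cj u); set V := vc (v * cj v); set W := vc _.
move=> Qu Qv Qb Zu Zv Zb.
have -> : E * (-2 * W + e * iC * U - e * iC * V) =
  E * (e * iC) * U + E * (- (e * iC)) * V + 2 * (- E * W) by ring.
have Qb2 : 0 <= 2 * (- E * W) by apply: mulr_ge0.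
rewrite lt_def (addr_ge0 (addr_ge0 Qu Qv) Qb2) andbT.
apply: contra nz; rewrite (paddr_eq0 (addr_ge0 Qu Qv) Qb2) (paddr_eq0 Qu Qv).
move=> /andP[/andP[/eqP /Zu eu /eqP /Zv ev]].
rewrite mulf_eq0 pnatr_eq0 /= => /eqP /Zb eb; apply/eqP.
have -> : a = 0 by rewrite ea eb mulr0 oppr0.
by rewrite eu ev eb /assemble inc0 !mulr0 !addr0.
Qed.

(** Completing the square, with S = s^M, y = c, x = b and primes for conjugates. The ring is
    noncommutative and only [s] is moved, hence the proof by hand. *)
Let base_identity (A : pzRingType) (S s x y x' y' : A) :
  (forall z, z * s = s * z) ->
  S * s * ((y - s * x) * x' + x * (y' - s * x')) + S * ((y - s * x) * (y' - s * x'))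
  = S * (y * y') - S * s * s * (x * x').
Proof.
move=> sC; rewrite !(mulrBl, mulrBr, mulrDr, mulrDl, mulrA).
have e1 : S * s * x * s = S * s * s * x by rewrite -!mulrA sC.
have e2 : S * y * s = S * s * y by rewrite -!mulrA sC.
rewrite e1 e2.
move: (S * s * y * x') (S * s * s * x * x') (S * s * x * y') (S * y * y') => X Z Y W.
rewrite !opprB (AC (2*2*(2*2)) (5*2*(1*8)*(3*6)*(7*4))).
by rewrite /= !subrr !addr0.
Qed.

(** The components c, u, v, b are primitive on C^n for powers of s, in bidegrees (p,q), (p-1,q),
    (p,q-1), (p-1,q-1). The value at Phi is the sum of their four Hodge-Riemann values; the minus
    sign before the term in b is absorbed by [eps_pred_lr]. *)
Lemma hrr_baseS p q M : (p + q + M = n)%N ->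
  hrr p q (pidset C [set~ j]) (base_seq M).
Proof.
move=> sz Phi hPhi; have [a [u [v [b [-> ha hu hv hb]]]]] := splitting j hPhi.
rewrite -[_ :: _]/(base_seq M.+1) !fprod_base.
have spl K : inc (sg ^+ K) * (inc sg + th) = inc (sg ^+ K.+1) + inc (sg ^+ K) * th.
  by rewrite mulrDr -incM -exprSr.
rewrite !spl mulrDl -[inc _ * th * _]mulrA theta_assemble.
rewrite !inc_assemble; try exact: sgX_central.
rewrite !mulr0 assembleD !addr0 => /assemble_eq0 [a0 u0 v0 ab0] nz.
pose c := a + sg * b.
have sgr K : cj (sg ^+ K) = sg ^+ K.
  elim: K => [|K IH]; first by rewrite cj1.
  by rewrite exprS cjM IH cj_hform // => k l; rewrite !mxE eq_sym rmorph_nat.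
have sg1 : cj sg = sg by rewrite -[sg]expr1 sgr.
have sgC y : y * sg = sg * y by rewrite -[sg]expr1 sgXC.
have ea : a = c - sg * b by rewrite addrK.
have c0 : sg ^+ M.+1 * c = 0.
  by rewrite /c mulrDr mulrA -exprSr addrC ab0.
(* The last component of primitivity, s^(M+2) b = - s^(M+1) a, is multiplied by s and combined with
   s^(M+2) a = 0. *)
have b0 : sg ^+ M.+3 * b = 0.
  have eb : sg ^+ M.+2 * b = - (sg ^+ M.+1 * a).
    by apply/eqP; rewrite -addr_eq0 ab0.
  by rewrite exprS -mulrA eb mulrN mulrA -exprS a0 oppr0.
have hc : pqs 0 0 p q c.
  apply: pqsD => //; case: hb => [->|[p' [q' [-> -> hb]]]].
    by rewrite mulr0; left.
  right; exists p'.+1, q'.+1; split; try lia.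
  exact: (pqM (pq_hform _) hb).
rewrite cj_assemble -mulrA (mul_assemble _ _ _ _ _ ha hu hv) mulrDl.
rewrite -[inc _ * th * _]mulrA theta_assemble !inc_assemble; try exact: sgX_central.
rewrite vcD !vc_assemble.
set e := (-1) ^+ _; set E := eps p q.
have key : sg ^+ M.+1 * (a * cj b + b * cj a) + sg ^+ M * (a * cj a) =
  sg ^+ M * c * cj c - sg ^+ M.+2 * b * cj b.
  rewrite ea cjD cjN cjM sg1 !exprSr base_identity //.
  by rewrite !mulrA.
set x := e * iC.
have -> : vc (sg ^+ M.+1 * (a * cj b + b * cj a + x *: (u * cj u) - x *: (v * cj v)))
    + vc (sg ^+ M * (a * cj a)) =
  vc (sg ^+ M * c * cj c) - vc (sg ^+ M.+2 * b * cj b)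
    + x * vc (sg ^+ M.+1 * u * cj u) - x * vc (sg ^+ M.+1 * v * cj v).
  have -> : vc (sg ^+ M * c * cj c) - vc (sg ^+ M.+2 * b * cj b) =
      vc (sg ^+ M.+1 * (a * cj b + b * cj a)) + vc (sg ^+ M * (a * cj a)).
    by rewrite -vcN -vcD -key vcD.
  rewrite -[_ * u * _]mulrA -[_ * v * _]mulrA.
  rewrite mulrBr [sg ^+ M.+1 * (_ + _ *: _)]mulrDr -!scalerAr !vcD vcN !vcZ.
  exact: (AC (3*1) (1*4*2*3)).
have [Qu Zu] : 0 <= E * x * vc (sg ^+ M.+1 * u * cj u) /\
    (E * x * vc (sg ^+ M.+1 * u * cj u) = 0 -> u = 0).
  apply: (hrr_sg hu) => // [|p' q' ep eq]; first by lia.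
  rewrite /E /x /e ep eq addn1 addn0 addSn exprS -(eps_pred_l p' q') mulN1r.
  by congr (_ * _); rewrite mulNr mulrN.
have [Qv Zv] : 0 <= E * (- x) * vc (sg ^+ M.+1 * v * cj v) /\
    (E * (- x) * vc (sg ^+ M.+1 * v * cj v) = 0 -> v = 0).
  apply: (hrr_sg hv) => // [|p' q' ep eq]; first by lia.
  rewrite /E /x /e ep eq addn1 addn0 addnS exprS -(eps_pred_r p' q') mulN1r.
  by rewrite !mulNr opprK.
have [Qc Zc] : 0 <= E * vc (sg ^+ M * c * cj c) /\
    (E * vc (sg ^+ M * c * cj c) = 0 -> c = 0).
  apply: (hrr_sg hc) => // [|p' q' ep eq]; first by lia.
  by rewrite /E ep eq !addn0.
have [Qb Zb] : 0 <= - E * vc (sg ^+ M.+2 * b * cj b) /\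
    (- E * vc (sg ^+ M.+2 * b * cj b) = 0 -> b = 0).
  apply: (hrr_sg hb) => // [|p' q' ep eq]; first by lia.
  by rewrite /E ep eq !addn1 eps_pred_lr.
move: Qu Qv Qc Qb Zu Zv Zc Zb.
set U := vc _; set V := vc _; set W := vc _; set B := vc _.
move=> Qu Qv Qc Qb Zu Zv Zc Zb.
have -> : E * (W - B + x * U - x * V) =
  E * x * U + E * (- x) * V + E * W + - E * B by ring.
have Quv := addr_ge0 Qu Qv; have Quvc := addr_ge0 Quv Qc.
rewrite lt_def (addr_ge0 Quvc Qb) andbT; apply: contra nz.
rewrite (paddr_eq0 Quvc Qb) (paddr_eq0 Quv Qc) (paddr_eq0 Qu Qv).
move=> /andP[/andP[/andP[/eqP /Zu eu /eqP /Zv ev] /eqP /Zc ec] /eqP /Zb eb].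
have -> : a = 0 by rewrite ea eb ec mulr0 subr0.
by rewrite eu ev eb /assemble inc0 !mulr0 !addr0.
Qed.

End BaseCase.

(** * Transport of Hodge-Riemann along a linear path of forms *)

Section GramPath.
Variables (R : realType) (n : nat).
Local Notation C := R[i].
Local Notation extalg := (extalg R n).
Local Notation "M ^t*" := (map_mx Num.conj (M^T)) (at level 30).
Local Notation "x %:C" := (real_complex _ x) (format "x %:C") : ring_scope.

Definition lipE (F : R -> extalg) := forall I, lip (fun t => cf (F t) I).

Lemma lipE_const a : lipE (fun=> a).
Proof. by move=> I; apply: lip_const. Qed.

Lemma lipED F G : lipE F -> lipE G -> lipE (fun t => F t + G t).
Proof.
by move=> lF lG I; apply: lip_eq (lipD (lF I) (lG I)) _ => t; rewrite cfD.
Qed.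

Lemma lipEZ f F : lip f -> lipE F -> lipE (fun t => f t *: F t).
Proof. by move=> lf lF I; apply: lip_eq (lipM lf (lF I)) _ => t; rewrite cfZ. Qed.

Lemma lipEM F G : lipE F -> lipE G -> lipE (fun t => F t * G t).
Proof.
move=> lF lG K; apply: (@lip_eq _ (fun t => \sum_(I : {set idx n})
  \sum_(J : {set idx n} | (I :|: J == K) && [disjoint I & J])
  shuffle_sign R I J * cf (F t) I * cf (G t) J)); last by move=> t; rewrite cfM.
apply: lip_sum => I _; apply: lip_sum => J _; apply: lipM => //.
by apply: lipM => //; apply: lip_const.
Qed.

Lemma lip_vc F : lipE F -> lip (fun t => vc (F t)).
Proof. by move=> lF; apply: lipM => //; apply: lip_const. Qed.

Definition mix (t : R) (c b : 'M[C]_n) := (1 - t)%:C *: c + t%:C *: b.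
Definition mixs t (cs bs : seq 'M[C]_n) := [seq mix t x.1 x.2 | x <- zip cs bs].

Lemma lipE_hform_mix c b : lipE (fun t => hform (mix t c b)).
Proof.
have e t : (1 - t%:C) *: hform c + t%:C *: hform b = hform (mix t c b).
  by rewrite /mix hformD !hformZ rmorphB.
move=> I; apply: (@lip_eq _ (fun t => cf ((1 - t%:C) *: hform c + t%:C *: hform b) I)).
  apply: lipED; apply: lipEZ; try exact: lipE_const; last exact: lip_id.
  by apply: lipD; [exact: lip_const | apply/lipN/lip_id].
by move=> t; rewrite e.
Qed.

Lemma lipE_fprod_mixs cs bs : lipE (fun t => fprod (mixs t cs bs)).
Proof.
elim: cs bs => [|c cs IH] [|b bs]; try by move=> I;
  apply: lip_eq (lip_const (cf 1 I)) _ => t; rewrite fprod_nil.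
move=> I; apply: (@lip_eq _ (fun t => cf (hform (mix t c b) * fprod (mixs t cs bs)) I)).
  by apply: lipEM; [apply: lipE_hform_mix | apply: IH].
by move=> t; rewrite -fprod_cons.
Qed.

Lemma mix0 c b : mix 0 c b = c.
Proof. by rewrite /mix subr0 scale1r scale0r addr0. Qed.

Lemma mix1 c b : mix 1 c b = b.
Proof. by rewrite /mix subrr scale1r scale0r add0r. Qed.

Lemma mixs0 cs bs : size cs = size bs -> mixs 0 cs bs = cs.
Proof.
by elim: cs bs => [|c cs IH] [|b bs] //= [/IH e]; rewrite /mixs /= mix0 -/(mixs _ _ _) e.
Qed.

Lemma mixs1 cs bs : size cs = size bs -> mixs 1 cs bs = bs.
Proof.
by elim: cs bs => [|c cs IH] [|b bs] //= [/IH e]; rewrite /mixs /= mix1 -/(mixs _ _ _) e.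
Qed.

Lemma size_mixs t cs bs : size cs = size bs -> size (mixs t cs bs) = size bs.
Proof. by move=> e; rewrite size_map size_zip e minnn. Qed.

(** For t < 1 the rank is at least that of [c], since adding a semipositive form cannot lower it; at
    t = 1 the rank is that of [b]. *)
Lemma mix_psd t r c b : unit_itv t -> psdmx c -> psdmx b ->
  (r <= \rank c)%N -> (r <= \rank b)%N -> psdmx (mix t c b) /\ (r <= \rank (mix t c b))%N.
Proof.
move=> /andP[t0 t1] pc pb rc rb.
have pc' : psdmx ((1 - t)%:C *: c) by apply: psdmxZ => //; rewrite ler0c subr_ge0.
have pb' : psdmx (t%:C *: b) by apply: psdmxZ => //; rewrite ler0c.
split; first exact: psdmxD.
have [t1'|t1'] := eqVneq t 1.
  by rewrite t1' mix1.
apply: leq_trans (psd_rankD pc' pb'); rewrite psd_rankZ //.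
by rewrite -[0]/(0%:C) (inj_eq (@complexI R)) subr_eq0 eq_sym.
Qed.

Lemma good_mixs t r cs bs : unit_itv t -> good r cs -> good r bs ->
  good r (mixs t cs bs).
Proof.
move=> it; elim: cs bs r => [|c cs IH] [|b bs] r //= [pc rc gc] [pb rb gb].
by have [? ?] := mix_psd it pc pb rc rb; split=> //; apply: IH.
Qed.

Section Coordinates.
Variable S : {set {set idx n}}.
Let N := #|S|.

(** Coordinates on the span of the monomials in [S], through which the results on matrices apply to
    forms of fixed bidegree. *)
Definition vec (v : 'rV[C]_N) : extalg := \sum_i v 0 i *: eb R (enum_val i).

Lemma vecZ k v : vec (k *: v) = k *: vec v.
Proof. by rewrite /vec scaler_sumr; apply: eq_bigr => i _; rewrite mxE scalerA. Qed.

Lemma cf_vec v i : cf (vec v) (enum_val i) = v 0 i.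
Proof.
rewrite cf_sum (bigD1 i) //= cfZ cf_eb eqxx mulr1 big1 ?addr0 // => k ne.
by rewrite cfZ cf_eb (inj_eq enum_val_inj) eq_sym (negbTE ne) mulr0.
Qed.

Lemma cf_vec_out v I : I \notin S -> cf (vec v) I = 0.
Proof.
move=> IS; rewrite cf_sum big1 // => i _; rewrite cfZ cf_eb.
case: eqP => [e|_]; last by rewrite mulr0.
by rewrite e enum_valP in IS.
Qed.

Lemma vec_inj v : vec v = 0 -> v = 0.
Proof. by move=> e; apply/rowP => i; rewrite -cf_vec e cf0 mxE. Qed.

Lemma vecK a : (forall I, cf a I != 0 -> I \in S) ->
  vec (\row_i cf a (enum_val i)) = a.
Proof.
move=> ha; apply: ext_eqP => I; have [IS|IS] := boolP (I \in S).
  by rewrite -(enum_rankK_in IS IS) cf_vec mxE.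
rewrite cf_vec_out //; apply/esym/eqP/negPn/negP => /ha.
by rewrite (negbTE IS).
Qed.
End Coordinates.

Variables (p q : nat) (c0 b0 : 'M[C]_n) (cs bs : seq 'M[C]_n).
Hypotheses (hln : hl R n) (sz : (p + q + size bs = n)%N) (szc : size cs = size bs).
Hypotheses (gc : good (p + q) (c0 :: cs)) (gb : good (p + q) (b0 :: bs)).

Let S := [set I : {set idx n} | (#|holo I| == p) && (#|antiholo I| == q)].
(** The monomials of bidegree (p-1,q-1). Writing the conditions with successors makes the set empty
    when p = 0 or q = 0. *)
Let S' := [set I : {set idx n} | (#|holo I|.+1 == p) && (#|antiholo I|.+1 == q)].
Let Om t := fprod (mixs t cs bs).
Let be t := hform (mix t c0 b0).
Let G t : 'M[C]_#|S| := \matrix_(i, k)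
  (eps R p q * vc (Om t * eb R (enum_val i) * cj (eb R (enum_val k)))).
(** Multiplication by b_0 from bidegree (p-1,q-1) to (p,q), in coordinates ([vecB]). *)
Let B t : 'M[C]_(#|S'|, #|S|) := \matrix_(k, i) cf (be t * eb R (enum_val k)) (enum_val i).

Let pq_vec (v : 'rV[C]_#|S|) : pq p q (vec v).
Proof.
apply/pqP => I; have [|IS] := boolP (I \in S); last by rewrite cf_vec_out ?eqxx.
by rewrite inE => /andP[/eqP -> /eqP ->].
Qed.

Let vecSK a : pq p q a -> vec (S := S) (\row_i cf a (enum_val i)) = a.
Proof. by move/pqP => ha; apply: vecK => I /ha [e1 e2]; rewrite inE e1 e2 !eqxx. Qed.

Let pq_vec' (u : 'rV[C]_#|S'|) :
  (exists p' q', [/\ p = p'.+1, q = q'.+1 & pq p' q' (vec u)]) \/ vec u = 0.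
Proof.
have out I : cf (vec u) I != 0 -> #|holo I|.+1 = p /\ #|antiholo I|.+1 = q.
  have [|IS] := boolP (I \in S'); last by rewrite cf_vec_out ?eqxx.
  by rewrite inE => /andP[/eqP -> /eqP ->].
case: (posnP p) => [p0|p0].
  by right; apply: ext_eqP => I; rewrite cf0; apply/eqP/negPn/negP => /out [e _]; lia.
case: (posnP q) => [q0|q0].
  by right; apply: ext_eqP => I; rewrite cf0; apply/eqP/negPn/negP => /out [_ e]; lia.
left; exists p.-1, q.-1; split; rewrite ?prednK //.
by apply/pqP => I /out [<- <-].
Qed.

Let vecB t (u : 'rV[C]_#|S'|) : vec (u *m B t) = be t * vec u.
Proof.
rewrite -[RHS]vecSK; last first.
  case: (pq_vec' u) => [[p' [q' [-> -> hu]]]|->]; last by rewrite mulr0 pq0.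
  exact: (pqM (pq_hform _) hu).
congr (vec _); apply/rowP => i; rewrite !mxE /vec mulr_sumr cf_sum.
by apply: eq_bigr => k _; rewrite mxE -scalerAr cfZ.
Qed.

Let GE t (v w : 'rV[C]_#|S|) :
  (v *m G t *m w^t*) 0 0 = eps R p q * vc (Om t * vec v * cj (vec w)).
Proof.
rewrite mxE /vec cj_sum !mulr_sumr vc_sum mulr_sumr; apply: eq_bigr => k _.
rewrite [(v *m G t) 0 k]mxE !mulr_suml vc_sum mulr_sumr; apply: eq_bigr => i _.
have sc (x y : C) (a b : extalg) :
    Om t * (x *: a) * (y *: b) = (y * x) *: (Om t * a * b).
  by rewrite -scalerAr -scalerAr -scalerAl scalerA.
rewrite [G t i k]mxE [(w^t*) k 0]mxE [w^T _ _]mxE cjZ sc vcZ.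
by set z := vc _; ring.
Qed.

Let gmix t : unit_itv t -> good (p + q) (mix t c0 b0 :: mixs t cs bs).
Proof. by move=> it; apply: (good_mixs (cs := c0 :: cs) (bs := b0 :: bs) it). Qed.

Let cjOm t : unit_itv t -> cj (Om t) = Om t.
Proof. by move/gmix => [_ _ /cj_fprod]. Qed.

Let cjbe t : unit_itv t -> cj (be t) = be t.
Proof.
move/gmix => [[hh _] _ _]; apply: cj_hform => i k.
by rewrite -{1}hh !mxE.
Qed.

Let pqOm t : pq (size bs) (size bs) (Om t).
Proof. by have := pq_fprod (mixs t cs bs); rewrite size_mixs. Qed.

Let vc_eq0 (a : extalg) : vc a = 0 -> cf a setT = 0.
Proof.
move/eqP; rewrite mulf_eq0 invr_eq0 expf_eq0 (negbTE (iC_neq0 R)) andbF orbF.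
by move/eqP.
Qed.

Let eps_neq0 p' q' : eps R p' q' != 0.
Proof. by rewrite mulf_neq0 ?signr_eq0 ?expfz_neq0 ?iC_neq0. Qed.

Let conj_eps p' q' : (eps R p' q')^* = (-1) ^+ (p' + q') * eps R p' q'.
Proof.
rewrite /eps rmorphM /= rmorph_sign mulrA; congr (_ * _).
rewrite fmorphXz /= conj_iC -[- iC R]mulN1r expfzMl; congr (_ * _).
rewrite expfzDr ?oppr_eq0 ?oner_eq0 // -exprnN -exprnP invr_sign -exprD.
by rewrite addnC.
Qed.

(** Conjugating [eps] costs (-1)^(p+q) and exchanging the two forms costs (-1)^((p+q)^2); the total
    exponent (p+q)(p+q+1) is even. *)
Let hermG t : unit_itv t -> hermx (G t).
Proof.
move=> it; apply/matrixP => i k; rewrite !mxE.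
set a := eb R (enum_val k); set b := eb R (enum_val i).
have pqS (l : 'I_#|S|) : pq p q (eb R (enum_val l)).
  have := enum_valP l; rewrite inE => /andP[/eqP e1 /eqP e2].
  by apply: pq_eq (pq_eb _ _) e1 e2.
have ha : pq p q a by apply: pqS.
have hb : pq p q b by apply: pqS.
have top : pq n n (Om t * a * cj b).
  by apply: pq_eq (pqM (pqM (pqOm t) ha) (pq_cj hb)) _ _; lia.
rewrite rmorphM /= -vc_cj // !cjM cjK cjOm // conj_eps.
rewrite -[_ * cj a * b]mulrA (pq_mulC (pq_cj ha) hb) -scalerAr vcZ.
rewrite -[_ * b * cj a]mulrA; set V := vc _; set x := (-1) ^+ (p + q).
set y := (-1) ^+ _; have xy : x * y = 1.
  rewrite /x /y -exprD [(q + p)%N]addnC -mulnS -signr_odd oddM /=.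
  by case: (odd _).
by transitivity ((x * y) * (eps R p q * V)); [ring | rewrite xy mul1r].
Qed.

(** A kernel vector gives a form whose product with [Om t] pairs to zero with the whole
    complementary bidegree. By duality this product vanishes, and hard Lefschetz kills the form. *)
Let unitG t : unit_itv t -> G t \in unitmx.
Proof.
move=> it; rewrite -row_free_unit -kermx_eq0; apply/eqP/row_matrixP => i.
rewrite row0; set v := row i _.
have v0 : v *m G t = 0 by rewrite -row_mul mulmx_ker row0.
apply: vec_inj; have [_ _ gm] := gmix it.
apply: (hln (p := p) (q := q) (bs := mixs t cs bs)) => //.
  by rewrite size_mixs.
apply: (@top_pairing R n (size bs + p) (size bs + q) q p) => [|||b hb]; try lia.
  exact: pqM (pqOm t) (pq_vec v).
apply: vc_eq0; have := GE t v (\row_i cf (cj b) (enum_val i)).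
rewrite vecSK ?cjK; last exact: pq_cj.
rewrite v0 mul0mx mxE => /esym/eqP; rewrite mulf_eq0 (negbTE (eps_neq0 _ _)).
by move/eqP.
Qed.

(** Since b_0 is real and central, it passes from the second argument of the pairing to the first;
    duality then turns orthogonality to the rows of [B] into primitivity. *)
Let prim_iff t (v : 'rV[C]_#|S|) : unit_itv t ->
  v *m G t *m (B t)^t* = 0 <-> be t * Om t * vec v = 0.
Proof.
move=> it.
have adj (u : 'rV[C]_#|S'|) : (v *m G t *m (B t)^t* *m u^t*) 0 0 =
    eps R p q * vc (be t * Om t * vec v * cj (vec u)).
  rewrite -mulmxA -adjmxM GE vecB cjM cjbe //.
  by rewrite mulrA (hform_central (mix t c0 b0) (Om t * vec v)) !mulrA.
split=> h; last first.
  apply/rowP => k.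
  have de l : ((delta_mx 0 k : 'rV[C]_#|S'|)^t*) l 0 = (l == k)%:R.
    by rewrite !mxE eqxx /= rmorph_nat.
  have := adj (delta_mx 0 k); rewrite h mul0r vc0 mulr0 => e.
  rewrite [RHS]mxE -[RHS]e [RHS]mxE [RHS](bigD1 k) //= big1 ?addr0 => [|l ne].
    by rewrite de eqxx mulr1.
  by rewrite de (negbTE ne) mulr0.
have pqv : pq (1 + size bs + p) (1 + size bs + q) (be t * Om t * vec v).
  exact: pqM (pqM (pq_hform _) (pqOm t)) (pq_vec v).
(* When p = 0 or q = 0 there are no test forms, but then the other degree of the product is n + 1
   and the product vanishes. *)
case: (posnP p) => [p0|p0]; first by apply: (pq_above pqv); right; lia.
case: (posnP q) => [q0|q0]; first by apply: (pq_above pqv); left; lia.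
apply: (top_pairing (p' := q.-1) (q' := p.-1) pqv) => [||b hb]; try lia.
apply: vc_eq0; have := adj (\row_i cf (cj b) (enum_val i)).
rewrite vecK ?cjK; last first.
  move=> I; have /pqP hb' := pq_cj hb; move/hb' => [e1 e2].
  by rewrite inE e1 e2 !prednK ?eqxx.
rewrite h mul0mx mxE => /esym/eqP; rewrite mulf_eq0 (negbTE (eps_neq0 _ _)).
by move/eqP.
Qed.

(** A kernel vector gives a (p-1,q-1)-form killed by b_0 b_0 b_1 ... b_N. Hard Lefschetz applies in
    that bidegree: the two copies of b_0 need ranks p + q - 1 and p + q, and the later requirements
    are unchanged. *)
Let unitN t : unit_itv t -> B t *m G t *m (B t)^t* \in unitmx.
Proof.
move=> it; rewrite -row_free_unit -kermx_eq0; apply/eqP/row_matrixP => i.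
rewrite row0; set u := row i _.
have u0 : u *m B t *m G t *m (B t)^t* = 0.
  by rewrite -2!mulmxA [B t *m (_ *m _)]mulmxA -row_mul mulmx_ker row0.
have := (prim_iff (u *m B t) it).1 u0; rewrite vecB => h.
apply: vec_inj; case: (pq_vec' u) => [[p' [q' [ep eq hu]]]|//].
have [pm rm gm] := gmix it.
apply: (hln (p := p') (q := q') (bs := mix t c0 b0 :: mix t c0 b0 :: mixs t cs bs)) => //.
- by rewrite /= size_mixs //; lia.
- have r2 : (p + q = (p' + q').+2)%N by lia.
  by split=> //; [lia | split=> //; [lia | rewrite -r2]].
- rewrite !fprod_cons -h -/(be t) -/(Om t).
  by rewrite -!mulrA; congr (_ * _); rewrite !mulrA hform_central.
Qed.

Let lipG : lipmx G.
Proof.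
move=> i k; apply: (@lip_eq _ (fun t => eps R p q *
    vc (Om t * eb R (enum_val i) * cj (eb R (enum_val k))))) => [|t]; last first.
  by rewrite mxE.
apply: lipM; first exact: lip_const.
apply: lip_vc; do 2![apply: lipEM; last exact: lipE_const].
exact: lipE_fprod_mixs.
Qed.

Let lipB : lipmx B.
Proof.
move=> k i; apply: (@lip_eq _ (fun t => cf (be t * eb R (enum_val k)) (enum_val i)))
  => [|t]; last by rewrite mxE.
apply: lipEM; [exact: lipE_hform_mix | exact: lipE_const].
Qed.

Lemma hrr_path : hrr p q c0 cs -> hrr p q b0 bs.
Proof.
move=> hc Phi hPhi Phi0 nz.
have i0 : unit_itv (0 : R) by rewrite /unit_itv lexx ler01.
have i1 : unit_itv (1 : R) by rewrite /unit_itv lexx ler01.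
have prim0 : prim_pos (G 0) (B 0).
  move=> v /(prim_iff v i0).1; rewrite /Om /be mix0 mixs0 // -fprod_cons => v0 nv.
  rewrite /qf GE /Om mixs0 //; apply: hc => //.
  by apply: contra nv => /eqP /vec_inj ->.
have := prim_pos_path lipG lipB hermG unitG unitN prim0.
move=> /(_ (\row_i cf Phi (enum_val i))); rewrite /qf GE vecSK // /Om mixs1 //; apply.
  by apply/(prim_iff _ i1); rewrite vecSK // /Om /be mix1 mixs1 // -fprod_cons.
by apply: contra nz => /eqP e; rewrite -(vecSK hPhi) e -(scale0r 0) vecZ scale0r.
Qed.

End GramPath.

(** * Induction on the dimension *)

Section HodgeRiemann.
Variable R : realType.
Local Notation C := R[i].
Local Notation "M ^t*" := (map_mx Num.conj (M^T)) (at level 30).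

Lemma hrr_dim0 : hrr_dim R 0.
Proof.
move=> p q b0 bs sz _ Phi hPhi _ nz.
have -> : p = 0%N by lia.
have -> : q = 0%N by lia.
have -> : bs = [::] by apply: size0nil; lia.
have E (I : {set idx 0}) : I = set0 by apply/setP => -[[]|[]].
have ePhi : Phi = cf Phi set0 *: 1.
  apply: ext_eqP => I; rewrite cfZ ext_oneE cf_eb (E I) eqxx.
  by rewrite mulr1.
have c0 : cf Phi set0 != 0.
  by apply: contra nz => /eqP e; rewrite ePhi e scale0r.
rewrite fprod_nil mul1r ePhi cjZ cj1 -scalerAl mul1r !vcZ.
have -> : vc (1 : extalg R 0) = 1.
  by rewrite /vc ext_oneE cf_eb (E setT) eqxx expr0 divr1.
rewrite /eps subrr expr0z mul1r /= expr0 mul1r mulr1.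
by rewrite mul_conjC_gt0.
Qed.

Lemma hrr_all n : hrr_dim R n.
Proof.
elim: n => [|n IH]; first exact: hrr_dim0.
move=> p q b0 bs sz gb.
have gbase := @good_base R n (p + q) (size bs) _.
(* When nothing follows b_0, the base sequence is the full form alone, without a copy of s in front,
   and [hrr_base0] applies. *)
case: bs sz gb gbase => [|b1 bs] sz gb gbase.
  apply: (@hrr_path R n.+1 p q 1%:M b0 [::] [::]) => //.
  - exact: hl_step.
  - by apply: gbase; rewrite sz.
  - by apply: hrr_base0 => //; move: sz; rewrite addn0.
apply: (@hrr_path R n.+1 p q (pidset C [set~ ord0]) b0 (base_seq R n (size bs))) => //.
- exact: hl_step.
- by rewrite size_rcons size_nseq.
- by apply: gbase; rewrite sz.
- by apply: hrr_baseS => //; move: sz => /=; lia.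
Qed.

End HodgeRiemann.

(** * From the concrete definitions to the ring of forms *)

Section Translation.
Variables (R : realType) (n : nat).
Local Notation C := R[i].
Local Notation "M ^t*" := (map_mx Num.conj (M^T)) (at level 30).

Lemma wedge_extE (a b : cform R n) : wedge a b = (a : extalg R n) * b.
Proof. by rewrite -[RHS]/(ext_mul a b) /ext_mul -lock. Qed.

Lemma one_form_extE : one_form R n = (1 : extalg R n).
Proof. by rewrite -[RHS]/(ext_one R n) /ext_one -lock. Qed.

Lemma zero_extE : (0 : cform R n) = (0 : extalg R n).
Proof. by rewrite -[RHS]/(ext_zero R n) /ext_zero -lock. Qed.

Lemma scale_extE (k : C) (a : cform R n) : k *: a = (k *: (a : extalg R n)).
Proof. by rewrite -[RHS]/(ext_scale k a) /ext_scale -lock. Qed.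

Lemma add_extE (a b : cform R n) : a + b = (a : extalg R n) + b.
Proof. by rewrite -[RHS]/(ext_add a b) /ext_add -lock. Qed.

Lemma sum_extE (T : Type) (r : seq T) (P : pred T) (F : T -> cform R n) :
  \sum_(i <- r | P i) F i = \sum_(i <- r | P i) (F i : extalg R n).
Proof.
elim: r => [|i r IH]; first by rewrite !big_nil zero_extE.
by rewrite !big_cons IH; case: ifP => // _; rewrite add_extE.
Qed.

Lemma e1_extE x : e1 R x = gen R x :> extalg R n.
Proof. by apply: ext_eqP => I; rewrite genE cf_eb cfE ffunE. Qed.

Lemma form11_extE h : form11 h = hform h :> extalg R n.
Proof.
rewrite /form11 /hform sum_extE; apply: eq_bigr => j _.
rewrite sum_extE; apply: eq_bigr => k _.
by rewrite scale_extE wedge_extE !e1_extE.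
Qed.

Lemma wpow_extE (a : cform R n) k : wpow a k = (a : extalg R n) ^+ k.
Proof.
elim: k => [|k IH]; first exact: one_form_extE.
by rewrite /wpow iterS -/(wpow a k) IH exprS wedge_extE.
Qed.

Lemma big_wedge_extE (T : Type) (r : seq T) (P : pred T) (F : T -> cform R n) :
  \big[@wedge R n/one_form R n]_(i <- r | P i) F i
  = \prod_(i <- r | P i) (F i : extalg R n).
Proof.
elim: r => [|i r IH]; first by rewrite !big_nil one_form_extE.
by rewrite !big_cons IH; case: ifP => // _; rewrite wedge_extE.
Qed.

Lemma monomial_extE (s : seq (idx n)) :
  monomial R s = \prod_(x <- s) gen R x :> extalg R n.
Proof.
elim: s => [|x s IH]; first by rewrite big_nil -one_form_extE.
by rewrite big_cons -IH -e1_extE -wedge_extE.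
Qed.

Lemma conj_form_extE (a : cform R n) : conj_form a = cj (a : extalg R n).
Proof.
rewrite /conj_form sum_extE /cj /hom; apply: eq_bigr => I _.
rewrite scale_extE cf_conj_coef cfE sort_enum_set monomial_extE.
by rewrite big_map big_filter.
Qed.

Lemma std_vol_extE : std_vol R n = iC R ^+ n *: eb R setT :> extalg R n.
Proof.
rewrite /std_vol big_wedge_extE -prod_theta; apply: eq_bigr => j _.
by rewrite scale_extE wedge_extE !e1_extE.
Qed.

Lemma is_hermitianP (h : 'M[C]_n) : is_hermitian h -> hermx h.
Proof. by move=> hh; apply/matrixP => j k; rewrite !mxE -hh. Qed.

Lemma qf_sum (h : 'M[C]_n) (x : 'rV[C]_n) :
  qf h x = \sum_j \sum_k ((x 0 j)^*)^* * h j k * (x 0 k)^*.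
Proof.
rewrite exchange_big /qf mxE; apply: eq_bigr => k _.
rewrite mxE mulr_suml; apply: eq_bigr => j _.
by rewrite !mxE conjCK.
Qed.

Lemma is_psdP (h : 'M[C]_n) : is_hermitian h -> is_psd h -> psdmx h.
Proof.
move=> hh ph; split=> [|x]; first exact: is_hermitianP.
by rewrite qf_sum; apply: (ph (fun j => (x 0 j)^*)).
Qed.

Lemma is_posdefP (h : 'M[C]_n) : is_posdef h -> posmx h.
Proof.
move=> ph x x0; rewrite qf_sum; apply: (ph (fun j => (x 0 j)^*)).
apply/existsP; apply: contraNT x0; rewrite negb_exists => /forallP x0.
apply/eqP/rowP => j; rewrite mxE; apply/eqP.
by have := x0 j; rewrite negbK conjC_eq0.
Qed.

Lemma posmx_psd (h : 'M[C]_n) : hermx h -> posmx h -> psdmx h.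
Proof.
move=> hh ph; split=> // x; have [->|/ph/ltW //] := eqVneq x 0.
by rewrite qf0.
Qed.

(** The summands commute and have square zero. Splitting one off, the binomial formula leaves only
    T^i and i theta T^(i-1), both zero by induction. *)
Lemma sum_theta_expr (J : {set 'I_n}) k : (#|J| < k)%N ->
  (\sum_(j in J) theta R j) ^+ k = 0.
Proof.
have seq_case (s : seq 'I_n) i : (size s < i)%N -> (\sum_(j <- s) theta R j) ^+ i = 0.
  elim: s i => [|j s IH] [|i] //= hi; first by rewrite big_nil expr0n.
  rewrite big_cons addrC exprDn_comm; last by rewrite /GRing.comm theta_central.
  apply: big1 => -[[|[|l]] hl] _ /=.
  - by rewrite subn0 expr0 mulr1 (IH i.+1) ?mul0rn // ltnW.
  - by rewrite subn1 /= IH ?mul0r ?mul0rn.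
  - have -> : theta R j ^+ l.+2 = 0 by rewrite !exprS mulrA theta_sq mul0r.
    by rewrite mulr0 mul0rn.
by move=> hJ; rewrite -big_enum; apply: seq_case; rewrite -cardE.
Qed.

(** If the rank were below m, then in the coordinates of the normal form [hform h] would be a sum of
    fewer than m of the [theta j], so its m-th power would vanish and could not give a positive
    volume form. *)
Lemma m_positive_rank (h w : 'M[C]_n) m : psdmx h ->
  m_positive m (form11 h) (form11 w) -> (m <= \rank h)%N.
Proof.
move=> ph hm; case: m hm => [//|m] hm; rewrite leqNgt; apply/negP => hr.
have [g [J [ug cJ eh]]] := psd_normal_form ph.
have h0 : (hform h) ^+ m.+1 = 0.
  pose g1 := map_mx Num.conj g.
  have -> : hform h = gl g1 (hform (pidset C J)).
    have e1 : g1^T = g^t* by rewrite map_trmx.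
    have e2 : map_mx Num.conj g1 = g by apply/matrixP => i k; rewrite !mxE conjCK.
    by rewrite [in LHS]eh gl_hform e1 e2.
  rewrite hform_pidset; set T := \sum_(i in J) _.
  have -> : gl g1 T ^+ m.+1 = gl g1 (T ^+ m.+1).
    by elim: (m.+1) => [|k IH]; rewrite ?gl1 // !exprS glM IH.
  by rewrite sum_theta_expr ?gl0 // cJ.
have [c [c0]] := hm m.+1 (ltnSn m).
rewrite wedge_extE !wpow_extE !form11_extE h0 mul0r scale_extE std_vol_extE.
move/(congr1 (fun a : extalg R n => cf a setT)); rewrite cf0 !cfZ cf_eb eqxx mulr1.
move/esym/eqP; rewrite mulf_eq0 expf_eq0 (negbTE (iC_neq0 R)) andbF orbF.
by rewrite gt_eqF.
Qed.

Lemma good_le r k (bs : seq 'M[C]_n) :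
  (forall h, h \in bs -> psdmx h /\ (k <= \rank h)%N) ->
  (r + size bs <= k.+1)%N -> good r bs.
Proof.
elim: bs r => [//|h bs IH] r hb /= hr.
have [ph rh] := hb h (mem_head _ _); split=> //; first by lia.
by apply: IH => [g gbs|]; [apply: hb; rewrite inE gbs orbT | lia].
Qed.

Lemma good_cat r (bs cs : seq 'M[C]_n) :
  good r bs -> good (r + size bs) cs -> good r (bs ++ cs).
Proof.
elim: bs r => [|h bs IH] r /=; first by rewrite addn0.
by move=> [ph rh gb] gcs; split=> //; apply: IH => //; rewrite addSnnS.
Qed.

End Translation.

Theorem theorem3p1 (R : realType) (n p q m : nat)
  (w : 'M[R[i]]_n) (alpha : 'I_(m - p - q).+1 -> 'M[R[i]]_n) (Gamma : cform R n) :
  (p + q <= m)%N -> (m <= n)%N ->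
  is_hermitian w -> is_posdef w ->
  (forall j, is_hermitian (alpha j) /\ is_psd (alpha j) /\
             m_positive m (form11 (alpha j)) (form11 w)) ->
  top_pos Gamma ->
  let Omega : cform R n :=
    wedge (wpow (form11 w) (n - m))
          (\big[@wedge R n/@one_form R n]_(j < m - p - q)
              form11 (alpha (widen_ord (leqnSn _) j))) in
  let Q (Phi Psi : cform R n) : R[i] :=
    exprz (@iC R) (q%:Z - p%:Z) * (-1) ^+ ((p + q) * (p + q).+1 %/ 2)
    * top_ratio (wedge (wedge Omega Phi) (conj_form Psi)) Gamma in
  forall Phi : cform R n,
    is_pq p q Phi ->
    wedge (wedge Omega (form11 (alpha ord_max))) Phi = 0 ->
    Phi != 0 ->
    0 < Q Phi Phi.
Proof.
move=> hpq hmn hw pw ha [g [g0 eG]] Omega Q Phi hPhi Phi0 nz.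
(* The alphas come before the copies of omega: with [alpha ord_max] in front they fill the positions
   that ask for ranks p + q, ..., m, and omega of rank n serves all later ones. The order does not
   affect the product, since (1,1)-forms are central. *)
pose bs := [seq alpha (widen_ord (leqnSn _) j) | j <- index_enum 'I_(m - p - q)]
  ++ nseq (n - m) w.
have eOm : Omega = fprod bs :> extalg R n.
  rewrite /Omega wedge_extE wpow_extE form11_extE big_wedge_extE /bs.
  rewrite /fprod big_cat big_map /= -[\prod_(i <- nseq _ _) _]/(fprod _).
  under eq_bigr do rewrite form11_extE.
  rewrite fprod_central; congr (_ * _).
  by elim: (n - m)%N => [|k IH]; rewrite ?fprod_nil // fprod_cons -IH exprS.
have pa j : psdmx (alpha j) /\ (m <= \rank (alpha j))%N.
  have [h1 [h2 h3]] := ha j; have pj := is_psdP h1 h2.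
  by split=> //; apply: m_positive_rank h3.
have szI : size (index_enum 'I_(m - p - q)) = (m - p - q)%N.
  by rewrite [index_enum _]unlock -enumT size_enum_ord.
have szb : size bs = (m - p - q + (n - m))%N.
  by rewrite size_cat size_map size_nseq szI.
have gb : good (p + q) (alpha ord_max :: bs).
  rewrite -cat_cons; apply: good_cat.
    apply: (@good_le _ _ _ m) => [h|]; last first.
      by rewrite /= size_map szI; lia.
    by rewrite inE => /orP[/eqP ->|/mapP[j _ ->]].
  apply: (@good_le _ _ _ n) => [h|].
    rewrite mem_nseq => /andP[_ /eqP ->].
    have pw' := is_posdefP pw; rewrite (posmx_rank pw'); split=> //.
    exact: posmx_psd (is_hermitianP hw) pw'.
  by rewrite /= size_map szI size_nseq; lia.
have hPhi' : pq p q (Phi : extalg R n).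
  by apply/pqP => I; rewrite cfE; apply: hPhi.
have Phi0' : fprod (alpha ord_max :: bs) * (Phi : extalg R n) = 0.
  by rewrite fprod_cons -hform_central -eOm -form11_extE -!wedge_extE Phi0 zero_extE.
have nz' : (Phi : extalg R n) != 0 by rewrite -zero_extE.
have szn : (p + q + size bs = n)%N by rewrite szb; lia.
have := hrr_all szn gb hPhi' Phi0' nz'.
rewrite -eOm -conj_form_extE -!wedge_extE /vc cfE => main.
rewrite /Q /top_ratio eG scale_extE std_vol_extE.
rewrite -[X in _ / X]cfE !cfZ cf_eb eqxx mulr1 invfM.
move: main; rewrite -/(eps R p q); move: (wedge _ _ _) (eps R p q) => X E main.
(* Gamma is [g] times the standard volume form with [g] positive, so [Q] is the value already known
   to be positive, rescaled by [g^-1]. *)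
have -> : E * (X * (g^-1 / iC R ^+ n)) = g^-1 * (E * (X / iC R ^+ n)) by ring.
by rewrite pmulr_rgt0 ?invr_gt0.
Qed.
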